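(* Let $\beta>0$ be a real number and let $f\in C^1([0,1])$. For every $\varepsilon\in(0,1)$ let $u_\varepsilon\in H^2((0,1))$ be a minimizer over $H^2((0,1))$ of the functional $\mathbb{PMF}_\varepsilon(\beta,f,(0,1),\cdot)$, and let $x_\varepsilon\in(0,1)$ be points such that $x_\varepsilon\to x_0\in(0,1)$ as $\varepsilon\to 0^+$. Let $$v_\varepsilon(y):=\frac{u_\varepsilon(x_\varepsilon+\omega(\varepsilon)y)-u_\varepsilon(x_\varepsilon)}{\omega(\varepsilon)}.$$ Assume that $f'(x_0)\neq 0$, set $$H:=\left(\frac{24}{\beta^2|f'(x_0)|^3}\right)^{1/5},\qquad V:=f'(x_0)H,$$ and assume that, as $\varepsilon\to 0^+$, $v_\varepsilon$ converges locally strictly in $BV_{\mathrm{loc}}(\mathbb{R})$ to the function $y\mapsto S_{H,V}(y-H)+V$. Then, as $\varepsilon\to0^+$, the functions $y\mapsto v_\varepsilon(\varepsilon^2y)$ converge to $C_{\Lambda,V}(y)$ strongly in $H^2_{\mathrm{loc}}(\mathbb{R})$ (that is, strongly in $H^2((a,b))$ for every bounded interval $(a,b)$), where $$\Lambda:=\frac{\sqrt3}{2}\sqrt{2|V|}.$$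
   Context: For $\varepsilon\in(0,1)$ set $\omega(\varepsilon):=\varepsilon|\log\varepsilon|^{1/2}$. For $\beta>0$, $f\in L^2((0,1))$ and $u\in H^2((0,1))$, $$\mathbb{PMF}_\varepsilon(\beta,f,(0,1),u):=\int_0^1\left\{\varepsilon^6\omega(\varepsilon)^4u''(x)^2+\log\left(1+u'(x)^2\right)+\beta(u(x)-f(x))^2\right\}dx.$$ Staircases: let $S(x):=2\left\lfloor\frac{x+1}{2}\right\rfloor$ for $x\in\mathbb{R}$. For real numbers $H>0$ and $V$, the canonical $(H,V)$-staircase is $S_{H,V}(x):=V\cdot S(x/H)$, $x\in\mathbb{R}$. Cubic connection: for $\Lambda>0$ and $V\neq0$, $C_{\Lambda,V}:\mathbb{R}\to\mathbb{R}$ is defined by $C_{\Lambda,V}(x)=-V$ if $x\le-\Lambda$, $C_{\Lambda,V}(x)=\frac{V}{2\Lambda^3}(3\Lambda^2x-x^3)$ if $x\in[-\Lambda,\Lambda]$, and $C_{\Lambda,V}(x)=V$ if $x\ge\Lambda$. Strict convergence: functions $v_\varepsilon\in BV((a,b))$ converge strictly to $v_0\in BV((a,b))$ if $v_\varepsilon\to v_0$ in $L^1((a,b))$ and the total variation of $v_\varepsilon$ in $(a,b)$ converges to the total variation of $v_0$ in $(a,b)$. Locally strict convergence in $BV_{\mathrm{loc}}(\mathbb{R})$ to a function $v_0$ defined on $\mathbb{R}$ means strict convergence in $BV((a,b))$ for every bounded interval $(a,b)$ whose endpoints are not jump points of $v_0$ (where $v_\varepsilon$ needs to be defined on $(a,b)$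 only for $\varepsilon$ small enough, depending on the interval). The function $v_\varepsilon(y)$ is defined for those $y$ with $x_\varepsilon+\omega(\varepsilon)y\in(0,1)$; on any bounded interval both $v_\varepsilon(y)$ and $v_\varepsilon(\varepsilon^2y)$ are defined for $\varepsilon$ small enough. *)

(* Defs.v *)
From HB Require Import structures.
From mathcomp Require Import all_boot all_order all_algebra.
From mathcomp Require Import all_classical all_reals all_analysis.

Set Implicit Arguments.
Unset Strict Implicit.
Unset Printing Implicit Defensive.

Import Order.TTheory GRing.Theory Num.Theory.
Import numFieldNormedType.Exports.
Local Open Scope ring_scope.
Local Open Scope classical_set_scope.

(** Functions on an interval are represented by total functions [R -> R] whose
    values outside the interval are never used.  Membership in [L2], [H2], [BV]
    and the integrals below depend only on the almost-everywhere class. *)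

Section FunctionSpaces.
Context {R : realType}.
Local Notation mu := (@lebesgue_measure R).
Implicit Types (a b : R) (u v w g f phi : R -> R).

(** C^1([a,b]) *)
Definition C1_closed a b f :=
  exists g : R -> R,
    [/\ {within `[a, b], continuous f}, {within `[a, b], continuous g} &
        forall x, a < x < b -> is_derive x 1 f (g x)].

Definition L2 a b u :=
  measurable_fun `]a, b[ u /\ mu.-integrable `]a, b[ (fun x => (u x ^+ 2)%:E).

(** C^1_c((a,b)), each element being extended by zero to R *)
Definition test_function a b phi :=
  [/\ (forall x, derivable phi x 1), continuous (derive1 phi),
      compact (closure [set x | phi x != 0]) &
      closure [set x | phi x != 0] `<=` `]a, b[].

Definition is_weak_derivative a b u g :=
  [/\ locally_integrable `]a, b[ u, locally_integrable `]a, b[ g &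
      forall phi, test_function a b phi ->
        \int[mu]_(x in `]a, b[) (u x * derive1 phi x) =
        - \int[mu]_(x in `]a, b[) (g x * phi x)].

(** A chosen representative of the weak derivative, which is unique up to
    almost everywhere equality; a junk value if there is none. *)
Definition weakD a b u : R -> R :=
  xget (fun=> 0) [set g | is_weak_derivative a b u g].

Definition H2 a b u :=
  exists g1 g2, [/\ L2 a b u, L2 a b g1, L2 a b g2,
    is_weak_derivative a b u g1 & is_weak_derivative a b g1 g2].

(** The squared norm of H^2((a,b)); meaningful on [H2 a b] only. *)
Definition H2_normsq a b u : \bar R :=
  (\int[mu]_(x in `]a, b[)
     (u x ^+ 2 + weakD a b u x ^+ 2 + weakD a b (weakD a b u) x ^+ 2)%:E)%E.

(** |Dv|((a,b)) in the sense of distributions, which is insensitive to the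
    choice of a representative, unlike the pointwise [total_variation]. *)
Definition BV_variation a b v : \bar R :=
  ereal_sup [set (\int[mu]_(x in `]a, b[) (v x * derive1 phi x))%:E | phi in
    [set phi | test_function a b phi /\ forall x, `|phi x| <= 1]].

Definition BV a b v :=
  mu.-integrable `]a, b[ (EFin \o v) /\ (BV_variation a b v < +oo)%E.

(** In the two notions of convergence below, the family is indexed by
    a parameter tending to 0 from the right. *)

Definition BV_strict_cvg a b (v : R -> R -> R) v0 :=
  [/\ BV a b v0,
      \forall e \near 0^'+, BV a b (v e),
      (\int[mu]_(y in `]a, b[) `|v e y - v0 y|%:E)%E @[e --> 0^'+] --> 0%E &
      BV_variation a b (v e) @[e --> 0^'+] --> BV_variation a b v0].

Definition jump_point v (y : R) :=
  exists l r : R, [/\ l != r, v z @[z --> y^'-] --> l & v z @[z --> y^'+] --> r].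

Definition BVloc_strict_cvg (v : R -> R -> R) v0 :=
  forall a b, a < b -> ~ jump_point v0 a -> ~ jump_point v0 b ->
    BV_strict_cvg a b v v0.

Definition H2_cvg a b (v : R -> R -> R) v0 :=
  [/\ H2 a b v0, \forall e \near 0^'+, H2 a b (v e) &
      H2_normsq a b (v e \- v0) @[e --> 0^'+] --> 0%E].

Definition H2loc_cvg (v : R -> R -> R) v0 :=
  forall a b, a < b -> H2_cvg a b v v0.

End FunctionSpaces.

Section PeronaMalik.
Context {R : realType}.
Local Notation mu := (@lebesgue_measure R).
Implicit Types (eps beta a b H V L x : R) (u f : R -> R).

Definition omega eps : R := eps * Num.sqrt `|ln eps|.

Definition PMF eps beta f a b u : \bar R :=
  (\int[mu]_(x in `]a, b[)
     (eps ^+ 6 * omega eps ^+ 4 * weakD a b (weakD a b u) x ^+ 2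
      + ln (1 + weakD a b u x ^+ 2)
      + beta * (u x - f x) ^+ 2)%:E)%E.

Definition PMF_minimizer eps beta f a b u :=
  H2 a b u /\
  forall w, H2 a b w -> (PMF eps beta f a b u <= PMF eps beta f a b w)%E.

Definition stair x : R := 2 * (Num.floor ((x + 1) / 2))%:~R.

Definition canonical_staircase H V x : R := V * stair (x / H).

Definition cubic_connection L V x : R :=
  if x <= - L then - V
  else if x <= L then V / (2 * L ^+ 3) * (3 * L ^+ 2 * x - x ^+ 3)
  else V.

Definition blow_up (u : R -> R -> R) (xe : R -> R) eps (y : R) : R :=
  (u eps (xe eps + omega eps * y) - u eps (xe eps)) / omega eps.

End PeronaMalik.

(* Main.v *)
Require Import Defs.
From HB Require Import structures.
From mathcomp Require Import all_boot all_order all_algebra.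
From mathcomp Require Import all_classical all_reals all_analysis.
From mathcomp Require Import interval_inference real_interval measurable_realfun ring lra.

(** The blow-up at the smaller scale is w(y) = v_eps(eps^2 y).  Up to the factor
|ln eps|, the functional is in this scale the integral of
  w''^2 + psi_eps(w') + beta eps^2 (w - datum)^2,
where psi_eps(t) = ln(1 + t^2/eps^4)/|ln eps| vanishes at 0 and tends to 4 at
every other t.  In the limit one pays w''^2 plus four times the length of the
set where w is not flat.  Climbing from -V to V on [-L, L] then costs at least
6 V^2/L^3 + 8 L, with equality for the cubic connection only, and the sum is
minimal, with value 32 Lambda/3, exactly when L = Lambda.  The theorem is the
stability of this minimization problem.

Upper bound.  The limit staircase jumps from -V to V at the origin and is flat
on both sides, so strict convergence provides points A < 0 < B, at distance of
order eps^-2 from the origin, where w is close to -V and V and w' = O(eps^2)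
([near_endpoints]).  A competitor with the same values and slopes at A and B,
flat except for short ends and one cubic transition, has almost the energy
32 Lambda/3.  The fidelity term is delicate, since the difference between datum
and w at the origin is uncontrolled: placing the cubic so that competitor and
minimizer have equal integrals makes this unknown constant disappear
([energy_upper_bound], [transition_energy_le]).

Lower bound.  Each half-line is treated separately ([half_transition]).  Up to
the first point where the slope is below a small threshold, integration by
parts and the Cauchy-Schwarz inequality relate the climbed height to the
energy; later excursions above the threshold are less efficient by a fixed
factor, and slopes below the threshold contribute a negligible height because
the well is steep at 0 ([small_slopes_mass]).  A half transition hence costs at
least 16 Lambda/3 up to a small error.  The two lower bounds add up to the upper
bound, so both halves are almost optimal, and then w'' is close in L^2 to the
second derivative of the cubic connection, and w' is small at Lambda
([two_sided_connection]).  Since w(0) = 0, integrating twice gives closeness in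
H^2 on every bounded interval ([connection_stability]).

These arguments need pointwise values and classical calculus.  A function of
class H^2 is therefore replaced by a triple made of a continuous representative
and its first two derivatives, linked by integration ([h2rep], [H2_h2rep]);
gluing such triples gives the competitors in H^2. *)

Import Order.TTheory GRing.Theory Num.Theory.
Import numFieldNormedType.Exports.
Local Open Scope ring_scope.
Local Open Scope classical_set_scope.
Set Implicit Arguments.
Unset Strict Implicit.
Unset Printing Implicit Defensive.

(** * Continuity and integrals over compact intervals *)
Section Continuity.
Context {R : realType}.
Implicit Types f g : R -> R.

Lemma ctsD f g : continuous f -> continuous g -> continuous (fun x => f x + g x).
Proof. by move=> cf cg x; apply: (continuousD (cf x) (cg x)). Qed.

Lemma ctsB f g : continuous f -> continuous g -> continuous (fun x => f x - g x).
Proof. by move=> cf cg x; apply: (continuousB (cf x) (cg x)). Qed.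

Lemma ctsM f g : continuous f -> continuous g -> continuous (fun x => f x * g x).
Proof. by move=> cf cg x; apply: (continuousM (cf x) (cg x)). Qed.

Lemma ctsN f : continuous f -> continuous (fun x => - f x).
Proof. by move=> cf x; apply: (continuousN (cf x)). Qed.

Lemma cts_cst (k : R) : continuous (fun _ : R => k).
Proof. by move=> x; apply: cvg_cst. Qed.

Lemma cts_id : continuous (fun x : R => x).
Proof. by move=> x; apply: cvg_id. Qed.

Lemma ctsX f n : continuous f -> continuous (fun x => f x ^+ n).
Proof.
move=> cf; elim: n => [|n IH].
  have -> : (fun x => f x ^+ 0) = (fun=> 1) by apply/funext => x; rewrite expr0.
  exact: cts_cst.
have -> : (fun x => f x ^+ n.+1) = (fun x => f x * f x ^+ n).
  by apply/funext => x; rewrite exprS.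
exact: ctsM.
Qed.

Lemma cts_comp f g : continuous f -> continuous g -> continuous (fun x => g (f x)).
Proof. by move=> cf cg x; apply: (continuous_comp (cf x) (cg (f x))). Qed.

Lemma cts_norm f : continuous f -> continuous (fun x => `|f x|).
Proof. by move=> cf; apply: (cts_comp cf); apply: norm_continuous. Qed.

End Continuity.

Section IntervalIntegral.
Context {R : realType}.
Local Notation mu := (@lebesgue_measure R).
Implicit Types (f g h P : R -> R) (a b c x y : R).

Definition Int f a b : R := \int[mu]_(x in `[a, b]) f x.

Definition locint f := forall a b, mu.-integrable `[a, b] (EFin \o f).

Lemma continuous_locint f : continuous f -> locint f.
Proof.
move=> cf a b; apply: continuous_compact_integrable; first exact: segment_compact.
exact: continuous_subspaceT.
Qed.

Lemma locint_measurable f : locint f -> measurable_fun setT f.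
Proof.
move=> lf; have -> : setT = \bigcup_n `[(- n%:R : R), n%:R]%classic.
  apply/esym/seteqP; split => // x _.
  have [n xn] : exists n : nat, `|x| < n%:R.
    by exists (Num.truncn `|x|).+1; rewrite truncnS_gt.
  by exists n => //=; rewrite in_itv/= -ler_norml ltW.
apply/measurable_fun_bigcup => // n.
by have /integrableP[/measurable_EFinP] := lf (- n%:R) n%:R.
Qed.

Lemma locintD f g : locint f -> locint g -> locint (fun x => f x + g x).
Proof. by move=> lf lg a b; apply: (integrableD _ (lf a b) (lg a b)). Qed.

Lemma locintN f : locint f -> locint (fun x => - f x).
Proof. by move=> lf a b; apply: (integrableN (lf a b)). Qed.

Lemma locintB f g : locint f -> locint g -> locint (fun x => f x - g x).
Proof. by move=> lf lg; apply: locintD => //; apply: locintN. Qed.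

Lemma locintZ k f : locint f -> locint (fun x => k * f x).
Proof. by move=> lf a b; apply: (integrableZl _ k (lf a b)). Qed.

Lemma locint_norm f : locint f -> locint (fun x => `|f x|).
Proof. by move=> lf a b; apply: (integrable_norm (lf a b)). Qed.

Lemma le_locint f g : measurable_fun setT f -> locint g ->
  (forall x, `|f x| <= g x) -> locint f.
Proof.
move=> mf lg fg a b; apply: (le_integrable _ _ _ (lg a b)) => //=.
  by apply/measurable_EFinP; apply: measurable_funS mf.
by move=> x _; rewrite lee_fin (le_trans (fg x))// ler_norm.
Qed.

Lemma locintM_continuous f h : locint f -> continuous h -> locint (fun x => f x * h x).
Proof.
move=> lf ch a b.
have ab : measurable (`[a, b] : set R) by exact: measurable_itv.
have [M [_ hM]] := compact_bounded (continuous_compact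
  (continuous_subspaceT (A := `[a, b]) ch) (segment_compact (a := a) (b := b))).
pose K := `|M| + 1.
apply: (le_integrable _ _ _ (locintZ K (locint_norm lf) a b)) => //.
  apply/measurable_EFinP; apply: measurable_funM.
    by have /integrableP[/measurable_EFinP] := lf a b.
  by apply: measurable_funS (continuous_measurable_fun ch).
move=> x abx; rewrite /= lee_fin normrM [leRHS]ger0_norm; last first.
  by rewrite mulr_ge0// /K; have := normr_ge0 M; lra.
rewrite mulrC ler_wpM2r//; apply: hM; last by exists x.
by rewrite /K; have := ler_norm M; lra.
Qed.

Lemma eq_Int f g a b : (forall x, a <= x <= b -> f x = g x) -> Int f a b = Int g a b.
Proof. by move=> fg; apply: eq_Rintegral => x; rewrite inE/= in_itv/=; exact: fg. Qed.

Lemma IntD f g a b : locint f -> locint g ->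
  Int (fun x => f x + g x) a b = Int f a b + Int g a b.
Proof. by move=> lf lg; rewrite /Int RintegralD. Qed.

Lemma IntB f g a b : locint f -> locint g ->
  Int (fun x => f x - g x) a b = Int f a b - Int g a b.
Proof. by move=> lf lg; rewrite /Int RintegralB. Qed.

Lemma IntZ k f a b : locint f -> Int (fun x => k * f x) a b = k * Int f a b.
Proof. by move=> lf; rewrite /Int RintegralZl. Qed.

Lemma IntN f a b : locint f -> Int (fun x => - f x) a b = - Int f a b.
Proof.
by move=> lf; rewrite -mulN1r -IntZ//; apply: eq_Int => x _; rewrite mulN1r.
Qed.

Lemma Int_cst k a b : a <= b -> Int (fun=> k) a b = k * (b - a).
Proof.
move=> ab; rewrite /Int Rintegral_cst//= lebesgue_measure_itv/= lte_fin.
case: ltP => [//|ba]; have -> : a = b by apply/eqP; rewrite eq_le ab.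
by rewrite subrr.
Qed.

Lemma Int_aa f a : Int f a a = 0.
Proof. by rewrite /Int set_itv1 Rintegral_set1. Qed.

Lemma le_Int f g a b : locint f -> locint g ->
  (forall x, a <= x <= b -> f x <= g x) -> Int f a b <= Int g a b.
Proof. by move=> lf lg fg; apply: le_Rintegral. Qed.

Lemma Int_ge0 f a b : (forall x, a <= x <= b -> 0 <= f x) -> 0 <= Int f a b.
Proof. by move=> f0; apply: Rintegral_ge0. Qed.

Lemma normr_Int f a b : locint f -> `|Int f a b| <= Int (fun x => `|f x|) a b.
Proof. by move=> lf; apply: le_normr_Rintegral. Qed.

Lemma Int_chasles f a b c : locint f -> a <= b -> b <= c ->
  Int f a c = Int f a b + Int f b c.
Proof.
move=> lf ab bc.
have := @Rintegral_itvB R f (BLeft a) (BRight c) b (lf a c).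
rewrite !bnd_simp => /(_ ab bc) H.
rewrite /Int -[X in _ + X]Rintegral_itv_obnd_cbnd; last first.
  by apply: integrableS (lf b c) => //; apply: subset_itvr; rewrite bnd_simp.
by rewrite -H addrC subrK.
Qed.

Lemma Int_sub f a b c d : locint f -> (forall x, a <= x <= d -> 0 <= f x) ->
  a <= b -> b <= c -> c <= d -> Int f b c <= Int f a d.
Proof.
move=> lf f0 ab bc cd.
rewrite (@Int_chasles f a b d)// ?(le_trans bc)// (@Int_chasles f b c d)//.
have := @Int_ge0 f a b; have := @Int_ge0 f c d.
have H1 : forall x, a <= x <= b -> 0 <= f x.
  by move=> x /andP[ax xb]; apply: f0; rewrite ax (le_trans xb)// (le_trans bc).
have H2 : forall x, c <= x <= d -> 0 <= f x.
  by move=> x /andP[cx xd]; apply: f0; rewrite xd andbT (le_trans _ cx)// (le_trans ab).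
by move=> /(_ H2) ? /(_ H1) ?; lra.
Qed.

Lemma is_derive_continuous f (df : R -> R) : (forall x, is_derive x 1 f (df x)) ->
  continuous f.
Proof.
move=> H x; apply: differentiable_continuous; apply/derivable1_diffP.
by have [] := H x.
Qed.

Lemma Int_FTC f (F : R -> R) a b : a <= b -> continuous f ->
  (forall x, is_derive x 1 F (f x)) -> Int f a b = F b - F a.
Proof.
rewrite le_eqVlt => /predU1P[<- _ _|ab cf dF]; first by rewrite Int_aa subrr.
rewrite /Int /Rintegral (@continuous_FTC2 _ _ F)//.
- exact: continuous_subspaceT.
- have cF := is_derive_continuous dF; split.
  + by move=> x _; have [] := dF x.
  + exact: cvg_at_right_filter (cF a).
  + exact: cvg_at_left_filter (cF b).
- by move=> x _; rewrite derive1E; have [] := dF x.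
Qed.

Lemma Int_continuous f a b : a <= b -> locint f ->
  {within `[a, b], continuous (Int f a)}.
Proof. by move=> ab lf; have := parameterized_integral_continuous ab (lf a b). Qed.

Definition L2loc g := measurable_fun setT g /\ locint (fun x => g x ^+ 2).

Lemma L2loc_locint g : L2loc g -> locint g.
Proof.
move=> [mg lg]; apply: (@le_locint _ (fun x => 1 + g x ^+ 2)) => //.
  by apply: locintD => //; apply: continuous_locint => x; apply: cvg_cst.
move=> x; rewrite -(real_normK (num_real (g x))); have := normr_ge0 (g x).
set t := `|g x|; move=> ?; nra.
Qed.

Lemma L2locM f g : L2loc f -> L2loc g -> locint (fun x => f x * g x).
Proof.
move=> [mf lf] [mg lg]; apply: (@le_locint _ (fun x => f x ^+ 2 + g x ^+ 2)).
- exact: measurable_funM.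
- exact: locintD.
- move=> x; rewrite -(real_normK (num_real (g x))) -(real_normK (num_real (f x))).
  rewrite normrM; have := normr_ge0 (g x); have := normr_ge0 (f x).
  set t := `|g x|; set s := `|f x|; move=> ? ?; nra.
Qed.

Lemma L2locD f g : L2loc f -> L2loc g -> L2loc (fun x => f x + g x).
Proof.
move=> Lf Lg; have [mf lf] := Lf; have [mg lg] := Lg.
split; first exact: measurable_funD.
have -> : (fun x => (f x + g x) ^+ 2) =
    (fun x => (f x ^+ 2 + 2 * (f x * g x)) + g x ^+ 2).
  by apply/funext => x; ring.
by do 2 (apply: locintD => //); apply: locintZ; apply: L2locM.
Qed.

Lemma L2locZ k f : L2loc f -> L2loc (fun x => k * f x).
Proof.
move=> [mf lf]; split; first by apply: measurable_funM.
have -> : (fun x => (k * f x) ^+ 2) = (fun x => k ^+ 2 * f x ^+ 2).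
  by apply/funext => x; ring.
exact: locintZ.
Qed.

Lemma continuous_L2loc f : continuous f -> L2loc f.
Proof.
move=> cf; split; first exact: continuous_measurable_fun.
by apply: continuous_locint; apply: ctsX.
Qed.

Lemma cauchy_schwarz f g a b : a <= b -> L2loc f -> L2loc g ->
  Int (fun x => f x * g x) a b ^+ 2 <=
  Int (fun x => f x ^+ 2) a b * Int (fun x => g x ^+ 2) a b.
Proof.
move=> ab Lf Lg; have [mf lf] := Lf; have [mg lg] := Lg.
have lfg := L2locM Lf Lg.
set p := Int _ a b; set q := Int _ a b; set r := Int _ a b.
have H k : 0 <= q + 2 * k * p + k ^+ 2 * r.
  have -> : q + 2 * k * p + k ^+ 2 * r = Int (fun x => (f x + k * g x) ^+ 2) a b.
    have l1 := locintZ (2 * k) lfg; have l2 := locintZ (k ^+ 2) lg.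
    rewrite /p /q /r -(IntZ (2 * k))// -(IntZ (k ^+ 2))// -IntD// -IntD//; last exact: locintD.
    by apply: eq_Int => x _; ring.
  by apply: Int_ge0 => x _; apply: sqr_ge0.
have q0 : 0 <= q by apply: Int_ge0 => x _; apply: sqr_ge0.
have r0 : 0 <= r by apply: Int_ge0 => x _; apply: sqr_ge0.
move: r0; rewrite le_eqVlt => /predU1P[r0|r0].
  rewrite -r0 mulr0; have [->|p0] := eqVneq p 0; first by rewrite expr0n.
  have := H (- (q + 1) / (2 * p)); rewrite -r0 mulr0 addr0.
  have -> : 2 * (- (q + 1) / (2 * p)) * p = - (q + 1) by field.
  lra.
have := H (- p / r).
have -> : q + 2 * (- p / r) * p + (- p / r) ^+ 2 * r = (q * r - p ^+ 2) / r.
  by field; rewrite gt_eqF.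
by rewrite pmulr_lge0 ?invr_gt0// subr_ge0.
Qed.

End IntervalIntegral.

(** * Primitives and integration by parts *)
Section AbsoluteContinuity.
Context {R : realType}.
Local Notation mu := (@lebesgue_measure R).
Implicit Types (f g h P : R -> R) (a b c x y : R).

(** Absolute continuity with density [g], expressed by the integral formula so
that no differentiability almost everywhere is involved. *)
Definition primitive g P := locint g /\ forall x y, x <= y -> P y - P x = Int g x y.

(** Subdividing [a, b] into n intervals of equal length and summing bounds the
total increment of D by C (b - a) (N b - N a)/n.  This replaces the theorem that
an absolutely continuous function with zero derivative is constant. *)
Lemma increments_cst (D N : R -> R) C a b : a <= b ->
  (forall x y, a <= x -> x <= y -> y <= b ->
    `|D y - D x| <= C * (y - x) * (N y - N x)) -> D b = D a.
Proof.
move=> ab H; apply/eqP; rewrite -subr_eq0 -normr_le0; apply/negPn/negP.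
rewrite -ltNge => D0; pose K := C * (b - a) * (N b - N a).
have [n Kn] : exists n : nat, K / `|D b - D a| < n.+1%:R.
  exists (Num.truncn `|K / `|D b - D a| |).
  by rewrite (le_lt_trans (ler_norm _))// truncnS_gt.
pose d := (b - a) / n.+1%:R; have d0 : 0 <= d by rewrite divr_ge0// subr_ge0.
have dn : n.+1%:R * d = b - a by rewrite /d mulrCA divff ?mulr1// pnatr_eq0.
have step k : (k <= n.+1)%N ->
    `|D (a + k%:R * d) - D a| <= C * d * (N (a + k%:R * d) - N a).
  elim: k => [_|k IH kn]; first by rewrite mul0r addr0 !subrr normr0 mulr0.
  have -> : D (a + k.+1%:R * d) - D a =
    (D (a + k.+1%:R * d) - D (a + k%:R * d)) + (D (a + k%:R * d) - D a) by ring.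
  apply: (le_trans (ler_normD _ _)).
  have -> : C * d * (N (a + k.+1%:R * d) - N a) =
    C * d * (N (a + k.+1%:R * d) - N (a + k%:R * d)) +
    C * d * (N (a + k%:R * d) - N a) by ring.
  apply: lerD; last exact/IH/ltnW.
  have -> : C * d = C * ((a + k.+1%:R * d) - (a + k%:R * d)).
    by rewrite -natr1; ring.
  apply: H.
  - by rewrite lerDl mulr_ge0.
  - by rewrite lerD2l ler_wpM2r// ler_nat.
  - have -> : b = a + n.+1%:R * d by rewrite dn; ring.
    by rewrite lerD2l ler_wpM2r// ler_nat.
have := step n.+1 (leqnn _); rewrite dn (_ : a + (b - a) = b); last by ring.
move: Kn; rewrite ltr_pdivrMr// => Kn H1.
have : n.+1%:R * `|D b - D a| <= K.
  rewrite /K -dn (_ : C * _ * _ = n.+1%:R * (C * d * (N b - N a))); last by ring.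
  by rewrite ler_pM2l.
by rewrite leNgt Kn.
Qed.

Lemma primitive_continuous g P : primitive g P -> continuous P.
Proof.
move=> [lg gP] x.
have ab : x - 1 < x + 1 by lra.
suff W : {within `[x - 1, x + 1], continuous P}.
  have [+ _ _] := (continuous_within_itvP P ab).1 W; apply.
  by rewrite in_itv/=; apply/andP; split; lra.
have H y : x - 1 <= y -> P (x - 1) + Int g (x - 1) y = P y.
  by move=> xy; rewrite -gP//; ring.
have x1 : x - 1 <= x + 1 by lra.
apply: (subspace_eq_continuous (f := fun y => P (x - 1) + Int g (x - 1) y)).
  by move=> y; rewrite inE/= in_itv/= => /andP[xy _]; apply: H.
move=> y; apply: (@continuousD R R _ _ _ _); first exact: cvg_cst.
exact: Int_continuous.
Qed.

(** The difference of the two sides, as a function of the right endpoint, has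
increments bounded by the length of the interval times the integral of |g|,
so [increments_cst] applies. *)
Lemma primitive_by_parts g P h dh a b : a <= b -> primitive g P ->
  (forall x, is_derive x 1 h (dh x)) -> continuous dh ->
  Int (fun x => P x * dh x) a b =
    P b * h b - P a * h a - Int (fun x => g x * h x) a b.
Proof.
move=> ab gP dhE cdh; have [lg E] := gP.
have ch := is_derive_continuous dhE; have cP := primitive_continuous gP.
have cPdh : continuous (fun x => P x * dh x) by exact: ctsM.
have lPdh := continuous_locint cPdh.
have lgh := locintM_continuous lg ch.
have lng := locint_norm lg.
have [M [_ hM]] := compact_bounded (continuous_compact
  (continuous_subspaceT (A := `[a, b]) (f := dh) cdh) (segment_compact (a := a) (b := b))).
pose K := `|M| + 1; have K0 : 0 <= K by rewrite /K; have := normr_ge0 M; lra.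
have dhK x : a <= x <= b -> `|dh x| <= K.
  move=> xab; apply: (hM K); last by exists x.
  by rewrite /K; have := ler_norm M; lra.
(* the claim is that D takes the same value at a and at b *)
pose D x := Int (fun x => P x * dh x) a x + Int (fun x => g x * h x) a x - P x * h x.
pose N x := Int (fun x => `|g x|) a x.
suff : D b = D a by rewrite /D !Int_aa => ?; lra.
apply: (increments_cst (N := N) (C := 2 * K)) => // x y ax xy yb.
have -> : N y - N x = Int (fun x => `|g x|) x y.
  by rewrite /N (@Int_chasles _ _ a x y)//; ring.
have -> : D y - D x = Int (fun t => g t * (h t - h y)) x y
    + Int (fun t => (P t - P x) * dh t) x y.
  have -> : D y - D x = Int (fun x => P x * dh x) x y
      + Int (fun x => g x * h x) x y - (P y * h y - P x * h x).
    by rewrite /D !(@Int_chasles _ _ a x y)//; ring.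
  have -> : P y * h y - P x * h x = (P y - P x) * h y + P x * (h y - h x) by ring.
  rewrite E// -(Int_FTC xy cdh)//.
  rewrite [RHS](_ : _ = (Int (fun t => g t * h t) x y - Int (fun t => h y * g t) x y) +
    (Int (fun t => P t * dh t) x y - Int (fun t => P x * dh t) x y)).
    by rewrite !IntZ//; [ring|exact: continuous_locint].
  have l1 := locintZ (h y) lg; have l2 := locintZ (P x) (continuous_locint cdh).
  rewrite -!IntB//; congr (_ + _); apply: eq_Int => t _; ring.
apply: (le_trans (ler_normD _ _)).
rewrite (_ : 2 * K * (y - x) * Int _ x y = K * (y - x) * Int (fun t => `|g t|) x y +
  K * (y - x) * Int (fun t => `|g t|) x y); last by ring.
have chy : continuous (fun t => h t - h y).
  by apply: ctsB => //; exact: cts_cst.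
have cPx : continuous (fun t => (P t - P x) * dh t).
  by apply: ctsM => //; apply: ctsB => //; exact: cts_cst.
apply: lerD.
- have l1 := locintM_continuous lg chy.
  apply: (le_trans (normr_Int _ _ l1)).
  rewrite -IntZ//; apply: le_Int; [exact: locint_norm|exact: locintZ|].
  move=> t /andP[xt ty]; rewrite normrM [leLHS]mulrC; apply: ler_wpM2r => //.
  have [c] := @MVT_segment R h dh t y ty (fun z _ => dhE z) (continuous_subspaceT ch).
  rewrite in_itv/= => /andP[tc cy] hE.
  rewrite distrC hE normrM (ger0_norm (x := y - t)) ?subr_ge0//.
  apply: ler_pM => //; first by rewrite subr_ge0.
    by apply: dhK; rewrite (le_trans ax)//= ?(le_trans xt)// (le_trans cy).
  by rewrite lerD2l lerN2.
- apply: (le_trans (normr_Int _ _ (continuous_locint cPx))).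
  have -> : K * (y - x) * Int (fun t => `|g t|) x y =
      Int (fun=> K * Int (fun t => `|g t|) x y) x y by rewrite Int_cst//; ring.
  apply: le_Int; [exact/locint_norm/continuous_locint|exact/continuous_locint/cst_continuous|].
  move=> t /andP[xt ty]; rewrite normrM [leRHS]mulrC.
  apply: ler_pM => //; last by apply: dhK; rewrite (le_trans ax xt) (le_trans ty yb).
  rewrite E//; apply: (le_trans (normr_Int _ _ lg)).
  rewrite (@Int_chasles _ (fun t => `|g t|) x t y)// lerDl.
  by apply: Int_ge0 => ? _.
Qed.

End AbsoluteContinuity.

(** * Affine changes of variables *)
Section ChangeOfVariables.
Context {R : realType}.
Local Notation mu := (@lebesgue_measure R).
Implicit Types (f : R -> R) (a b c k : R).

Section scaling_map.
Variables (phi : measurableTypeR R -> measurableTypeR R) (K : {nonneg R}).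
Hypothesis mphi : measurable_fun setT phi.
Hypothesis phiK : forall A, measurable A -> mu (phi @^-1` A) = ((K%:num)%:E * mu A)%E.

Let ge0_integral_scaling (D : set (measurableTypeR R)) (F : R -> \bar R) : measurable D ->
  measurable_fun setT F -> (forall x, 0 <= F x)%E ->
  (\int[mu]_(x in phi @^-1` D) F (phi x) = (K%:num)%:E * \int[mu]_(x in D) F x)%E.
Proof.
move=> mD mF F0.
have mFD : measurable_fun D F by apply: measurable_funS mF.
have -> : (\int[mu]_(x in phi @^-1` D) F (phi x) =
    \int[pushforward mu phi]_(y in D) F y)%E.
  by rewrite ge0_integral_pushforward.
rewrite -ge0_integral_mscale//.
by apply: eq_measure_integral => A mA _; exact: phiK.
Qed.

Lemma integrable_scaling (D : set (measurableTypeR R)) f : measurable D -> measurable_fun setT f ->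
  mu.-integrable D (EFin \o f) -> mu.-integrable (phi @^-1` D) (EFin \o (f \o phi)).
Proof.
move=> mD mf /integrableP[_ fD].
have mphiD : measurable (phi @^-1` D) by rewrite -[X in measurable X]setTI; exact: mphi.
apply/integrableP; split.
  apply/measurable_EFinP; apply: (@measurable_funS _ _ _ _ setT) => //.
  exact: (measurableT_comp mf mphi).
rewrite (@ge0_integral_scaling D (fun x => `|f x|%:E))//.
  by apply: lte_mul_pinfty => //; apply: integral_ge0.
by apply/measurable_EFinP; apply: measurableT_comp.
Qed.

Lemma Rintegral_scaling (D : set (measurableTypeR R)) f : measurable D -> measurable_fun setT f ->
  mu.-integrable D (EFin \o f) ->
  \int[mu]_(x in phi @^-1` D) f (phi x) = K%:num * \int[mu]_(x in D) f x.
Proof.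
move=> mD mf fD; have mEf : measurable_fun setT (EFin \o f) by apply/measurable_EFinP.
rewrite /Rintegral -[RHS]/(fine (K%:num)%:E * _) -fineM//; last exact: integrable_fin_num.
congr fine; pose F := (EFin \o f : R -> \bar R).
transitivity ((\int[mu]_(x in phi @^-1` D) F^\+ (phi x)) -
    (\int[mu]_(x in phi @^-1` D) F^\- (phi x)))%E; first by
  have := integralE mu (phi @^-1` D) (F \o phi); rewrite funepos_comp funeneg_comp.
transitivity (K%:num%:E * ((\int[mu]_(x in D) F^\+ x) - (\int[mu]_(x in D) F^\- x)))%E; last first.
  by congr (_ * _)%E; exact/esym/integralE.
rewrite muleBr//; last first.
  by apply: fin_num_adde_defl; rewrite fin_numN; exact: (integrable_neg_fin_num mD fD).
congr (_ - _)%E.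
  by apply: (ge0_integral_scaling mD) => //; exact: measurable_funepos.
by apply: (ge0_integral_scaling mD) => //; exact: measurable_funeneg.
Qed.

End scaling_map.

(** Both sides agree on half-open intervals, which determines the Lebesgue
measure. *)
Lemma measure_affine c k (A : set R) : 0 < k -> measurable A ->
  mu ((fun x => c + k * x) @^-1` A) = ((k^-1)%:E * mu A)%E.
Proof.
move=> k0 mA; pose phi := (fun x => c + k * x) : measurableTypeR R -> measurableTypeR R.
have mphi : measurable_fun setT phi.
  apply: continuous_measurable_fun; apply: ctsD; first exact: cts_cst.
  by apply: ctsM; [exact: cts_cst|exact: cts_id].
have k0' : 0 <= k by exact: ltW.
pose nu := mscale (NngNum k0') (pushforward mu phi).
have E : forall A, measurable A -> mu A = nu mphi A.
  apply: lebesgue_measure_unique => _ [[a b]] _ <-.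
  transitivity (k%:E * mu (phi @^-1` `]a, b]))%E; last by [].
  have -> : phi @^-1` `]a, b] = `](a - c) / k, (b - c) / k]%classic.
    apply/seteqP; split => x /=; rewrite !in_itv/= /phi => /andP[h1 h2]; apply/andP; split.
    + by rewrite ltr_pdivrMr//; lra.
    + by rewrite ler_pdivlMr//; lra.
    + by move: h1; rewrite ltr_pdivrMr//; lra.
    + by move: h2; rewrite ler_pdivlMr//; lra.
  rewrite !lebesgue_measure_itv/= !lte_fin ltr_pM2r ?invr_gt0// ltrD2r.
  case: ifP => _; last by rewrite mule0.
  by rewrite -!EFinD -EFinM; congr EFin; field; rewrite gt_eqF.
rewrite [in RHS]E//; change (nu mphi A) with (k%:E * mu (phi @^-1` A))%E.
rewrite muleA -EFinM mulVf ?mul1e//.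
by rewrite gt_eqF.
Qed.

Let maffine c k : measurable_fun setT ((fun x => c + k * x) : measurableTypeR R -> measurableTypeR R).
Proof.
apply: continuous_measurable_fun; apply: ctsD; first exact: cts_cst.
by apply: ctsM; [exact: cts_cst|exact: cts_id].
Qed.

Let affine_itv c k a b : 0 < k ->
  (fun x => c + k * x) @^-1` `[c + k * a, c + k * b] = `[a, b]%classic.
Proof.
move=> k0; apply/seteqP; split => x /=;
  by rewrite !in_itv/= !lerD2l !(ler_pM2l k0).
Qed.

Lemma locint_affine c k f : 0 < k -> locint f -> locint (fun x => f (c + k * x)).
Proof.
move=> k0 lf a b; have ki : 0 <= k^-1 by rewrite invr_ge0 ltW.
rewrite -(affine_itv c a b k0).
apply: (@integrable_scaling _ (NngNum ki) (maffine c k)) => //=.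
- by move=> A mA; exact: measure_affine.
- exact: locint_measurable.
Qed.

Lemma Int_affine c k f a b : 0 < k -> locint f ->
  Int (fun x => f (c + k * x)) a b = k^-1 * Int f (c + k * a) (c + k * b).
Proof.
move=> k0 lf; have ki : 0 <= k^-1 by rewrite invr_ge0 ltW.
rewrite /Int -(affine_itv c a b k0).
apply: (@Rintegral_scaling _ (NngNum ki) (maffine c k)) => //=.
- by move=> A mA; exact: measure_affine.
- exact: locint_measurable.
Qed.

Let mopp : measurable_fun setT (-%R : measurableTypeR R -> measurableTypeR R).
Proof. by apply: continuous_measurable_fun; exact: opp_continuous. Qed.

Lemma locint_opp f : locint f -> locint (fun x => f (- x)).
Proof.
move=> lf a b; have -> : `[a, b]%classic = -%R @^-1` `[- b, - a]%classic.
  by rewrite opp_preimage_itvbndbnd !opprK.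
apply: (@integrable_scaling _ 1%:nng mopp) => //=.
- by move=> A mA; rewrite mul1e -[RHS]lebesgue_measureN.
- exact: locint_measurable.
Qed.

Lemma Int_opp f a b : locint f -> Int (fun x => f (- x)) a b = Int f (- b) (- a).
Proof.
move=> lf; rewrite /Int (_ : `[a, b]%classic = -%R @^-1` `[- b, - a]%classic).
  rewrite (@Rintegral_scaling _ 1%:nng mopp) ?mul1r//=.
  - by move=> A mA; rewrite mul1e -[RHS]lebesgue_measureN.
  - exact: locint_measurable.
by rewrite opp_preimage_itvbndbnd !opprK.
Qed.

End ChangeOfVariables.

(** * Representatives of functions of class H^2 *)
Section Representatives.
Context {R : realType}.
Local Notation mu := (@lebesgue_measure R).
Implicit Types (f g h U P G : R -> R) (a b c k x y z : R).

Lemma Int_oo f a b : measurable_fun setT f -> Int f a b = \int[mu]_(x in `]a, b[) f x.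
Proof.
move=> mf; rewrite /Int /Rintegral integral_itv_bndoo//.
by apply/measurable_EFinP; apply: measurable_funS mf.
Qed.

Lemma eq_Int_oo f g a b : measurable_fun setT f -> measurable_fun setT g ->
  (forall x, a < x < b -> f x = g x) -> Int f a b = Int g a b.
Proof.
move=> mf mg fg; rewrite !Int_oo//; apply: eq_Rintegral => x.
by rewrite inE/= in_itv/=; exact: fg.
Qed.

Lemma primitive_locint g P : primitive g P -> locint g. Proof. by case. Qed.

Lemma primitiveE g P x y : primitive g P -> x <= y -> P y = P x + Int g x y.
Proof. by move=> [_ E] xy; rewrite -E//; ring. Qed.

Lemma is_derive_primitive p P : continuous p -> (forall x, is_derive x 1 P (p x)) ->
  primitive p P.
Proof.
move=> cp dP; split; first exact: continuous_locint.
by move=> x y xy; rewrite (Int_FTC xy cp dP).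
Qed.

(** Converse of [is_derive_primitive]; it turns primitives of continuous
functions into differentiable test functions. *)
Lemma primitive_is_derive p P x : continuous p -> primitive p P -> is_derive x 1 P (p x).
Proof.
move=> cp pP; have x1 : x < x + 1 by lra.
have [dF EF] := @continuous_FTC1_closed R p (x - 1) x (x + 1) x1
  ((primitive_locint pP) _ _) ltac:(lra) (cp x).
have dx : is_derive x 1 (fun y => P (x - 1) + Int p (x - 1) y) (p x).
  rewrite -EF derive1E -[X in is_derive _ _ _ X]add0r.
  by apply: is_deriveD; apply: DeriveDef.
apply: near_eq_is_derive dx.
near=> y; rewrite -(primitiveE pP)//; near: y.
exists 1 => //= y; rewrite /ball_/= ltr_norml => /andP[_ ?]; lra.
Unshelve. all: by end_near. Qed.

Definition paste z f g x := if x <= z then f x else g x.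

Lemma measurable_paste z f g : measurable_fun setT f -> measurable_fun setT g ->
  measurable_fun setT (paste z f g).
Proof.
move=> mf mg; apply: measurable_fun_if => //.
- apply: measurable_fun_ler => //.
- exact: measurable_funS mf.
- exact: measurable_funS mg.
Qed.

Lemma locint_paste z f g : locint f -> locint g -> locint (paste z f g).
Proof.
move=> lf lg; apply: (@le_locint _ _ (fun x => `|f x| + `|g x|)).
- by apply: measurable_paste; exact: locint_measurable.
- by apply: locintD; exact: locint_norm.
- by move=> x; rewrite /paste; case: ifP => _; rewrite ?lerDl ?lerDr.
Qed.

Lemma Int_paste z f g a b : locint f -> locint g -> a <= z -> z <= b ->
  Int (paste z f g) a b = Int f a z + Int g z b.
Proof.
move=> lf lg az zb; have lfg := locint_paste z lf lg.
rewrite (Int_chasles lfg az zb); congr (_ + _).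
  by apply: eq_Int => x /andP[_ xz]; rewrite /paste xz.
apply: eq_Int_oo; try exact: locint_measurable.
by move=> x /andP[zx _]; rewrite /paste leNgt zx.
Qed.

Lemma Int_paste_l z f g a b : b <= z -> Int (paste z f g) a b = Int f a b.
Proof.
by move=> bz; apply: eq_Int => x /andP[_ xb]; rewrite /paste (le_trans xb bz).
Qed.

Lemma Int_paste_r z f g a b : locint f -> locint g -> z <= a ->
  Int (paste z f g) a b = Int g a b.
Proof.
move=> lf lg za; have lfg := locint_paste z lf lg.
apply: eq_Int_oo; try exact: locint_measurable.
by move=> x /andP[ax _]; rewrite /paste leNgt (le_lt_trans za ax).
Qed.

Lemma primitive_paste z f g F G : primitive f F -> primitive g G -> F z = G z ->
  primitive (paste z f g) (paste z F G).
Proof.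
move=> fF gG FG; have lf := primitive_locint fF; have lg := primitive_locint gG.
split; first exact: locint_paste.
move=> x y xy; rewrite /(paste z F G).
case: (lerP x z) => xz; case: (lerP y z) => yz.
- by rewrite Int_paste_l// (primitiveE fF xy); ring.
- rewrite Int_paste//; last exact: ltW.
  by rewrite (primitiveE gG (ltW yz)) -FG (primitiveE fF xz); ring.
- by have := lt_le_trans xz (le_trans xy yz); rewrite ltxx.
- by rewrite Int_paste_r//; [rewrite (primitiveE gG xy); ring|exact: ltW].
Qed.

Lemma L2loc_paste z f g : L2loc f -> L2loc g -> L2loc (paste z f g).
Proof.
move=> [mf lf] [mg lg]; split; first exact: measurable_paste.
have -> : (fun x => paste z f g x ^+ 2) = paste z (fun x => f x ^+ 2) (fun x => g x ^+ 2).
  by apply/funext => x; rewrite /paste; case: ifP.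
exact: locint_paste.
Qed.

Lemma primitive_affine c k g P : 0 < k -> primitive g P ->
  primitive (fun x => k * g (c + k * x)) (fun x => P (c + k * x)).
Proof.
move=> k0 [lg E]; have l := locint_affine c k0 lg; split; first exact: locintZ.
move=> x y xy; rewrite IntZ// Int_affine// E.
  by rewrite mulrA divff ?mul1r// gt_eqF.
by rewrite lerD2l ler_pM2l.
Qed.

Lemma primitiveZ m g P : primitive g P -> primitive (fun x => m * g x) (fun x => m * P x).
Proof.
move=> [lg E]; split; first exact: locintZ.
by move=> x y xy; rewrite -mulrBr E// IntZ.
Qed.

Lemma primitive_addc m g P : primitive g P -> primitive g (fun x => P x + m).
Proof. by move=> [lg E]; split => // x y xy; rewrite -E//; ring. Qed.

Lemma primitiveB f g P Q : primitive f P -> primitive g Q ->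
  primitive (fun x => f x - g x) (fun x => P x - Q x).
Proof.
move=> [lf E] [lg E']; split; first exact: locintB.
by move=> x y xy; rewrite IntB// -E// -E'//; ring.
Qed.

Lemma primitive_opp g P : primitive g P ->
  primitive (fun x => - g (- x)) (fun x => P (- x)).
Proof.
move=> [lg E]; have l := locint_opp lg; split; first exact: locintN.
by move=> x y xy; rewrite IntN// Int_opp// -E ?lerN2//; ring.
Qed.

Lemma L2loc_affine c k g : 0 < k -> L2loc g -> L2loc (fun x => g (c + k * x)).
Proof.
move=> k0 [mg lg]; split; last exact: (locint_affine c k0 lg).
apply: (measurableT_comp mg); apply: continuous_measurable_fun.
by apply: ctsD; [exact: cts_cst|apply: ctsM; [exact: cts_cst|exact: cts_id]].
Qed.

Lemma L2loc_opp g : L2loc g -> L2loc (fun x => g (- x)).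
Proof.
move=> [mg lg]; split; last exact: (locint_opp lg).
apply: (measurableT_comp mg); apply: continuous_measurable_fun.
by apply: ctsN; exact: cts_id.
Qed.

(** [U] is a continuously differentiable function with derivative [P] and weak
second derivative [G].  The three functions are defined on the whole line, so
that rescaling and gluing involve no domains. *)
Definition h2rep U P G := [/\ L2loc G, primitive G P & primitive P U].

Lemma h2rep_cts U P G : h2rep U P G -> [/\ continuous U, continuous P & locint G].
Proof.
move=> [LG GP PU]; split; [exact: (primitive_continuous PU)|
  exact: (primitive_continuous GP)|exact: L2loc_locint].
Qed.

(** Matching values and slopes are what gluing in H^2 requires. *)
Lemma h2rep_paste z U1 P1 G1 U2 P2 G2 : h2rep U1 P1 G1 -> h2rep U2 P2 G2 ->
  U1 z = U2 z -> P1 z = P2 z -> h2rep (paste z U1 U2) (paste z P1 P2) (paste z G1 G2).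
Proof.
move=> [L1 g1 p1] [L2 g2 p2] EU EP; split; first exact: L2loc_paste.
  exact: primitive_paste.
exact: primitive_paste.
Qed.

Lemma h2rep_affine c k m d U P G : 0 < k -> h2rep U P G ->
  h2rep (fun x => m * U (c + k * x) + d) (fun x => m * (k * P (c + k * x)))
        (fun x => m * (k * (k * G (c + k * x)))).
Proof.
move=> k0 [LG GP PU]; split.
- by do 3 apply: L2locZ; exact: L2loc_affine.
- by apply: primitiveZ; apply: (primitiveZ k); apply: primitive_affine.
- by apply: primitive_addc; apply: primitiveZ; apply: primitive_affine.
Qed.

Lemma h2repB U1 P1 G1 U2 P2 G2 : h2rep U1 P1 G1 -> h2rep U2 P2 G2 ->
  h2rep (fun x => U1 x - U2 x) (fun x => P1 x - P2 x) (fun x => G1 x - G2 x).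
Proof.
move=> [L1 g1 p1] [L2 g2 p2]; split; [|exact: primitiveB|exact: primitiveB].
have -> : (fun x => G1 x - G2 x) = (fun x => G1 x + (-1) * G2 x).
  by apply/funext => x; rewrite mulN1r.
by apply: L2locD => //; exact: L2locZ.
Qed.

Lemma h2rep_smooth U P G : (forall x, is_derive x 1 U (P x)) ->
  (forall x, is_derive x 1 P (G x)) -> continuous G -> h2rep U P G.
Proof.
move=> dU dP cG; split; first exact: continuous_L2loc.
  exact: is_derive_primitive.
by apply: is_derive_primitive => //; exact: (is_derive_continuous dP).
Qed.

End Representatives.

(** * Test functions and weak derivatives *)
Section PointwiseDerivatives.
Context {R : realType}.
Implicit Types (f g : R -> R) (x a b : R).

Lemma dr_cst k x : is_derive x 1 ((fun=> k) : R -> R) 0.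
Proof. exact: is_derive_cst. Qed.

Lemma dr_id x : is_derive x 1 ((fun y => y) : R -> R) 1.
Proof. exact: is_derive_id. Qed.

Lemma drD f g x a b : is_derive x 1 f a -> is_derive x 1 g b ->
  is_derive x 1 (fun y => f y + g y) (a + b).
Proof. by move=> df dg; exact: (is_deriveD df dg). Qed.

Lemma drB f g x a b : is_derive x 1 f a -> is_derive x 1 g b ->
  is_derive x 1 (fun y => f y - g y) (a - b).
Proof. by move=> df dg; exact: (is_deriveB df dg). Qed.

Lemma drM f g x a b : is_derive x 1 f a -> is_derive x 1 g b ->
  is_derive x 1 (fun y => f y * g y) (f x * b + g x * a).
Proof. by move=> df dg; exact: (is_deriveM df dg). Qed.

Lemma drZ k f x a : is_derive x 1 f a -> is_derive x 1 (fun y => k * f y) (k * a).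
Proof. by move=> df; exact: (is_deriveZ k df). Qed.

Lemma drX f n x a : is_derive x 1 f a ->
  is_derive x 1 (fun y => f y ^+ n) (n%:R * f x ^+ n.-1 * a).
Proof.
by move=> df; have := is_deriveX n df; rewrite /GRing.scale/= exprfctE.
Qed.

Lemma dr_eq f x a b : is_derive x 1 f a -> a = b -> is_derive x 1 f b.
Proof. by move=> df <-. Qed.

Lemma ctsV f : continuous f -> (forall x, f x != 0) -> continuous (fun x => (f x)^-1).
Proof. by move=> cf f0 x; apply: (cvgV (f0 x) (cf x)). Qed.

End PointwiseDerivatives.

Section WeakDerivatives.
Context {R : realType}.
Local Notation mu := (@lebesgue_measure R).
Implicit Types (f g h u U P G phi : R -> R) (a b c k x y z : R).

(** Only the support needs an argument: the closure of the set where [phi] does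
not vanish stays in the compact interval [x, y]. *)
Lemma test_functionI a b x y phi (dphi : R -> R) : a < x -> y < b ->
  (forall t : R, is_derive t 1 phi (dphi t)) -> continuous dphi ->
  (forall t, phi t != 0 -> x <= t <= y) -> test_function a b phi.
Proof.
move=> ax yb dE cd supp.
have sub : closure [set t | phi t != 0] `<=` `[x, y].
  have cl : closed `[x, y]%classic by exact: itv_closed.
  rewrite [X in _ `<=` X](closure_id _).1//; apply: closure_subset => t/= /supp.
  by rewrite in_itv.
split.
- by move=> t; have [] := dE t.
- by have -> : derive1 phi = dphi; [apply/funext => t; rewrite derive1E; have [] := dE t|].
- by apply: (subclosed_compact _ (segment_compact (a := x) (b := y)) sub); exact: closed_closure.
- by move=> t /sub /=; rewrite !in_itv/= => /andP[? ?]; apply/andP; split; lra.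
Qed.

Lemma test_function_derive a b phi (t : R) : test_function a b phi -> is_derive t 1 phi (derive1 phi t).
Proof. by move=> [d _ _ _]; rewrite derive1E; apply: DeriveDef. Qed.

Lemma test_function_out a b phi t : test_function a b phi -> t <= a \/ b <= t -> phi t = 0.
Proof.
move=> [_ _ _ sub] H; apply/eqP/negPn/negP => pt.
have /sub/= : closure [set t | phi t != 0] t by exact: subset_closure.
by rewrite in_itv/= => /andP[at_ tb]; case: H; rewrite leNgt ?at_ ?tb.
Qed.

Lemma locint_locally_integrable a b g : locint g -> locally_integrable `]a, b[ g.
Proof.
move=> lg; apply: open_integrable_locally; first exact: interval_open.
by apply: integrableS (lg a b) => //; exact: subset_itv_oo_cc.
Qed.

Lemma primitive_weak_derivative a b g P : a < b -> primitive g P ->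
  is_weak_derivative a b P g.
Proof.
move=> ab gP; have [lg _] := gP; have cP := primitive_continuous gP.
have lP := continuous_locint cP.
split; [exact: locint_locally_integrable..|].
move=> phi tphi; have [_ cd _ _] := tphi.
have dphi t := test_function_derive t tphi.
have cphi := is_derive_continuous dphi.
rewrite -Int_oo; last by apply: continuous_measurable_fun; exact: ctsM.
rewrite -Int_oo; last first.
  by apply: measurable_funM; [exact: locint_measurable|exact: continuous_measurable_fun].
rewrite (primitive_by_parts (ltW ab) gP dphi cd).
rewrite (test_function_out (t := a) tphi); last by left.
rewrite (test_function_out (t := b) tphi); last by right.
ring.
Qed.

Definition posq x : R := paste 0 (fun=> 0) (fun t => t ^+ 2) x.
Definition dposq x : R := paste 0 (fun=> 0) (fun t => 2 * t) x.

Lemma dposqE t : dposq t = 2 * Num.max 0 t.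
Proof. by rewrite /dposq /paste; case: lerP => h; rewrite ?mulr0. Qed.

Lemma cts_dposq : continuous dposq.
Proof.
have -> : dposq = (fun t => 2 * Num.max 0 t) by apply/funext => t; rewrite dposqE.
apply: ctsM; first exact: cts_cst.
by move=> t; apply: (@continuous_max _ _ _ _ _); [exact: cvg_cst|exact: cvg_id].
Qed.

Lemma posq_derive (t : R) : is_derive t 1 posq (dposq t).
Proof.
apply: primitive_is_derive; first exact: cts_dposq.
apply: primitive_paste; last by rewrite expr0n.
  exact: (is_derive_primitive (@cts_cst R 0) (fun x => dr_cst 0 x)).
apply: is_derive_primitive; first by apply: ctsM; [exact: cts_cst|exact: cts_id].
by move=> x; apply: (dr_eq (drX 2 (dr_id x))); rewrite /= expr1 mulr1.
Qed.

Lemma posq_ge0 t : 0 <= posq t.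
Proof. by rewrite /posq /paste; case: ifP => // _; exact: sqr_ge0. Qed.

Lemma posq_gt0 t : (0 < posq t) = (0 < t).
Proof.
by rewrite /posq /paste; case: (lerP t 0) => h /=; [exact: ltxx|exact: exprn_gt0].
Qed.

(** The square of a positive part is C^1, which is all the regularity that
test functions must have. *)
Definition hump x y t : R := posq ((t - x) * (y - t)).
Definition dhump x y t : R := dposq ((t - x) * (y - t)) * (x + y - 2 * t).

Lemma hump_gt0 x y t : x <= y -> (0 < hump x y t) = (x < t < y).
Proof.
move=> xy; rewrite /hump posq_gt0; apply/idP/idP; last first.
  by move=> /andP[? ?]; rewrite mulr_gt0 ?subr_gt0.
case: (ltP x t) => xt; case: (ltP t y) => ty //=; nra.
Qed.

Lemma hump_derive x y (t : R) : is_derive t 1 (hump x y) (dhump x y t).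
Proof.
apply: (is_derive1_comp (f := posq) (g := fun t => (t - x) * (y - t))).
  exact: posq_derive.
apply: (dr_eq (drM (drB (dr_id t) (dr_cst x t)) (drB (dr_cst y t) (dr_id t)))).
ring.
Qed.

Lemma cts_dhump x y : continuous (dhump x y).
Proof.
apply: ctsM.
  apply: (cts_comp (g := dposq)); last exact: cts_dposq.
  by apply: ctsM; apply: ctsB; (exact: cts_cst || exact: cts_id).
apply: ctsB; first exact: cts_cst.
by apply: ctsM; [exact: cts_cst|exact: cts_id].
Qed.

Lemma hump_test a b x y : a < x -> x <= y -> y < b -> test_function a b (hump x y).
Proof.
move=> ax xy yb; apply: (test_functionI ax yb (@hump_derive x y) (@cts_dhump x y)).
move=> t; case: (ltP 0 (hump x y t)) => [t0 _|h].
  by move: t0; rewrite hump_gt0// => /andP[/ltW-> /ltW->].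
by rewrite (_ : hump x y t = 0) ?eqxx//; apply/eqP; rewrite eq_le h posq_ge0.
Qed.

(** With h = [hump x y] this is n h/(1 + n h), which increases to the indicator
function of (x, y) as n grows. *)
Definition plateau x y (n : nat) t : R := 1 - (1 + n%:R * hump x y t)^-1.

Lemma plateau_den_gt0 x y n t : 0 < 1 + n%:R * hump x y t.
Proof. by rewrite ltr_pwDl// mulr_ge0// posq_ge0. Qed.

Lemma plateau_test a b x y n : a < x -> x <= y -> y < b -> test_function a b (plateau x y n).
Proof.
move=> ax xy yb.
pose d t := (1 + n%:R * hump x y t) ^- 2 * (n%:R * dhump x y t).
have cb : continuous (hump x y) by exact: (is_derive_continuous (@hump_derive x y)).
have cden : continuous (fun t => 1 + n%:R * hump x y t).
  by apply: ctsD; [exact: cts_cst|apply: ctsM => //; exact: cts_cst].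
apply: (@test_functionI a b x y _ d) => //.
- move=> t; have ne : 1 + n%:R * hump x y t != 0 by rewrite gt_eqF// plateau_den_gt0.
  have D := drD (dr_cst 1 t) (drZ n%:R (hump_derive x y t)).
  have DV := is_deriveV (f := fun s => 1 + n%:R * hump x y s) ne D.
  apply: (dr_eq (drB (dr_cst 1 t) DV)).
  by rewrite /d /GRing.scale/=; ring.
- rewrite /d; apply: ctsM; last by apply: ctsM; [exact: cts_cst|exact: cts_dhump].
  apply: (ctsV (f := fun t => (1 + n%:R * hump x y t) ^+ 2)); first exact: ctsX.
  by move=> t; rewrite expf_neq0// gt_eqF// plateau_den_gt0.
- move=> t; have [t0|] := ltP 0 (hump x y t).
    by move: t0; rewrite hump_gt0// => /andP[/ltW-> /ltW->].
  move=> h; rewrite /plateau (_ : hump x y t = 0) ?mulr0 ?addr0 ?invr1 ?subrr ?eqxx//.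
  by apply/eqP; rewrite eq_le h posq_ge0.
Qed.

Lemma plateau_out x y n t : x <= y -> ~~ (x < t < y) -> plateau x y n t = 0.
Proof.
move=> xy; rewrite -hump_gt0// -leNgt => h.
rewrite /plateau (_ : hump x y t = 0) ?mulr0 ?addr0 ?invr1 ?subrr//.
by apply/eqP; rewrite eq_le h posq_ge0.
Qed.

Lemma plateau_bounds x y n t : 0 <= plateau x y n t <= 1.
Proof.
have h := plateau_den_gt0 x y n t; rewrite /plateau subr_ge0 gerBl invr_ge0 (ltW h) andbT.
by rewrite invf_le1// lerDl mulr_ge0// posq_ge0.
Qed.

Lemma plateau_cvg x y t : x < t < y -> plateau x y n t @[n --> \oo] --> (1 : R).
Proof.
move=> xty; have q0 : 0 < hump x y t.
  by rewrite hump_gt0//; case/andP: xty => xt ty; exact: ltW (lt_trans xt ty).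
rewrite -[X in _ --> X]subr0; apply: cvgB; first exact: cvg_cst.
apply/cvgrPdist_lt => e e0; near=> n.
have h := plateau_den_gt0 x y n t.
rewrite sub0r normrN gtr0_norm ?invr_gt0// invf_plt ?posrE//.
have : (e^-1 / hump x y t) < n%:R.
  by near: n; exact: nbhs_infty_gtr.
by rewrite ltr_pdivrMr// => H; rewrite (lt_trans H)// ltrDr.
Unshelve. all: by end_near. Qed.

End WeakDerivatives.

(** * The fundamental lemma of the calculus of variations *)
Section FundamentalLemma.
Context {R : realType}.
Local Notation mu := (@lebesgue_measure R).
Implicit Types (f g h u U P G phi : R -> R) (a b c k x y z : R).

Lemma locally_integrable_sub a b x y h : a < x -> y < b ->
  locally_integrable `]a, b[ h -> mu.-integrable `[x, y] (EFin \o h).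
Proof.
move=> ax yb [mh _ ih].
have sub : `[x, y] `<=` `]a, b[.
  by move=> t; rewrite /= !in_itv/= => /andP[? ?]; apply/andP; split; lra.
apply/integrableP; split.
  by apply/measurable_EFinP; apply: measurable_funS mh.
by apply: ih => //; exact: segment_compact.
Qed.

Lemma plateau_integral a b x y n h : a < x -> x <= y -> y < b ->
  \int[mu]_(t in `]a, b[) (h t * plateau x y n t) =
  \int[mu]_(t in `]x, y[) (h t * plateau x y n t).
Proof.
move=> ax xy yb.
have sub : (`]x, y[ : set R) `<=` `]a, b[.
  by move=> t; rewrite /= !in_itv/= => /andP[? ?]; apply/andP; split; lra.
rewrite -[in RHS](setIidr sub) Rintegral_mkcondr; apply: eq_Rintegral => t _.
rewrite patchE; case: ifPn => // tn.
rewrite plateau_out ?mulr0//; apply: contra tn => xty.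
by rewrite inE/= in_itv.
Qed.

(** Test against [plateau x y n] and pass to the limit by dominated
convergence. *)
Lemma weak_zero_Rintegral a b x y h : a < x -> x <= y -> y < b ->
  locally_integrable `]a, b[ h ->
  (forall phi, test_function a b phi -> \int[mu]_(t in `]a, b[) (h t * phi t) = 0) ->
  \int[mu]_(t in `[x, y]) h t = 0.
Proof.
move=> ax xy yb lh H.
have ih := locally_integrable_sub ax yb lh.
have iho : mu.-integrable `]x, y[ (EFin \o h).
  by apply: integrableS ih => //; exact: subset_itv_oo_cc.
have mho : measurable_fun `]x, y[ h by have /integrableP[/measurable_EFinP] := iho.
have [|||||_ _] := @dominated_convergence _ _ R mu `]x, y[ (measurable_itv _)
  (fun n t => (h t * plateau x y n t)%:E) (EFin \o h) (fun t => `|h t|%:E).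
- move=> n; apply/measurable_EFinP; apply: measurable_funM => //.
  apply: (@measurable_funS _ _ _ _ setT) => //; apply: continuous_measurable_fun.
  exact: (is_derive_continuous (fun t => test_function_derive t (plateau_test n ax xy yb))).
- exact/measurable_EFinP.
- apply: aeW => t /=; rewrite in_itv/= => xty.
  apply: cvg_EFin; first exact: nearW.
  rewrite -[X in _ --> X]mulr1; apply: cvgM; first exact: cvg_cst.
  exact: plateau_cvg.
- exact: integrable_norm.
- apply: aeW => t n _ /=; rewrite lee_fin normrM ler_piMr//.
  by have /andP[p0 p1] := plateau_bounds x y n t; rewrite ger0_norm.
move=> cv.
have cst0 : (fun n => \int[mu]_(t in `]x, y[) (h t * plateau x y n t)%:E)%E = (fun=> 0%E).
  apply/funext => n.
  have fin : (\int[mu]_(t in `]x, y[) (h t * plateau x y n t)%:E)%E \is a fin_num.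
    apply: integrable_fin_num => //.
    apply: (le_integrable _ _ _ (integrable_norm iho)) => //=.
      apply/measurable_EFinP; apply: measurable_funM => //.
      apply: (@measurable_funS _ _ _ _ setT) => //; apply: continuous_measurable_fun.
      exact: (is_derive_continuous (fun t => test_function_derive t (plateau_test n ax xy yb))).
    move=> t _; rewrite lee_fin normrM normr_id ler_piMr//.
    by have /andP[p0 p1] := plateau_bounds x y n t; rewrite ger0_norm.
  rewrite -(fineK fin) -[fine _]/(\int[mu]_(t in `]x, y[) (h t * plateau x y n t)).
  by rewrite -(plateau_integral n h ax xy yb) H//; exact: plateau_test.
rewrite /Rintegral integral_itv_bndoo; last first.
  by apply/measurable_EFinP.
move: cv; rewrite cst0 => cv.
have -> : (\int[mu]_(t in `]x, y[) (h t)%:E)%E = 0%E; last by [].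
by apply: (cvg_unique _ cv (cvg_cst _)).
Qed.

(** Lebesgue differentiation applied to the integral function, which is
constant. *)
Lemma zero_Rintegral_ae x y h : x < y -> mu.-integrable `[x, y] (EFin \o h) ->
  (forall z, x < z -> z < y -> \int[mu]_(t in `[x, z]) h t = 0) ->
  {ae mu, forall t, x < t < y -> h t = 0}.
Proof.
move=> xy ih H; pose f := h \_ `[x, y].
have lf : locally_integrable setT f by exact: integrable_locally_restrict.
have If z : mu.-integrable `[x, z] (EFin \o f).
  have : mu.-integrable setT (EFin \o f).
    by rewrite -restrict_EFin; apply/integrable_restrict; rewrite ?setTI.
  by apply: integrableS => //.
have F0 z : x < z -> z < y -> \int[mu]_(t in `[x, z]) f t = 0.
  move=> xz zy; rewrite -(H z)//; apply: eq_Rintegral => t; rewrite inE/= in_itv/= => /andP[xt tz].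
  by rewrite /f patchE mem_set//= in_itv/= xt (le_trans tz)// ltW.
have := @FTC1 R f (BLeft x) If lf.
apply: filterS; first exact: (ae_filter_ringOfSetsType mu).
move=> t D /andP[xt ty].
have [|dF] := D; first by rewrite lte_fin.
rewrite /f patchE mem_set/= ?in_itv/= ?(ltW xt) ?(ltW ty)// => <-.
rewrite derive1E (near_eq_derive (g := cst 0)) ?derive_cst//.
near=> s; apply: F0.
  by near: s; apply: lt_nbhsr.
by near: s; apply: lt_nbhsl.
Unshelve. all: by end_near. Qed.

(** The integral of [h] vanishes on every compact subinterval; exhausting
(a, b) by countably many of them, [zero_Rintegral_ae] gives the conclusion. *)
Lemma fundamental_lemma a b h : a < b -> locally_integrable `]a, b[ h ->
  (forall phi, test_function a b phi -> \int[mu]_(t in `]a, b[) (h t * phi t) = 0) ->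
  {ae mu, forall t, a < t < b -> h t = 0}.
Proof.
move=> ab lh H.
pose d (n : nat) := (b - a) / n.+3%:R.
have d0 n : 0 < d n by rewrite divr_gt0// subr_gt0.
have dab n : a + d n < b - d n.
  have : d n * 3 <= b - a.
    by rewrite /d mulrAC ler_pdivrMr// ler_wpM2l ?ler_nat// subr_ge0 ltW.
  by have := d0 n; lra.
have : {ae mu, forall t, forall n, a + d n < t < b - d n -> h t = 0}.
  apply: ae_foralln => n.
  have an : a < a + d n by have := d0 n; lra.
  have bn : b - d n < b by have := d0 n; lra.
  apply: zero_Rintegral_ae (dab n) (locally_integrable_sub an bn lh) _ => z xz zy.
  by apply: (weak_zero_Rintegral an (ltW xz) _ lh H); exact: lt_trans bn.
apply: filterS; first exact: (ae_filter_ringOfSetsType mu).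
move=> t + /andP[at_ tb].
have [n [n1 n2]] : exists n : nat, d n < t - a /\ d n < b - t.
  pose e := Num.min (t - a) (b - t).
  have e0 : 0 < e by rewrite /e lt_min !subr_gt0 at_.
  exists (Num.truncn ((b - a) / e)).
  have : d (Num.truncn ((b - a) / e)) < e.
    rewrite /d ltr_pdivrMr// mulrC -ltr_pdivrMr//.
    by apply: (lt_le_trans (truncnS_gt _)); rewrite ler_nat; exact: (leqW (leqW (leqnn _))).
  by rewrite lt_min => /andP[].
by move=> /(_ n); apply; apply/andP; split; lra.
Qed.

End FundamentalLemma.

(** * The lemma of du Bois-Reymond *)
Section DuBoisReymond.
Context {R : realType}.
Local Notation mu := (@lebesgue_measure R).
Implicit Types (f g h u w U P G phi : R -> R) (a b c k x y z : R).

Lemma exists_primitive g : locint g -> exists P, primitive g P.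
Proof.
move=> lg; exists (fun x => Int g 0 x - Int g x 0); split=> // x y xy.
have gt0 s t : t < s -> Int g s t = 0.
  by move=> ts; rewrite /Int set_itv_ge ?Rintegral_set0// bnd_simp -ltNge.
case: (leP 0 x) => x0.
  rewrite (@Int_chasles _ g 0 x y)//.
  have -> : Int g x 0 = 0.
    by move: x0; rewrite le_eqVlt => /predU1P[<-|/gt0//]; rewrite Int_aa.
  have -> : Int g y 0 = 0; last by ring.
  have := le_trans x0 xy.
  by rewrite le_eqVlt => /predU1P[<-|/gt0//]; rewrite Int_aa.
rewrite (gt0 0 x)//; case: (leP 0 y) => y0.
  rewrite (@Int_chasles _ g x 0 y) ?(ltW x0)//.
  have -> : Int g y 0 = 0; last by ring.
  by move: y0; rewrite le_eqVlt => /predU1P[<-|/gt0//]; rewrite Int_aa.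
by rewrite (gt0 0 y)// (@Int_chasles _ g x y 0) ?(ltW y0)//; ring.
Qed.

Lemma test_support a b phi : a < b -> test_function a b phi -> exists x y,
  [/\ a < x, x <= y, y < b & forall t, phi t != 0 -> x <= t <= y].
Proof.
move=> ab tphi; have [_ _ cS sub] := tphi.
set S := closure _ in cS sub.
have [[s Ss]|S0] := pselect (S !=set0); last first.
  exists ((a + b) / 2), ((a + b) / 2); split=> //; [lra|lra|].
  by move=> t pt; exfalso; apply: S0; exists t; exact: subset_closure.
have cid : {within S, continuous (fun x : R => x)}.
  by apply: continuous_subspaceT; exact: cts_id.
have [y] := compact_EVT_max (ex_intro _ s Ss) cS cid.
have [x] := compact_EVT_min (ex_intro _ s Ss) cS cid.
rewrite !inE => Sx xmin Sy ymax.
have Ic t : phi t != 0 -> x <= t <= y.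
  move=> pt; have St : t \in S by rewrite inE; exact: subset_closure.
  by rewrite xmin// ymax.
exists x, y; split => //.
- by have /= := sub _ Sx; rewrite in_itv/= => /andP[].
- by apply: ymax; rewrite inE.
- by have /= := sub _ Sy; rewrite in_itv/= => /andP[].
Qed.

Lemma test_cts a b phi : test_function a b phi -> continuous phi.
Proof. by move=> tphi; exact: (is_derive_continuous (fun t => test_function_derive t tphi)). Qed.

Lemma locally_integrable_test a b h phi : a < b -> locally_integrable `]a, b[ h ->
  test_function a b phi -> mu.-integrable `]a, b[ (EFin \o (fun t => h t * phi t)).
Proof.
move=> ab lh tphi; have [x [y [ax xy yb supp]]] := test_support ab tphi.
have cphi := test_cts tphi.
have ih := locally_integrable_sub ax yb lh.
have lf : locint (h \_ `[x, y]).
  move=> s t; have : mu.-integrable setT (EFin \o (h \_ `[x, y])).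
    by rewrite -restrict_EFin; apply/integrable_restrict; rewrite ?setTI.
  by apply: integrableS.
have lfphi := locintM_continuous lf cphi.
have : mu.-integrable `]a, b[ (EFin \o (fun t => (h \_ `[x, y]) t * phi t)).
  by apply: integrableS (lfphi a b) => //; exact: subset_itv_oo_cc.
apply: eq_integrable => // t _ /=; congr EFin; rewrite patchE; case: ifPn => // tn.
rewrite mul0r; suff -> : phi t = 0 by rewrite mulr0.
apply/eqP/negPn/negP => /supp xty; move: tn; rewrite notin_setE/= in_itv/=.
by rewrite xty.
Qed.

(** The derivative of a test function vanishes outside any compact interval
that contains the support in its interior. *)
Lemma locally_integrable_test_derive a b h phi : a < b -> locally_integrable `]a, b[ h ->
  test_function a b phi -> mu.-integrable `]a, b[ (EFin \o (fun t => h t * derive1 phi t)).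
Proof.
move=> ab lh tphi; have [x [y [ax xy yb supp]]] := test_support ab tphi.
have [_ cd _ _] := tphi.
pose x' := (a + x) / 2; pose y' := (y + b) / 2.
have ax' : a < x' by rewrite /x'; lra.
have yb' : y' < b by rewrite /y'; lra.
have ih := locally_integrable_sub ax' yb' lh.
have lf : locint (h \_ `[x', y']).
  move=> s t; have : mu.-integrable setT (EFin \o (h \_ `[x', y'])).
    by rewrite -restrict_EFin; apply/integrable_restrict; rewrite ?setTI.
  by apply: integrableS.
have lfphi := locintM_continuous lf cd.
have : mu.-integrable `]a, b[ (EFin \o (fun t => (h \_ `[x', y']) t * derive1 phi t)).
  by apply: integrableS (lfphi a b) => //; exact: subset_itv_oo_cc.
apply: eq_integrable => // t _ /=; congr EFin; rewrite patchE; case: ifPn => // tn.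
rewrite mul0r; suff -> : derive1 phi t = 0 by rewrite mulr0.
have zero s : ~~ (x <= s <= y) -> phi s = 0.
  by move=> ns; apply/eqP/negPn/negP => /supp; apply/negP.
have txy : t < x \/ y < t.
  move: tn; rewrite notin_setE/= in_itv/= => /negP; rewrite negb_and -!ltNge /x' /y'.
  by case/orP => ?; [left|right]; lra.
rewrite derive1E (near_eq_derive (g := cst 0)) ?derive_cst//.
case: txy => txy; near=> s; apply: zero; rewrite negb_and -!ltNge.
  by apply/orP; left; near: s; apply: lt_nbhsl.
by apply/orP; right; near: s; apply: lt_nbhsr.
Unshelve. all: by end_near. Qed.

Lemma hump_Int_gt0 x y : x < y -> 0 < Int (hump x y) x y.
Proof.
move=> xy; pose l := (y - x) / 4.
have cb : continuous (hump x y) by exact: (is_derive_continuous (@hump_derive R x y)).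
have l0 : 0 < l by rewrite /l; lra.
have b0 t : 0 <= hump x y t by exact: posq_ge0.
apply: (@lt_le_trans _ _ (Int (hump x y) (x + l) (y - l))); last first.
  by apply: Int_sub; rewrite /l; [exact: continuous_locint|move=> ? _; exact: b0|lra..].
apply: (@lt_le_trans _ _ (Int (fun=> (l * l) ^+ 2) (x + l) (y - l))).
  rewrite Int_cst; last by rewrite /l; lra.
  by rewrite mulr_gt0 ?exprn_gt0 ?mulr_gt0// /l; lra.
apply: le_Int; [exact/continuous_locint/cts_cst|exact: continuous_locint|].
move=> t /andP[t1 t2].
have h : l * l <= (t - x) * (y - t) by apply: ler_pM; [exact: ltW|exact: ltW|lra|lra].
have h0 : 0 < (t - x) * (y - t) by apply: lt_le_trans h; exact: mulr_gt0.
rewrite /hump /posq /paste ifF; last by apply/negbTE; rewrite -ltNge.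
by rewrite ler_pXn2r// nnegrE ltW// mulr_gt0.
Qed.

Lemma test_Int a b phi : test_function a b phi ->
  \int[mu]_(t in `]a, b[) phi t = Int phi a b.
Proof. by move=> tphi; rewrite Int_oo//; apply: continuous_measurable_fun; exact: test_cts tphi. Qed.

Lemma Int_support g a b x y : continuous g -> a <= x -> x <= y -> y <= b ->
  (forall t, g t != 0 -> x <= t <= y) -> Int g a b = Int g x y.
Proof.
move=> cg ax xy yb supp; have lg := continuous_locint cg.
have mg := continuous_measurable_fun cg.
have z s t : t <= x \/ y <= s -> s <= t -> Int g s t = 0.
  move=> H st; rewrite -[RHS](mul0r (t - s)) -(Int_cst _ st).
  apply: eq_Int_oo => //.
  move=> r /andP[sr rt]; apply/eqP/negPn/negP => /supp /andP[xr ry].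
  by case: H => H; lra.
rewrite (@Int_chasles _ g a x b)// ?(le_trans xy)// (@Int_chasles _ g x y b)//.
rewrite (z a x)//; last by left.
by rewrite (z y b)//; [ring|right].
Qed.

(** For a fixed test function phi0 of integral 1, the function
psi - (integral of psi) phi0 has integral 0, so its primitive is again a test
function.  Testing with that primitive shows that h - K satisfies the hypothesis
of [fundamental_lemma], where K is the integral of h phi0. *)
Lemma du_bois_reymond a b h : a < b -> locally_integrable `]a, b[ h ->
  (forall phi, test_function a b phi -> \int[mu]_(t in `]a, b[) (h t * derive1 phi t) = 0) ->
  exists K, {ae mu, forall t, a < t < b -> h t = K}.
Proof.
move=> ab lh H.
pose x0 := (2 * a + b) / 3; pose y0 := (a + 2 * b) / 3.
have ax0 : a < x0 by rewrite /x0; lra.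
have xy0 : x0 < y0 by rewrite /x0 /y0; lra.
have y0b : y0 < b by rewrite /y0; lra.
have t0 := hump_test ax0 (ltW xy0) y0b.
pose c0 := Int (hump x0 y0) x0 y0.
have c00 : c0 != 0 by rewrite gt_eqF// hump_Int_gt0.
pose phi0 t := c0^-1 * hump x0 y0 t.
have cphi0 : continuous phi0 by apply: ctsM; [exact: cts_cst|exact: test_cts t0].
have supp0 t : phi0 t != 0 -> x0 <= t <= y0.
  rewrite /phi0 mulf_eq0 negb_or => /andP[_].
  case: (ltP 0 (hump x0 y0 t)) => [|h0].
    by rewrite hump_gt0 ?(ltW xy0)// => /andP[/ltW-> /ltW->].
  by rewrite (_ : hump _ _ t = 0) ?eqxx//; apply/eqP; rewrite eq_le h0 posq_ge0.
have tphi0 : test_function a b phi0.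
  apply: (test_functionI (dphi := fun t => c0^-1 * dhump x0 y0 t) ax0 y0b) => //.
    by move=> t; exact/drZ/hump_derive.
  by apply: ctsM; [exact: cts_cst|exact: cts_dhump].
have I0 : Int phi0 x0 y0 = 1.
  rewrite IntZ ?mulVf//; apply: continuous_locint; exact: test_cts t0.
pose K := \int[mu]_(t in `]a, b[) (h t * phi0 t).
have lK : locally_integrable `]a, b[ (fun=> K).
  by apply: locint_locally_integrable; apply: continuous_locint; exact: cts_cst.
have [mh oh _] := lh.
exists K.
suff : {ae mu, forall t, a < t < b -> h t - K = 0}.
  apply: filterS; first exact: (ae_filter_ringOfSetsType mu).
  by move=> t + tab => /(_ tab)/eqP; rewrite subr_eq0 => /eqP.
apply: fundamental_lemma => //; first exact: locally_integrableB.
move=> psi tpsi; have [x1 [y1 [ax1 xy1 y1b supp1]]] := test_support ab tpsi.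
have cpsi := test_cts tpsi.
pose c := Int psi a b.
pose X := Num.min x0 x1; pose Y := Num.max y0 y1.
have aX : a < X by rewrite /X lt_min ax0 ax1.
have Yb : Y < b by rewrite /Y gt_max y0b y1b.
have XY : X <= Y by rewrite /X /Y (@le_trans _ _ x0)// ?ge_min ?lexx// (le_trans (ltW xy0))// le_max lexx.
pose zeta t := psi t - c * phi0 t.
have czeta : continuous zeta by apply: ctsB => //; apply: ctsM => //; exact: cts_cst.
have suppz t : zeta t != 0 -> X <= t <= Y.
  move=> zt; have [p0|p0] := eqVneq (psi t) 0; last first.
    by have /andP[? ?] := supp1 _ p0; rewrite /X /Y ge_min le_max; apply/andP; split; apply/orP; right.
  have : phi0 t != 0.
    by apply: contra zt => /eqP q0; rewrite /zeta p0 q0 mulr0 subrr.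
  by move=> /supp0 /andP[? ?]; rewrite /X /Y ge_min le_max; apply/andP; split; apply/orP; left.
have lz := continuous_locint czeta.
have Iz : Int zeta X Y = 0.
  rewrite -(Int_support czeta (ltW aX) XY (ltW Yb) suppz) /zeta IntB//; last 2 first.
  - exact: continuous_locint.
  - exact/locintZ/continuous_locint.
  rewrite IntZ; last exact: continuous_locint.
  by rewrite -/c (Int_support cphi0 (ltW ax0) (ltW xy0) (ltW y0b) supp0) I0 mulr1 subrr.
have [Q zQ] := exists_primitive lz.
pose theta t := Q t - Q X.
have z0 s t : t <= X \/ Y <= s -> s <= t -> Int zeta s t = 0.
  move=> HH st; rewrite -[RHS](mul0r (t - s)) -(Int_cst _ st).
  apply: eq_Int_oo => //; first exact: continuous_measurable_fun.
  move=> r /andP[sr rt]; apply/eqP/negPn/negP => /suppz /andP[xr ry].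
  by case: HH => HH; lra.
have dtheta (t : R) : is_derive t 1 theta (zeta t).
  apply: (dr_eq (drB (primitive_is_derive t czeta zQ) (dr_cst _ t))).
  by rewrite subr0.
have ttheta : test_function a b theta.
  apply: (test_functionI aX Yb dtheta czeta) => t.
  apply: contraNT; rewrite negb_and -!ltNge /theta => /orP[tX|Yt].
    by rewrite (primitiveE zQ (ltW tX)) (z0 t X) ?(ltW tX)//; [apply/eqP; ring|left].
  rewrite (primitiveE zQ (ltW Yt)) (z0 Y t) ?(ltW Yt)//; last by right.
  by rewrite (primitiveE zQ XY) Iz; apply/eqP; ring.
have := H _ ttheta.
have -> : derive1 theta = zeta.
  by apply/funext => t; rewrite derive1E; have [] := dtheta t.
have ihpsi := locally_integrable_test ab lh tpsi.
have ihphi0 := locally_integrable_test ab lh tphi0.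
have iKpsi := locally_integrable_test ab lK tpsi.
have -> : (fun t => h t * zeta t) = (fun t => h t * psi t - c * (h t * phi0 t)).
  by apply/funext => t; rewrite /zeta; ring.
rewrite RintegralB//; last first.
  exact: (integrableZl _ c ihphi0).
rewrite RintegralZl// -/K => E.
transitivity (\int[mu]_(t in `]a, b[) (h t * psi t - K * psi t)).
  by apply: eq_Rintegral => t _; ring.
have l1 := locint_locally_integrable a b (continuous_locint (@cts_cst R 1)).
have ipsi : mu.-integrable `]a, b[ (EFin \o psi).
  have := locally_integrable_test ab l1 tpsi.
  by apply: eq_integrable => // t _; rewrite /= mul1r.
rewrite RintegralB// RintegralZl// (test_Int tpsi) -/c.
by rewrite (mulrC K).
Qed.

End DuBoisReymond.

(** * Weak derivatives and continuous representatives *)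
Section SobolevRepresentation.
Context {R : realType}.
Local Notation mu := (@lebesgue_measure R).
Implicit Types (f g h u w U P G phi : R -> R) (a b c k x y z : R).

(** This makes the arbitrary choice in [weakD] harmless, see [weakD_ae]. *)
Lemma weak_derivative_unique a b u g g' : a < b ->
  is_weak_derivative a b u g -> is_weak_derivative a b u g' ->
  {ae mu, forall x, a < x < b -> g x = g' x}.
Proof.
move=> ab [lu lg E] [_ lg' E'].
have : {ae mu, forall x, a < x < b -> g x - g' x = 0}.
  apply: fundamental_lemma => //; first exact: locally_integrableB.
  move=> phi tphi.
  have -> : (fun t => (g t - g' t) * phi t) = (fun t => g t * phi t - g' t * phi t).
    by apply/funext => t; ring.
  have i1 := locally_integrable_test ab lg tphi.
  have i2 := locally_integrable_test ab lg' tphi.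
  rewrite RintegralB//; apply/eqP; rewrite subr_eq0 -eqr_opp; apply/eqP.
  by rewrite -(E _ tphi) -(E' _ tphi).
apply: filterS; first exact: (ae_filter_ringOfSetsType mu).
by move=> t + tab => /(_ tab)/eqP; rewrite subr_eq0 => /eqP.
Qed.

Lemma ae_eq_RintegralM a b u u' phi : locally_integrable `]a, b[ u ->
  locally_integrable `]a, b[ u' -> continuous phi ->
  {ae mu, forall x, a < x < b -> u x = u' x} ->
  \int[mu]_(x in `]a, b[) (u x * phi x) = \int[mu]_(x in `]a, b[) (u' x * phi x).
Proof.
move=> [mu_ _ _] [mu' _ _] cphi uu'.
have mphi : measurable_fun `]a, b[ phi.
  by apply: (@measurable_funS _ _ _ _ setT) => //; exact: continuous_measurable_fun.
rewrite /Rintegral; congr fine; apply: ae_eq_integral => //.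
- by apply/measurable_EFinP; exact: measurable_funM.
- by apply/measurable_EFinP; exact: measurable_funM.
- move: uu'; apply: filterS; first exact: (ae_filter_ringOfSetsType mu).
  by move=> t + /=; rewrite in_itv/= => E tab; rewrite E.
Qed.

Lemma weak_derivative_ae a b u u' g : locally_integrable `]a, b[ u' ->
  {ae mu, forall x, a < x < b -> u x = u' x} ->
  is_weak_derivative a b u g -> is_weak_derivative a b u' g.
Proof.
move=> lu' uu' [lu lg E]; split=> // phi tphi; rewrite -E//.
by have [_ cd _ _] := tphi; apply/esym/ae_eq_RintegralM.
Qed.

Lemma weak_derivative_ae_r a b u g g' : locally_integrable `]a, b[ g' ->
  {ae mu, forall x, a < x < b -> g x = g' x} ->
  is_weak_derivative a b u g -> is_weak_derivative a b u g'.
Proof.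
move=> lg' gg' [lu lg E]; split=> // phi tphi; rewrite E//; congr (- _).
by apply: ae_eq_RintegralM => //; exact: test_cts tphi.
Qed.

Lemma weakD_weak_derivative a b u g : is_weak_derivative a b u g ->
  is_weak_derivative a b u (weakD a b u).
Proof. by move=> ug; apply: (@xgetPex _ (fun=> 0) [set g | is_weak_derivative a b u g]); exists g. Qed.

Lemma weakD_ae a b u g : a < b -> is_weak_derivative a b u g ->
  {ae mu, forall x, a < x < b -> weakD a b u x = g x}.
Proof.
by move=> ab ug; apply: (weak_derivative_unique ab (weakD_weak_derivative ug) ug).
Qed.

Lemma L2loc_L2 a b g : L2loc g -> L2 a b g.
Proof.
move=> [mg lg]; split; first exact: measurable_funS mg.
by apply: integrableS (lg a b) => //; exact: subset_itv_oo_cc.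
Qed.

Lemma L2_ext a b u w : (forall x, a < x < b -> w x = u x) -> L2 a b u -> L2 a b w.
Proof.
move=> E [mu_ iu]; split.
  by apply: (eq_measurable_fun u) => // x; rewrite inE/= in_itv/= => /E.
by apply: eq_integrable iu => // x; rewrite inE/= in_itv/= => /E ->.
Qed.

Lemma locally_integrable_ext a b u w : (forall x, a < x < b -> w x = u x) ->
  locally_integrable `]a, b[ u -> locally_integrable `]a, b[ w.
Proof.
move=> E [mu_ o iu]; split => //.
  by apply: (eq_measurable_fun u) => // x; rewrite inE/= in_itv/= => /E.
move=> K KD cK.
have -> : (\int[mu]_(x in K) `|w x|%:E = \int[mu]_(x in K) `|u x|%:E)%E; last exact: iu.
by apply: eq_integral => x; rewrite inE => /KD; rewrite /= in_itv/= => /E ->.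
Qed.

Lemma h2rep_weakD a b w U P G : a < b -> h2rep U P G ->
  (forall x, a < x < b -> w x = U x) ->
  [/\ H2 a b w, {ae mu, forall x, a < x < b -> weakD a b w x = P x} &
    {ae mu, forall x, a < x < b -> weakD a b (weakD a b w) x = G x}].
Proof.
move=> ab r E; have [cU cP lG] := h2rep_cts r; have [LG GP PU] := r.
have wP : is_weak_derivative a b w P.
  apply: (weak_derivative_ae _ _ (primitive_weak_derivative ab PU)).
    by apply: (locally_integrable_ext E); exact/locint_locally_integrable/continuous_locint.
  by apply: aeW => x /E.
have dw := weakD_ae ab wP.
split => //.
  exists P, G; split => //; last exact: primitive_weak_derivative.
  - by apply: (L2_ext E); exact/L2loc_L2/continuous_L2loc.
  - exact/L2loc_L2/continuous_L2loc.
  - exact: L2loc_L2.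
apply: weakD_ae => //; apply: (weak_derivative_ae _ _ (primitive_weak_derivative ab GP)).
  by have [] := weakD_weak_derivative wP.
move: dw; apply: filterS; first exact: (ae_filter_ringOfSetsType mu).
by move=> x + xab => ->.
Qed.

Lemma L2_restrict a b g : L2 a b g -> L2loc (g \_ `]a, b[).
Proof.
move=> [mg ig]; split.
  by apply/(measurable_restrictT _ _).1 => //; exact: measurable_itv.
move=> s t; have : mu.-integrable setT (EFin \o ((fun x => g x ^+ 2) \_ `]a, b[)).
  by rewrite -restrict_EFin; apply/integrable_restrict; rewrite ?setTI.
have -> : (fun x => (g \_ `]a, b[) x ^+ 2) = ((fun x => g x ^+ 2) \_ `]a, b[).
  by apply/funext => x; rewrite !patchE; case: ifP => // _; rewrite expr0n.
by apply: integrableS.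
Qed.

Lemma continuous_ae_eq a b u w : {ae mu, forall x, a < x < b -> u x = w x} ->
  (forall x, a < x < b -> {for x, continuous u}) ->
  (forall x, a < x < b -> {for x, continuous w}) ->
  forall x, a < x < b -> u x = w x.
Proof.
move=> [N [mN N0 sub]] cu cw x xab; apply/eqP; rewrite -subr_eq0; apply/negPn/negP => ne.
have /andP[ax xb] := xab.
have cd : {for x, continuous (fun y => u y - w y)}.
  by apply: continuousB; [exact: cu|exact: cw].
have ball_sub : \forall y \near x, ~ (a < y < b -> u y = w y).
  near=> y => H.
  have : u y - w y != 0.
    near: y; have := cd; move/cvgrPdist_lt => /(_ `|u x - w x|).
    rewrite normr_gt0 => /(_ ne); apply: filterS => y; apply: contraTN => /eqP ->.
    by rewrite subr0 ltxx.
  rewrite H ?subrr ?eqxx//; apply/andP; split; near: y; [exact: lt_nbhsr|exact: lt_nbhsl].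
have [e e0 He] := ball_sub.
have : (mu (ball x e) <= mu N)%E.
  rewrite le_measure ?inE//; first exact: measurable_ball.
  by move=> y /He; apply: sub.
rewrite N0 lebesgue_measure_ball ?(ltW e0)// lee_fin.
by rewrite leNgt mulrn_wgt0.
Unshelve. all: by end_near. Qed.

(** Integrate the second weak derivative twice.  By [du_bois_reymond] each
integration recovers the previous function up to a constant, almost everywhere,
and then everywhere by continuity. *)
Lemma H2_h2rep a b u : a < b -> H2 a b u ->
  (forall x, a < x < b -> {for x, continuous u}) ->
  exists U P G, h2rep U P G /\ forall x, a < x < b -> u x = U x.
Proof.
move=> ab [g1 [g2 [Lu L1 L2_ ug1 g12]]] cu.
pose G := g2 \_ `]a, b[; have LG : L2loc G by exact: L2_restrict.
have lG := L2loc_locint LG.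
have [P0 GP0] := exists_primitive lG.
have G2 : {ae mu, forall x, a < x < b -> g2 x = G x}.
  by apply: aeW => x xab; rewrite /G patchE mem_set.
have lG' := locint_locally_integrable a b lG.
have g1G := weak_derivative_ae_r lG' G2 g12.
have cP0 := primitive_continuous GP0.
have lP0 := locint_locally_integrable a b (continuous_locint cP0).
have dbr h h' g : is_weak_derivative a b h g -> is_weak_derivative a b h' g ->
    exists K, {ae mu, forall t, a < t < b -> h t - h' t = K}.
  move=> [lh lg E] [lh' _ E']; apply: du_bois_reymond => //.
    exact: locally_integrableB.
  move=> phi tphi.
  have -> : (fun t => (h t - h' t) * derive1 phi t) =
      (fun t => h t * derive1 phi t - h' t * derive1 phi t).
    by apply/funext => t; ring.
  have i1 := locally_integrable_test_derive ab lh tphi.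
  have i2 := locally_integrable_test_derive ab lh' tphi.
  by rewrite RintegralB// E// E'// subrr.
have [K HK] := dbr _ _ _ g1G (primitive_weak_derivative ab GP0).
pose P x := P0 x + K.
have GP : primitive G P by exact: primitive_addc.
have cP := primitive_continuous GP.
have lP := locint_locally_integrable a b (continuous_locint cP).
have g1P : {ae mu, forall x, a < x < b -> g1 x = P x}.
  move: HK; apply: filterS; first exact: (ae_filter_ringOfSetsType mu).
  by move=> x + xab => /(_ xab) E; rewrite /P -E; ring.
have uP := weak_derivative_ae_r lP g1P ug1.
have [U0 PU0] := exists_primitive (continuous_locint cP).
have [K' HK'] := dbr _ _ _ uP (primitive_weak_derivative ab PU0).
exists (fun x => U0 x + K'), P, G; split.
  by split => //; exact: primitive_addc.
apply: continuous_ae_eq => //.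
  move: HK'; apply: filterS; first exact: (ae_filter_ringOfSetsType mu).
  by move=> x + xab => /(_ xab) <-; ring.
move=> x _; apply: (@primitive_continuous _ P); exact: primitive_addc.
Qed.

End SobolevRepresentation.

(** * The functional and the squared norm of a representative *)
Section EnergyOfRepresentatives.
Context {R : realType}.
Local Notation mu := (@lebesgue_measure R).
Implicit Types (f g h u w U P G F : R -> R) (a b c k x y z eps beta : R).

Lemma ae_eq_integral_Int a b e e' : locint e -> measurable_fun `]a, b[ e' ->
  {ae mu, forall x, a < x < b -> e' x = e x} ->
  (\int[mu]_(x in `]a, b[) (e' x)%:E = (Int e a b)%:E)%E.
Proof.
move=> le me' ee'; have me := locint_measurable le.
have ie : mu.-integrable `]a, b[ (EFin \o e).
  by apply: integrableS (le a b) => //; exact: subset_itv_oo_cc.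
rewrite Int_oo// /Rintegral fineK; last exact: integrable_fin_num.
apply: ae_eq_integral => //.
- exact/measurable_EFinP.
- by apply/measurable_EFinP; exact: measurable_funS me.
- move: ee'; apply: filterS; first exact: (ae_filter_ringOfSetsType mu).
  by move=> x + /=; rewrite in_itv/= => E xab; rewrite E.
Qed.

Lemma weakD_measurable a b u g : is_weak_derivative a b u g ->
  measurable_fun `]a, b[ (weakD a b u).
Proof. by move=> /weakD_weak_derivative[_ []]. Qed.

Lemma H2_weakD_measurable a b u : a < b -> H2 a b u ->
  [/\ measurable_fun `]a, b[ u, measurable_fun `]a, b[ (weakD a b u) &
      measurable_fun `]a, b[ (weakD a b (weakD a b u))].
Proof.
move=> ab [g1 [g2 [[mu_ _] _ _ ug1 g12]]]; split => //.
  exact: weakD_measurable ug1.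
have dw := weakD_ae ab ug1.
apply: (weakD_measurable (g := g2)); apply: weak_derivative_ae g12.
  by have [] := weakD_weak_derivative ug1.
move: dw; apply: filterS; first exact: (ae_filter_ringOfSetsType mu).
by move=> x + xab => ->.
Qed.

Lemma cts_ln1sqr : continuous (fun x : R => ln (1 + x ^+ 2)).
Proof.
move=> x.
have c : continuous (fun x : R => 1 + x ^+ 2).
  by apply: ctsD; [exact: cts_cst|apply: ctsX; exact: cts_id].
have h : {for 1 + x ^+ 2, continuous (@ln R)}.
  by apply: continuous_ln; rewrite ltr_pwDl// sqr_ge0.
exact: (continuous_comp (c x) h).
Qed.

Definition density eps beta F U P G x : R :=
  eps ^+ 6 * omega eps ^+ 4 * G x ^+ 2 + ln (1 + P x ^+ 2) + beta * (U x - F x) ^+ 2.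

Lemma density_locint eps beta F U P G : continuous F -> h2rep U P G ->
  locint (density eps beta F U P G).
Proof.
move=> cF r; have [cU cP _] := h2rep_cts r; have [[mG lG] _ _] := r.
apply: locintD; first apply: locintD.
- exact: locintZ.
- by apply: continuous_locint; exact: (cts_comp cP cts_ln1sqr).
- by apply: locintZ; apply: continuous_locint; apply: ctsX; exact: ctsB.
Qed.

Lemma PMF_h2rep eps beta f a b w F U P G : a < b -> h2rep U P G ->
  (forall x, a < x < b -> w x = U x) -> continuous F ->
  (forall x, a < x < b -> f x = F x) ->
  PMF eps beta f a b w = (Int (density eps beta F U P G) a b)%:E.
Proof.
move=> ab r wU cF fF; have [Hw dw ddw] := h2rep_weakD ab r wU.
have [m0 m1 m2] := H2_weakD_measurable ab Hw.
apply: ae_eq_integral_Int.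
- exact: density_locint.
- apply: measurable_funD; first apply: measurable_funD.
  + by apply: measurable_funM => //; exact: measurable_funX.
  + apply: (measurableT_comp (f := fun x => ln (1 + x ^+ 2))) => //.
    exact: continuous_measurable_fun cts_ln1sqr.
  + apply: measurable_funM => //; apply: measurable_funX; apply: measurable_funB => //.
    apply: (eq_measurable_fun F); first by move=> x; rewrite inE/= in_itv/= => /fF.
    by apply: (@measurable_funS _ _ _ _ setT) => //; exact: continuous_measurable_fun.
- move: ddw; apply: filterS2 dw => //; first exact: (ae_filter_ringOfSetsType mu).
  by move=> x d1 d2 xab; rewrite /density d1// d2// wU// fF.
Qed.

Lemma H2_normsq_h2rep a b w U P G : a < b -> h2rep U P G ->
  (forall x, a < x < b -> w x = U x) ->
  H2_normsq a b w = (Int (fun x => U x ^+ 2 + P x ^+ 2 + G x ^+ 2) a b)%:E.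
Proof.
move=> ab r wU; have [Hw dw ddw] := h2rep_weakD ab r wU.
have [m0 m1 m2] := H2_weakD_measurable ab Hw.
have [cU cP _] := h2rep_cts r; have [[mG lG] _ _] := r.
apply: ae_eq_integral_Int.
- by apply: locintD => //; apply: locintD; apply: continuous_locint; exact: ctsX.
- by do 2 (apply: measurable_funD; last exact: measurable_funX); exact: measurable_funX.
- move: ddw; apply: filterS2 dw => //; first exact: (ae_filter_ringOfSetsType mu).
  by move=> x d1 d2 xab; rewrite d1// d2// wU.
Qed.

(** Composing with the projection onto [0, 1] extends the datum to the line
with the same Lipschitz constant. *)
Lemma C1_closed_lipschitz f : C1_closed 0 1 f -> exists F L,
  [/\ 0 <= L, forall x y, `|F x - F y| <= L * `|x - y|, continuous F &
      forall x, 0 < x < 1 -> f x = F x].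
Proof.
move=> [g [cf cg dfg]].
have [M [_ hM]] := compact_bounded (continuous_compact cg (segment_compact (a := 0) (b := 1))).
pose L := `|M| + 1; have L0 : 0 <= L by rewrite /L; have := normr_ge0 M; lra.
have gL x : 0 <= x <= 1 -> `|g x| <= L.
  move=> x01; apply: (hM L); last by exists x.
  by rewrite /L; have := ler_norm M; lra.
have lip x y : 0 <= x -> x <= y -> y <= 1 -> `|f y - f x| <= L * (y - x).
  move=> x0; rewrite le_eqVlt => /predU1P[<- _|xy y1]; first by rewrite !subrr normr0 mulr0.
  have d z : z \in `]x, y[%R -> is_derive z 1 f (g z).
    by rewrite in_itv/= => /andP[xz zy]; apply: dfg; apply/andP; split; lra.
  have w : {within `[x, y], continuous f}.
    apply: continuous_subspaceW cf => z /=; rewrite !in_itv/= => /andP[? ?].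
    by apply/andP; split; lra.
  have [c] := @MVT R f g x y xy d w.
  rewrite in_itv/= => /andP[xc cy] ->.
  rewrite normrM (gtr0_norm (x := y - x)) ?subr_gt0// ler_wpM2r ?subr_ge0 ?(ltW xy)//.
  by apply: gL; apply/andP; split; lra.
pose cl x : R := Num.max 0 (Num.min x 1).
have cl01 x : 0 <= cl x <= 1.
  by rewrite /cl le_max lexx/= ge_max ler01/= ge_min lexx orbT.
have clip x y : x <= y -> cl x <= cl y /\ cl y - cl x <= y - x.
  move=> xy; rewrite /cl !maxEle !minEle.
  case: (leP x 1) => ?; case: (leP y 1) => ?; rewrite ?ler01;
    case: (leP 0 x) => ?; case: (leP 0 y) => ?; split; lra.
pose F x := f (cl x).
have lipF x y : `|F x - F y| <= L * `|x - y|.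
  wlog xy : x y / x <= y.
    by move=> H; case: (leP x y) => [/H//|/ltW/H]; rewrite distrC (distrC y).
  have [c1 c2] := clip _ _ xy; have /andP[x0 _] := cl01 x; have /andP[_ y1] := cl01 y.
  rewrite distrC (le_trans (lip _ _ x0 c1 y1))//.
  by rewrite ler_wpM2l// distrC ger0_norm ?subr_ge0.
exists F, L; split => //.
- move=> x; apply/cvgrPdist_lt => e e0; near=> y.
  apply: (le_lt_trans (lipF _ _)).
  have : `|x - y| < e / (L + 1).
    near: y; exists (e / (L + 1)) => //=.
    by rewrite divr_gt0// ltr_wpDl.
  rewrite ltr_pdivlMr ?ltr_wpDl// => H; apply: le_lt_trans H.
  by rewrite mulrC ler_wpM2l// lerDl.
- by move=> x /andP[x0 x1]; rewrite /F /cl min_l ?ltW// max_r ?ltW.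
Unshelve. all: by end_near. Qed.

End EnergyOfRepresentatives.

(** * Localized minimality and the blow-up scale *)
Section LocalMinimality.
Context {R : realType}.
Local Notation mu := (@lebesgue_measure R).
Implicit Types (f g h u w U P G F : R -> R) (a b c k x y z eps beta : R).

Lemma density_paste eps beta F z U P G U' P' G' :
  density eps beta F (paste z U U') (paste z P P') (paste z G G') =
  paste z (density eps beta F U P G) (density eps beta F U' P' G').
Proof. by apply/funext => x; rewrite /density /paste; case: ifP. Qed.

(** Outside [x1, x2] the minimizer is kept; the glued function is an admissible
competitor on (0, 1), and the two energies differ on [x1, x2] only. *)
Lemma local_minimality eps beta f u F U P G U1 P1 G1 x1 x2 :
  PMF_minimizer eps beta f 0 1 u -> h2rep U P G ->
  (forall x, 0 < x < 1 -> u x = U x) -> continuous F ->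
  (forall x, 0 < x < 1 -> f x = F x) ->
  0 < x1 -> x1 <= x2 -> x2 < 1 -> h2rep U1 P1 G1 ->
  U1 x1 = U x1 -> P1 x1 = P x1 -> U1 x2 = U x2 -> P1 x2 = P x2 ->
  Int (density eps beta F U P G) x1 x2 <= Int (density eps beta F U1 P1 G1) x1 x2.
Proof.
move=> [_ um] r uU cF fF x10 x12 x21 r1 EU1 EP1 EU2 EP2.
have rr := h2rep_paste r1 r EU2 EP2.
have EU : U x1 = paste x2 U1 U x1 by rewrite /paste x12 EU1.
have EP : P x1 = paste x2 P1 P x1 by rewrite /paste x12 EP1.
have r2 := h2rep_paste r rr EU EP.
have [H2w _ _] := h2rep_weakD (w := paste x1 U (paste x2 U1 U)) ltr01 r2 (fun x _ => erefl).
have := um _ H2w.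
rewrite (PMF_h2rep _ _ ltr01 r uU cF fF) (PMF_h2rep _ _ ltr01 r2 (fun x _ => erefl) cF fF).
rewrite lee_fin !density_paste.
have l := density_locint eps beta cF r; have l1 := density_locint eps beta cF r1.
rewrite Int_paste//; [|exact: locint_paste|exact: ltW|by rewrite ltW// (le_lt_trans x12)].
rewrite Int_paste//; last exact: ltW.
rewrite (Int_chasles l (ltW x10)) ?(ltW (le_lt_trans x12 x21))//.
by rewrite (Int_chasles l x12 (ltW x21)) lerD2l lerD2r.
Qed.

(** The factor 1/|ln eps| makes the value at a fixed non-zero slope tend to 4 as
eps tends to 0. *)
Definition psi eps t : R := ln (1 + t ^+ 2 / eps ^+ 4) / `|ln eps|.

Definition scaled_density eps b (Phi w p g : R -> R) y : R :=
  g y ^+ 2 + psi eps (p y) + b * (w y - Phi y) ^+ 2.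

Lemma abs_ln_gt0 eps : 0 < eps < 1 -> 0 < `|ln eps|.
Proof. by move=> /ln_lt0 h; rewrite normr_gt0 lt_eqF. Qed.

Lemma omega_gt0 eps : 0 < eps < 1 -> 0 < omega eps.
Proof.
by move=> e01; have /andP[e0 _] := e01; rewrite mulr_gt0// sqrtr_gt0 abs_ln_gt0.
Qed.

Lemma omega_sqr eps : omega eps ^+ 2 = eps ^+ 2 * `|ln eps|.
Proof. by rewrite /omega exprMn sqr_sqrtr. Qed.

Section blow_up_scale.
Variables (eps beta : R) (F U P G : R -> R) (xe : R).
Hypothesis e01 : 0 < eps < 1.
Let k := omega eps * eps ^+ 2.
Definition blow_w y := (U (xe + omega eps * eps ^+ 2 * y) - U xe) / omega eps.
Definition blow_p y := eps ^+ 2 * P (xe + omega eps * eps ^+ 2 * y).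
Definition blow_g y := omega eps * eps ^+ 4 * G (xe + omega eps * eps ^+ 2 * y).
Definition blow_datum y := (F (xe + omega eps * eps ^+ 2 * y) - U xe) / omega eps.

Let e0 : 0 < eps. Proof. by case/andP: e01. Qed.
Let om0 : 0 < omega eps. Proof. exact: omega_gt0. Qed.
Let k0 : 0 < k. Proof. by rewrite mulr_gt0 ?exprn_gt0. Qed.

Lemma blow_h2rep : h2rep U P G -> h2rep blow_w blow_p blow_g.
Proof.
move=> r; have := h2rep_affine xe (omega eps)^-1 (- (U xe / omega eps)) k0 r.
have on0 : omega eps != 0 by rewrite gt_eqF.
congr h2rep; apply/funext => y; rewrite /blow_w /blow_p /blow_g /k; field => //.
Qed.

(** All powers of eps and omega in the three terms reduce to the common factor
|ln eps|; this is what the exponents in the functional are made for. *)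
Lemma density_scaled W Q H y x : x = xe + omega eps * eps ^+ 2 * y ->
  density eps beta F (fun x => U xe + omega eps * W ((x - xe) / k))
    (fun x => eps ^- 2 * Q ((x - xe) / k))
    (fun x => (omega eps * eps ^+ 4)^-1 * H ((x - xe) / k)) x =
  `|ln eps| * scaled_density eps (beta * eps ^+ 2) blow_datum W Q H y.
Proof.
move=> xE; rewrite /density /scaled_density /blow_datum -xE /psi.
have -> : (x - xe) / k = y.
  by rewrite xE /k; field; rewrite !gt_eqF.
have l0 := abs_ln_gt0 e01.
have on0 : omega eps != 0 by rewrite gt_eqF.
have en0 : eps != 0 by rewrite gt_eqF.
rewrite !mulrDr; congr (_ + _ + _).
- have -> : eps ^+ 6 * omega eps ^+ 4 * ((omega eps * eps ^+ 4)^-1 * H y) ^+ 2 =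
    (omega eps ^+ 2) / eps ^+ 2 * H y ^+ 2 by field; rewrite en0 on0.
  by rewrite omega_sqr; field.
- have -> : (eps ^- 2 * Q y) ^+ 2 = Q y ^+ 2 / eps ^+ 4 by field.
  by field; rewrite gt_eqF.
- have -> : beta * (U xe + omega eps * W y - F x) ^+ 2 =
    omega eps ^+ 2 * beta * (W y - (F x - U xe) / omega eps) ^+ 2 by field.
  by rewrite omega_sqr; ring.
Qed.

Lemma blow_up_minimality f u A B W Q H : PMF_minimizer eps beta f 0 1 u ->
  h2rep U P G -> (forall x, 0 < x < 1 -> u x = U x) -> continuous F ->
  (forall x, 0 < x < 1 -> f x = F x) ->
  A <= B -> 0 < xe + omega eps * eps ^+ 2 * A -> xe + omega eps * eps ^+ 2 * B < 1 ->
  h2rep W Q H -> W A = blow_w A -> Q A = blow_p A -> W B = blow_w B -> Q B = blow_p B ->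
  Int (scaled_density eps (beta * eps ^+ 2) blow_datum blow_w blow_p blow_g) A B <=
  Int (scaled_density eps (beta * eps ^+ 2) blow_datum W Q H) A B.
Proof.
move=> um r uU cF fF AB xA xB rW WA QA WB QB.
have on0 : omega eps != 0 by rewrite gt_eqF.
have en0 : eps != 0 by rewrite gt_eqF.
have kn0 : k != 0 by rewrite gt_eqF.
have rb := blow_h2rep r.
have l0 := abs_ln_gt0 e01.
have transport W' Q' H' : h2rep W' Q' H' ->
    h2rep (fun x => U xe + omega eps * W' ((x - xe) / k))
    (fun x => eps ^- 2 * Q' ((x - xe) / k))
    (fun x => (omega eps * eps ^+ 4)^-1 * H' ((x - xe) / k)).
  move=> r'; have ki0 : 0 < k^-1 by rewrite invr_gt0.
  have := h2rep_affine (- (xe / k)) (omega eps) (U xe) ki0 r'.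
  have E x : - (xe / k) + k^-1 * x = (x - xe) / k by field.
  congr h2rep; apply/funext => x; rewrite E.
  - by rewrite addrC.
  - by rewrite /k; field; rewrite on0 en0.
  - by rewrite /k; field; rewrite on0 en0.
have cphi : continuous blow_datum.
  apply: ctsM; last exact: cts_cst.
  apply: ctsB; last exact: cts_cst.
  apply: (cts_comp _ cF); apply: ctsD; first exact: cts_cst.
  by apply: ctsM; [exact: cts_cst|exact: cts_id].
have sc W' Q' H' : h2rep W' Q' H' ->
   Int (scaled_density eps (beta * eps ^+ 2) blow_datum W' Q' H') A B =
   `|ln eps|^-1 * (k^-1 * Int (density eps beta F
    (fun x => U xe + omega eps * W' ((x - xe) / k))
    (fun x => eps ^- 2 * Q' ((x - xe) / k))
    (fun x => (omega eps * eps ^+ 4)^-1 * H' ((x - xe) / k))) (xe + k * A) (xe + k * B)).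
  move=> r'; have rt := transport _ _ _ r'; have ld := density_locint eps beta cF rt.
  rewrite -(Int_affine xe A B k0 ld) -IntZ; last exact: locint_affine.
  apply: eq_Int => y _; rewrite (density_scaled W' Q' H' (y := y))//.
  by rewrite [RHS]mulrA mulVf ?mul1r// gt_eqF.
rewrite !sc// ler_pM2l ?invr_gt0// ler_pM2l ?invr_gt0//.
have cancel y : (xe + k * y - xe) / k = y by field.
have -> : (fun x => U xe + omega eps * blow_w ((x - xe) / k)) = U.
  by apply/funext => x; rewrite /blow_w -/k (_ : xe + k * ((x - xe) / k) = x);
    [field|field].
have -> : (fun x => eps ^- 2 * blow_p ((x - xe) / k)) = P.
  by apply/funext => x; rewrite /blow_p -/k (_ : xe + k * ((x - xe) / k) = x);
    [field|field].
have -> : (fun x => (omega eps * eps ^+ 4)^-1 * blow_g ((x - xe) / k)) = G.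
  by apply/funext => x; rewrite /blow_g -/k (_ : xe + k * ((x - xe) / k) = x);
    [field; rewrite on0 en0|field].
apply: (local_minimality um r uU cF fF xA _ xB (transport _ _ _ rW)).
- by rewrite lerD2l ler_pM2l.
- by rewrite cancel WA /blow_w -/k; field.
- by rewrite cancel QA /blow_p -/k; field.
- by rewrite cancel WB /blow_w -/k; field.
- by rewrite cancel QB /blow_p -/k; field.
Qed.

End blow_up_scale.

End LocalMinimality.

(** * Elementary inequalities for the cost of a transition *)
Section RealEstimates.
Context {R : realType}.
Implicit Types (D a m X Y V c k r beta Lam rho : R).

Lemma small_near C r : 0 < r -> \forall k \near (0 : R)^'+, C * k <= r.
Proof.
move=> r0; exists (r / (`|C| + 1)) => /=; first by rewrite divr_gt0// ltr_wpDl.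
move=> k /= ; rewrite sub0r normrN => kr k0; move: kr.
rewrite gtr0_norm// ltr_pdivlMr ?ltr_wpDl// => kr.
apply: (le_trans _ (ltW kr)); rewrite mulrC ler_wpM2l ?(ltW k0)//.
by rewrite (le_trans (ler_norm C))// lerDl.
Qed.

(** The arithmetic-geometric mean inequality for D and three copies of 4a/3,
with equality for D = 4a/3.  The optimal cubic has this ratio between its
bending energy D and the length a of each half. *)
Lemma weighted_amgm D a : 0 <= D -> 0 <= a -> 4 ^+ 7 / 27 * (D * a ^+ 3) <= (D + 4 * a) ^+ 4.
Proof.
move=> D0 a0; pose b := 4 * a / 3; have b0 : 0 <= b by rewrite /b; lra.
have aE : a = 3 * b / 4 by rewrite /b; field.
rewrite -subr_ge0.
have -> : (D + 4 * a) ^+ 4 - 4 ^+ 7 / 27 * (D * a ^+ 3) =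
  (D - b) ^+ 2 * (D ^+ 2 + 14 * (D * b) + 81 * b ^+ 2) by rewrite aE; field.
by rewrite mulr_ge0 ?sqr_ge0// !addr_ge0 ?sqr_ge0 ?mulr_ge0 ?sqr_ge0.
Qed.

(** In the application r is 3 or 4 and m is the height climbed by a slope profile
with bending energy D and well energy 4a. *)
Lemma energy_dominates_mass D a m c r : 0 <= D -> 0 <= a -> 0 <= m -> 0 <= c ->
  r * m ^+ 2 <= D * a ^+ 3 -> c ^+ 2 <= 4 ^+ 7 / 27 * r -> c * m <= (D + 4 * a) ^+ 2.
Proof.
move=> D0 a0 m0 c0 H cr.
rewrite -(@ler_pXn2r _ 2) ?nnegrE; [|by []|exact: mulr_ge0|exact: sqr_ge0].
rewrite -exprM/= exprMn; apply: le_trans (weighted_amgm D0 a0).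
apply: (@le_trans _ _ (4 ^+ 7 / 27 * (r * m ^+ 2))).
  by rewrite [leRHS]mulrA; apply: ler_wpM2r => //; exact: sqr_ge0.
by apply: ler_wpM2l => //; lra.
Qed.

(** Here V, Y and c stand for 2 Lam^2/3, 16 Lam/3 and 128/3; the hypotheses
retain the relations between them that the argument uses.  The index 1 refers to
the part of the profile before the first return below the threshold, the index
2 to the rest.  The factor 8/7 makes climbing in the second part strictly more
expensive, so an almost optimal profile has X2 = D2 + 4a and hence m2 of order
k.  Then m1 is close to V, and the quartic identity, whose right-hand side is
non-negative, bounds (beta - Lam)^2 by a multiple of k. *)
Lemma half_profile_stability Lam V Y c rho : 0 < Lam -> 0 < V -> 0 < Y -> 0 < c ->
  c * V = Y ^+ 2 ->
  (forall t, 4 * t ^+ 4 - Y * t ^+ 3 + 3 * V ^+ 2 - (t - Lam) ^+ 2 * (4 / 3 * Lam ^+ 2) =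
     (t - Lam) ^+ 2 * (4 * t ^+ 2 + 8 / 3 * (Lam * t))) ->
  Y = 4 * Lam + 4 * Lam / 3 ->
  0 < rho -> exists2 k, 0 < k &
  forall D1 beta D2 a m1 m2, 0 <= D1 -> 0 <= beta -> 0 <= D2 -> 0 <= a ->
   0 <= m1 -> 0 <= m2 ->
   3 * m1 ^+ 2 <= D1 * beta ^+ 3 ->
   c * m1 <= (D1 + 4 * beta) ^+ 2 -> 8 / 7 * c * m2 <= (D2 + 4 * a) ^+ 2 ->
   V - k <= m1 + m2 ->
   Y - rho <= D1 + 4 * beta + (D2 + 4 * a) /\
   (D1 + 4 * beta + (D2 + 4 * a) <= Y + k ->
    [/\ `|beta - Lam| <= rho, `|m1 - V| <= rho &
        D1 + 4 * beta + (D2 + 4 * a) - 4 * beta <= 4 * Lam / 3 + rho]).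
Proof.
move=> Lam0 V0 Y0 c0 cV quartic YLam rho0.
have [C2 C2E] : exists C2, C2 = 8 * (2 * Y + 1 + c) / Y by exists (8 * (2 * Y + 1 + c) / Y).
have C20 : 0 < C2.
  by rewrite C2E; apply: divr_gt0 => //; have := Y0; have := c0; lra.
have C22 : 0 < C2 ^+ 2 by exact: exprn_gt0.
have [C3 C3E] : exists C3, C3 = 7 / 8 * C2 ^+ 2 / c by exists (7 / 8 * C2 ^+ 2 / c).
have C30 : 0 < C3.
  by rewrite C3E; apply: divr_gt0 => //; lra.
have [C4 C4E] : exists C4, C4 = (2 * Y + 1) / c by exists ((2 * Y + 1) / c).
have [b bE] : exists b, b = (Y + 1) / 4 by exists ((Y + 1) / 4).
have [C5 C5E] : exists C5, C5 = b ^+ 3 + 6 * V * (1 + C3) by exists (b ^+ 3 + 6 * V * (1 + C3)).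
near (0 : R)^'+ => k.
have k0 : 0 < k by near: k; exact: nbhs_right_gt.
have k1 : k <= 1 by near: k; apply: nbhs_right_le.
have kA : c * k <= Y * rho.
  by near: k; apply: small_near; exact: mulr_gt0.
have kB : C3 * k <= rho / 4 by near: k; apply: small_near; lra.
have kC : C4 * k <= rho by near: k; apply: small_near.
have kD : C5 * k <= 4 / 3 * Lam ^+ 2 * (rho / 8) ^+ 2.
  by near: k; apply: small_near; rewrite !mulr_gt0 ?exprn_gt0 ?divr_gt0.
have kE : 1 * k <= rho / 4 by near: k; apply: small_near; lra.
rewrite mul1r in kE.
exists k => // D1 beta D2 a m1 m2 D10 beta0 D20 a0 m10 m20 H1.
have [X1 X1E] : exists X1, X1 = D1 + 4 * beta by exists (D1 + 4 * beta).
have [X2 X2E] : exists X2, X2 = D2 + 4 * a by exists (D2 + 4 * a).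
have X10 : 0 <= X1 by rewrite X1E; clear -D10 beta0; lra.
have X20 : 0 <= X2 by rewrite X2E; clear -D20 a0; lra.
rewrite -X1E -X2E => E1 E2 Hm.
have sum : Y ^+ 2 - c * k <= X1 ^+ 2 + 7 / 8 * X2 ^+ 2.
  have : c * (V - k) <= c * (m1 + m2) by rewrite ler_pM2l.
  by rewrite mulrBr cV mulrDr; clear -E1 E2; lra.
split.
  rewrite leNgt; apply/negP => lt.
  have rY : rho < Y by clear -lt X10 X20; lra.
  have S1 : X1 ^+ 2 + 7 / 8 * X2 ^+ 2 <= (X1 + X2) ^+ 2 by clear -X10 X20; nra.
  have S2 : (X1 + X2) ^+ 2 < (Y - rho) ^+ 2 by rewrite ltr_pXn2r ?nnegrE//; clear -X10 X20 rY rho0; lra.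
  have S3 : rho ^+ 2 <= Y * rho by clear -rY rho0; nra.
  have S4 : 0 < Y * rho by exact: mulr_gt0.
  have S5 : (Y - rho) ^+ 2 = Y ^+ 2 - 2 * (Y * rho) + rho ^+ 2 by ring.
  by clear -S1 S2 S3 S4 S5 sum kA; lra.
move=> up.
have X2k : X2 <= C2 * k.
  have P1 : X1 ^+ 2 <= (Y + k - X2) ^+ 2.
    by rewrite ler_pXn2r ?nnegrE//; clear -X10 X20 up; lra.
  have P2 : X2 ^+ 2 <= (Y + k) * X2.
    by rewrite expr2; apply: ler_wpM2r => //; clear -X10 up; lra.
  have P3 : (Y + k) * X2 / 8 <= 2 * Y * k + k ^+ 2 + c * k.
    have : (Y + k - X2) ^+ 2 = Y ^+ 2 + 2 * Y * k + k ^+ 2 - 2 * ((Y + k) * X2) + X2 ^+ 2 by ring.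
    by clear -P1 P2 sum; lra.
  have P4 : Y * X2 <= 8 * (2 * Y + 1 + c) * k.
    have : k ^+ 2 <= k by clear -k0 k1; nra.
    have : 0 <= k * X2 by rewrite mulr_ge0// ltW.
    by clear -P3; lra.
  by rewrite C2E mulrAC ler_pdivlMr// mulrC.
have m2k : m2 <= C3 * k.
  have Q1 : X2 ^+ 2 <= C2 ^+ 2 * k.
    have : X2 ^+ 2 <= (C2 * k) ^+ 2.
      by rewrite ler_pXn2r// nnegrE// mulr_ge0 ?ltW.
    have u1 : k ^+ 2 <= k by clear -k0 k1; nra.
    rewrite exprMn => u; apply: (le_trans u).
    by rewrite ler_pM2l.
  have : C3 * k = 7 / 8 / c * (C2 ^+ 2 * k) by rewrite C3E; field; rewrite gt_eqF.
  move=> ->.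
  rewrite -(@ler_pM2l _ (8 / 7 * c)); last by rewrite mulr_gt0.
  apply: (le_trans E2); apply: (le_trans Q1).
  have -> : 8 / 7 * c * (7 / 8 / c * (C2 ^+ 2 * k)) = C2 ^+ 2 * k by field; rewrite gt_eqF.
  exact: lexx.
have m1lo : V - (1 + C3) * k <= m1 by clear -m2k Hm; lra.
have m1hi : m1 <= V + C4 * k.
  have u : X1 ^+ 2 <= (Y + k) ^+ 2.
    by rewrite ler_pXn2r ?nnegrE//; clear -X10 X20 up k0 Y0; lra.
  have v : (Y + k) ^+ 2 <= c * V + (2 * Y + 1) * k.
    have u1 : k ^+ 2 <= k by clear -k0 k1; nra.
    have -> : (Y + k) ^+ 2 = Y ^+ 2 + 2 * Y * k + k ^+ 2 by ring.
    by rewrite cV; clear -u1; lra.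
  rewrite -(@ler_pM2l _ c)//.
  apply: (le_trans E1); apply: (le_trans u); apply: (le_trans v).
  have -> : c * (V + C4 * k) = c * V + (2 * Y + 1) * k by rewrite C4E; field; rewrite gt_eqF.
  exact: lexx.
have beta_le : beta <= b by rewrite bE; rewrite X1E in up; clear -up X20 D10 k1; lra.
have quart : (beta - Lam) ^+ 2 * (4 / 3 * Lam ^+ 2) <= C5 * k.
  have T1 : 3 * (V ^+ 2 - 2 * V * ((1 + C3) * k)) <= 3 * m1 ^+ 2.
    rewrite ler_pM2l//; have : 0 <= (m1 - V) ^+ 2 by exact: sqr_ge0.
    have : V * (V - (1 + C3) * k) <= V * m1 by rewrite ler_pM2l.
    have -> : (m1 - V) ^+ 2 = m1 ^+ 2 - 2 * (V * m1) + V ^+ 2 by ring.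
    by rewrite mulrBr; clear; lra.
  have T2 : D1 * beta ^+ 3 <= (Y + k - 4 * beta) * beta ^+ 3.
    by rewrite ler_wpM2r ?exprn_ge0//; rewrite X1E in up; clear -up X20; lra.
  have T3 : beta ^+ 3 * k <= b ^+ 3 * k.
    by rewrite ler_wpM2r ?(ltW k0)// ler_pXn2r ?nnegrE// (le_trans beta0).
  have T4 : (beta - Lam) ^+ 2 * (4 / 3 * Lam ^+ 2) <=
     4 * beta ^+ 4 - Y * beta ^+ 3 + 3 * V ^+ 2.
    rewrite -subr_ge0.
    rewrite quartic.
    by rewrite mulr_ge0 ?sqr_ge0// addr_ge0 ?mulr_ge0 ?sqr_ge0// ltW.
  apply: (le_trans T4); rewrite C5E.
  have -> : (b ^+ 3 + 6 * V * (1 + C3)) * k = b ^+ 3 * k + 3 * (2 * V * ((1 + C3) * k)) by ring.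
  have T5 : (Y + k - 4 * beta) * beta ^+ 3 = Y * beta ^+ 3 + beta ^+ 3 * k - 4 * beta ^+ 4 by ring.
  by clear -H1 T1 T2 T3 T5; lra.
have bl : `|beta - Lam| <= rho / 8.
  rewrite -(@ler_pXn2r _ 2)// ?nnegrE ?divr_ge0 ?(ltW rho0)//.
  rewrite real_normK ?num_real// -(@ler_pM2l _ (4 / 3 * Lam ^+ 2)); last first.
    by rewrite mulr_gt0 ?exprn_gt0.
  by rewrite mulrC (le_trans quart).
split.
- by apply: (le_trans bl); clear -rho0; lra.
- rewrite ler_norml; apply/andP; split; last by clear -m1hi kC; lra.
  by rewrite mulrDl mul1r in m1lo; clear -m1lo kE kB rho0; lra.
- move: bl; rewrite ler_norml => /andP[H H0]; by rewrite YLam in up; clear -up kE rho0 H H0; lra.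
Unshelve. all: by end_near.
Qed.

End RealEstimates.

(** * Mass and energy of a one-sided slope profile *)
Section HalfTransition.
Context {R : realType}.
Implicit Types (p g s : R -> R) (a b c x y z tau beta B Lam rho : R).

Lemma le_Int_oo f g a b : locint f -> locint g ->
  (forall x, a < x < b -> f x <= g x) -> Int f a b <= Int g a b.
Proof.
move=> lf lg fg; rewrite !Int_oo; [|exact: locint_measurable..].
have oc : (`]a, b[ : set R) `<=` `[a, b] by exact: subset_itv_oo_cc.
apply: le_Rintegral => //.
- by apply: integrableS (lf a b).
- by apply: integrableS (lg a b).
Qed.

Lemma exists_first_below p tau y B : continuous p -> y <= B -> p B <= tau ->
  exists beta, [/\ y <= beta <= B, p beta <= tau, forall z, y <= z -> z < beta -> tau < p z &
    y < beta -> p beta = tau].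
Proof.
move=> cp yB pB; pose S := `[y, B] `&` [set z | p z <= tau].
have cS : compact S.
  apply: (subclosed_compact _ (segment_compact (a := y) (b := B))) => [|z []//].
  apply: closedI; first exact: itv_closed.
  by apply: (@closed_comp _ _ p [set z | z <= tau]); [move=> z _; exact: cp|exact: closed_le].
have S0 : S !=set0 by exists B; split => //=; rewrite in_itv/= yB lexx.
have cid : {within S, continuous (fun x : R => x)}.
  by apply: continuous_subspaceT; exact: cts_id.
have [be] := compact_EVT_min S0 cS cid.
rewrite inE => -[/=]; rewrite in_itv/= => ybB pbe bmin.
have lt z : y <= z -> z < be -> tau < p z.
  move=> yz zb; rewrite ltNge; apply/negP => pz.
  have /bmin : z \in S.
    rewrite inE; split => //=; rewrite in_itv/= yz (le_trans (ltW zb))//.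
    by case/andP: ybB.
  by rewrite leNgt zb.
exists be; split => // ybe; apply/eqP; rewrite eq_le pbe leNgt; apply/negP => pb.
have : \forall z \near be^'-, p z < tau.
  have cl : p z @[z --> be^'-] --> p be by apply: cvg_at_left_filter; exact: cp.
  by apply: (cvgr_lt _ cl).
move=> H; near be^'- => z.
have : tau < p z.
  apply: lt; last by near: z; exact: nbhs_left_lt.
  by near: z; exact: nbhs_left_ge.
by apply/negP; rewrite -leNgt ltW//; near: z.
Unshelve. all: by end_near. Qed.

Lemma exists_last_below p tau a y : continuous p -> a <= y -> p a <= tau ->
  exists al, [/\ a <= al <= y, p al <= tau, forall z, al < z -> z <= y -> tau < p z &
    al < y -> p al = tau].
Proof.
move=> cp ay pa; have cpo : continuous (fun z => p (- z)).
  by apply: (cts_comp _ cp); apply: ctsN; exact: cts_id.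
have ny : - y <= - a by rewrite lerN2.
have pa' : p (- - a) <= tau by rewrite opprK.
have [be [/andP[h1 h2] pb Hz Hb]] := exists_first_below cpo ny pa'.
exists (- be); split => //.
- by apply/andP; split; [rewrite lerNr|rewrite lerNl].
- by move=> z z1 z2; have := Hz (- z); rewrite opprK lerN2 ltrNl; apply.
- by rewrite ltrNl => /Hb.
Qed.

(** A bump has to rise and to fall, each time by q.  This gains a factor 4 over
the one-sided estimate. *)
Lemma rise_and_fall (q d1 l1 d2 l2 : R) : 0 <= d1 -> 0 <= l1 -> 0 <= d2 -> 0 <= l2 ->
  q ^+ 2 <= d1 * l1 -> q ^+ 2 <= d2 * l2 -> 4 * q ^+ 2 <= (d1 + d2) * (l1 + l2).
Proof.
move=> d10 l10 d20 l20 h1 h2.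
have q0 : 0 <= q ^+ 2 by exact: sqr_ge0.
suff : 2 * q ^+ 2 <= d1 * l2 + d2 * l1 by clear -h1 h2; lra.
rewrite -(@ler_pXn2r _ 2) ?nnegrE//; last 2 first.
- by rewrite mulr_ge0.
- by rewrite addr_ge0 ?mulr_ge0.
apply: (@le_trans _ _ (4 * ((d1 * l2) * (d2 * l1)))).
  have -> : (d1 * l2) * (d2 * l1) = (d1 * l1) * (d2 * l2) by ring.
  have -> : (2 * q ^+ 2) ^+ 2 = 4 * (q ^+ 2 * q ^+ 2) by ring.
  by rewrite ler_pM2l//; apply: ler_pM.
rewrite -subr_ge0.
have -> : (d1 * l2 + d2 * l1) ^+ 2 - 4 * (d1 * l2 * (d2 * l1)) = (d1 * l2 - d2 * l1) ^+ 2 by ring.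
exact: sqr_ge0.
Qed.

Lemma primitive_increment_sqr g p x y : x <= y -> L2loc g -> primitive g p ->
  (p y - p x) ^+ 2 <= Int (fun t => g t ^+ 2) x y * (y - x).
Proof.
move=> xy Lg [lg E]; rewrite E//.
have L1 : L2loc (fun _ : R => 1 : R) by apply: continuous_L2loc; exact: cts_cst.
have := cauchy_schwarz xy Lg L1.
have -> : Int (fun=> 1 ^+ 2) x y = y - x.
  by rewrite -[RHS]mul1r -Int_cst//; apply: eq_Int => t _; rewrite expr1n.
by rewrite (eq_Int (g := g)) // => t _; rewrite mulr1.
Qed.

Definition excess p tau y : R := Num.max (p y - tau) 0.

Lemma cts_excess p tau : continuous p -> continuous (excess p tau).
Proof.
move=> cp; have -> : excess p tau = (fun y => (p y - tau + `|p y - tau|) / 2).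
  apply/funext => y; rewrite /excess maxEle; case: leP => h; [rewrite ler0_norm//|rewrite gtr0_norm//]; lra.
have cpt : continuous (fun y => p y - tau) by apply: ctsB => //; exact: cts_cst.
by apply: ctsM; [apply: ctsD => //; exact: cts_norm|exact: cts_cst].
Qed.

Section one_profile.
Variables (B tau : R) (p g s : R -> R).
Hypotheses (B0 : 0 <= B) (Lg : L2loc g) (gp : primitive g p) (cs : continuous s)
  (s0 : forall y, 0 <= s y) (pB : p B <= tau) (ps : forall y, tau < p y -> 4 <= s y).
Local Notation D x y := (Int (fun t => g t ^+ 2) x y).

Let cp : continuous p. Proof. exact: primitive_continuous gp. Qed.
Let lg2 : locint (fun t => g t ^+ 2). Proof. by case: Lg. Qed.
Let ls : locint s. Proof. exact: continuous_locint. Qed.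

Lemma four_le_Int_well x y : x <= y -> (forall z, x < z -> z < y -> tau < p z) ->
  4 * (y - x) <= Int s x y.
Proof.
move=> xy H; rewrite -Int_cst//; apply: le_Int_oo => //.
  by apply: continuous_locint; exact: cts_cst.
by move=> z /andP[? ?]; apply: ps; exact: H.
Qed.

(** A point where the slope exceeds [tau] lies between two points where it equals
[tau]; in between the well costs at least 4 per unit length. *)
Lemma profile_sup_bound beta y : 0 <= beta -> p beta <= tau -> beta <= y -> y <= B ->
  4 * excess p tau y ^+ 2 <= D beta B * (Int s beta B / 4).
Proof.
move=> b0 pb by_ yB.
have DI x z : 0 <= D x z by apply: Int_ge0 => t _; exact: sqr_ge0.
have SI x z : 0 <= Int s x z by apply: Int_ge0.
rewrite /excess; case: (lerP (p y - tau) 0) => [h|]; last rewrite subr_gt0 => py.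
  by rewrite expr0n/= mulr0 mulr_ge0 ?divr_ge0.
have [be [/andP[ybe beB] pbe Hbe Ebe]] := exists_first_below cp yB pB.
have [al [/andP[bal aly] pal Hal Eal]] := exists_last_below cp by_ pb.
have yb : y < be by rewrite lt_neqAle ybe andbT; apply/eqP => E; rewrite -E in pbe; have := lt_le_trans py pbe; rewrite ltxx.
have ay : al < y by rewrite lt_neqAle aly andbT; apply/eqP => E; rewrite E in pal; have := lt_le_trans py pal; rewrite ltxx.
have i1 := primitive_increment_sqr aly Lg gp; have i2 := primitive_increment_sqr ybe Lg gp.
rewrite (Eal ay) in i1; rewrite (Ebe yb) -sqrrN opprB in i2.
have h1 : 4 * (p y - tau) ^+ 2 <= (D al y + D y be) * ((y - al) + (be - y)).
  by apply: rise_and_fall => //; rewrite subr_ge0.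
apply: (le_trans h1); apply: ler_pM.
- exact: addr_ge0.
- by rewrite addr_ge0// subr_ge0.
- rewrite -Int_chasles//; apply: Int_sub => //; first by move=> *; exact: sqr_ge0.
  by rewrite (le_trans aly).
- rewrite ler_pdivlMr//.
  have -> : (y - al + (be - y)) * 4 = 4 * (be - al) by ring.
  apply: (@le_trans _ _ (Int s al be)).
    apply: four_le_Int_well; first by rewrite (le_trans aly).
    move=> z z1 z2; case: (leP z y) => zy; first exact: Hal.
    by apply: Hbe => //; exact: ltW.
  by apply: Int_sub => //; rewrite (le_trans aly).
Qed.

(** The crude estimate for the excursions above [tau] that follow the first
return: the maximal excess times the length of the set where it is positive.
The constant 4, against 3 in [half_mass_bound], makes the excursions
inefficient. *)
Lemma excess_mass_bound beta : 0 <= beta -> p beta <= tau -> beta <= B ->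
  4 * Int (excess p tau) beta B ^+ 2 <= D beta B * (Int s beta B / 4) ^+ 3.
Proof.
move=> b0 pb bB.
have DI : 0 <= D beta B by apply: Int_ge0 => t _; exact: sqr_ge0.
have SI : 0 <= Int s beta B by apply: Int_ge0.
set a := Int s beta B / 4; have a0 : 0 <= a by rewrite divr_ge0.
pose S := Num.sqrt (D beta B * a / 4).
have S2 : S ^+ 2 = D beta B * a / 4 by rewrite sqr_sqrtr// divr_ge0// mulr_ge0.
have m0 : 0 <= Int (excess p tau) beta B.
  by apply: Int_ge0 => t _; rewrite /excess le_max lexx orbT.
have mS : Int (excess p tau) beta B <= S * a.
  have -> : S * a = Int (fun t => S / 4 * s t) beta B by rewrite IntZ// /a; field.
  apply: le_Int; [exact/continuous_locint/cts_excess|exact: locintZ|].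
  move=> y /andP[by_ yB]; have e0 : 0 <= excess p tau y by rewrite le_max lexx orbT.
  have eS : excess p tau y <= S.
    have S0 : 0 <= S by exact: sqrtr_ge0.
    have : excess p tau y ^+ 2 <= S ^+ 2; last by rewrite ler_pXn2r.
    rewrite S2 ler_pdivlMr// mulrC.
    exact: profile_sup_bound.
  case: (leP (p y) tau) => py.
    have -> : excess p tau y = 0 by rewrite /excess; apply: max_r; rewrite subr_le0.
    by rewrite mulr_ge0 ?divr_ge0 ?sqrtr_ge0.
  apply: (le_trans eS); have s4 := ps py.
  have S0 : 0 <= S by exact: sqrtr_ge0.
  by rewrite mulrAC ler_pdivlMr//; apply: ler_wpM2l.
have E : 4 * (S * a) ^+ 2 = D beta B * a ^+ 3 by rewrite [(S * a) ^+ 2]exprMn S2; field.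
apply: (@le_trans _ _ (4 * (S * a) ^+ 2)); last by rewrite E.
by rewrite ler_pM2l// ler_pXn2r ?nnegrE// mulr_ge0 ?sqrtr_ge0.
Qed.

(** Integration by parts gives - int y g(y) dy on the left, and equality in
the Cauchy-Schwarz inequality holds for the linear profiles g of the cubic. *)
Lemma half_mass_bound beta : 0 <= beta -> (0 < beta -> p beta = tau) ->
  3 * Int (fun y => p y - tau) 0 beta ^+ 2 <= D 0 beta * beta ^+ 3.
Proof.
move=> b0 pb.
have gq : primitive g (fun y => p y + - tau) by exact: primitive_addc.
have := primitive_by_parts b0 gq (fun x => dr_id x) (@cts_cst R 1).
rewrite (eq_Int (g := fun y => p y - tau)); last by move=> x _; rewrite mulr1.
have -> : (p beta - tau) * beta = 0.
  move: b0 pb; rewrite le_eqVlt => /predU1P[<- _|b0 /(_ b0) ->]; by rewrite ?mulr0 ?subrr ?mul0r.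
rewrite mulr0 subrr sub0r => ->; rewrite sqrrN.
have Lid : L2loc (fun x : R => x) by apply: continuous_L2loc; exact: cts_id.
have := cauchy_schwarz b0 Lg Lid.
have -> : Int (fun x : R => x ^+ 2) 0 beta = beta ^+ 3 / 3.
  have d (x : R) : is_derive x 1 (fun x : R => x ^+ 3 * 3^-1) (x ^+ 2).
    apply: (dr_eq (drM (drX 3 (dr_id x)) (dr_cst 3^-1 x))).
    by rewrite /=; field.
  have csq : continuous (fun x : R => x ^+ 2) by apply: ctsX; exact: cts_id.
  by rewrite (Int_FTC b0 csq d) expr0n/= mul0r subr0.
by rewrite mulrA ler_pdivlMr// mulrC.
Qed.

End one_profile.
End HalfTransition.

(** * Stability of the optimal half transition *)
Section HalfTransitionStability.
Context {R : realType}.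
Implicit Types (p g s : R -> R) (a b c x y z tau beta B Lam rho : R).

(** The lower bound comes from [half_profile_stability], applied to the part of the
profile before its first return below [tau] and to the rest.  In the almost optimal case, the square of
g + (2/Lam) y is expanded: its cross term is an integral of p by parts, known up
to a small error, and the bending energy is at most 4 Lam/3 up to a small error,
which is exactly what makes the square small. *)
Lemma half_transition Lam rho : 0 < Lam -> 0 < rho -> exists2 kap, 0 < kap &
  forall B tau p g s, Lam + 1 <= B -> L2loc g -> primitive g p -> continuous s ->
  (forall y, 0 <= s y) -> p B <= tau -> (forall y, tau < p y -> 4 <= s y) ->
  0 <= tau -> tau <= kap ->
  2 * Lam ^+ 2 / 3 - kap <= Int (excess p tau) 0 B ->
  let X := Int (fun y => g y ^+ 2) 0 B + Int s 0 B in
  16 * Lam / 3 - rho <= X /\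
  (X <= 16 * Lam / 3 + kap -> `|p Lam| <= rho /\
    Int (fun y => (g y + 2 / Lam * y) ^+ 2) 0 Lam + Int (fun y => g y ^+ 2) Lam B <= rho).
Proof.
move=> Lam0 rho0.
(* r1 controls the errors in the conclusion, and the much smaller r0 those in
   the position of the first return and in the energies *)
near (0 : R)^'+ => r1.
have r10 : 0 < r1 by near: r1; exact: nbhs_right_gt.
have r11 : 1 * r1 <= 1 by near: r1; exact: small_near.
have r1a : 1 * r1 <= rho by near: r1; exact: small_near.
have r1b : (5 + 4 / Lam * (Lam + 3)) * r1 <= rho by near: r1; exact: small_near.
rewrite !mul1r in r11 r1a.
near (0 : R)^'+ => r0.
have r00 : 0 < r0 by near: r0; exact: nbhs_right_gt.
have r0a : 2 * r0 <= r1 by near: r0; exact: small_near.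
have r0b : (4 * Lam / 3 + 1) * r0 <= (r1 / 2) ^+ 2.
  by near: r0; apply: small_near; rewrite exprn_gt0// divr_gt0.
have r0c : 2 * r0 <= 1 by near: r0; exact: small_near.
have r0d : 2 * r0 <= Lam by near: r0; exact: small_near.
have V0 : 0 < 2 * Lam ^+ 2 / 3 by rewrite divr_gt0 ?mulr_gt0 ?exprn_gt0.
have Y0 : 0 < 16 * Lam / 3 by rewrite divr_gt0 ?mulr_gt0.
have c0 : (0 : R) < 128 / 3 by clear; lra.
have cV : 128 / 3 * (2 * Lam ^+ 2 / 3) = (16 * Lam / 3) ^+ 2 by clear; field.
have quartic t : 4 * t ^+ 4 - 16 * Lam / 3 * t ^+ 3 + 3 * (2 * Lam ^+ 2 / 3) ^+ 2 -
    (t - Lam) ^+ 2 * (4 / 3 * Lam ^+ 2) =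
    (t - Lam) ^+ 2 * (4 * t ^+ 2 + 8 / 3 * (Lam * t)) by clear; field.
have YLam : 16 * Lam / 3 = 4 * Lam + 4 * Lam / 3 by clear; field.
have [k k0 stab] := half_profile_stability Lam0 V0 Y0 c0 cV quartic YLam r00.
exists (Num.min k r0); first by rewrite lt_min k0.
move=> B tau p g s LB Lg gp cs s0 pB ps tau0; rewrite le_min => /andP[tauk taur] mass X.
have B0 : 0 <= B by clear -LB Lam0; lra.
have cp := primitive_continuous gp; have [mg lg2] := Lg.
have ls := continuous_locint cs.
have [beta [/andP[b0 bB] pb Hb Eb]] := exists_first_below cp B0 pB.
have DI x z : 0 <= Int (fun y => g y ^+ 2) x z by apply: Int_ge0 => t _; exact: sqr_ge0.
have SI x z : 0 <= Int s x z by apply: Int_ge0.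
set D1 := Int (fun y => g y ^+ 2) 0 beta.
set D2 := Int (fun y => g y ^+ 2) beta B.
pose a := Int s beta B / 4; pose m1 := Int (fun y => p y - tau) 0 beta.
pose m2 := Int (excess p tau) beta B.
have a0 : 0 <= a by rewrite divr_ge0.
have lex := continuous_locint (cts_excess (tau := tau) cp).
have m1E : Int (excess p tau) 0 beta = m1.
  apply: eq_Int_oo; [exact: locint_measurable| |].
    by apply: continuous_measurable_fun; apply: ctsB => //; exact: cts_cst.
  by move=> y /andP[y0 yb]; rewrite /excess max_l// subr_ge0 ltW// Hb// ltW.
have exc0 x z : 0 <= Int (excess p tau) x z.
  by apply: Int_ge0 => t _; rewrite /excess le_max lexx orbT.
have m10 : 0 <= m1 by rewrite -m1E.
have H1 : 3 * m1 ^+ 2 <= D1 * beta ^+ 3 by exact: (half_mass_bound Lg gp b0 Eb).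
have H2 : 4 * m2 ^+ 2 <= D2 * a ^+ 3 by exact: (excess_mass_bound Lg gp cs s0 pB ps b0 pb bB).
have sb : 4 * beta <= Int s 0 beta.
  rewrite -[X in 4 * X]subr0; apply: (four_le_Int_well (p := p) (tau := tau)) => //.
  by move=> z z0; apply: Hb; exact: ltW.
have XE : X = D1 + D2 + (Int s 0 beta + 4 * a).
  rewrite /X (Int_chasles lg2 b0 bB) (Int_chasles ls b0 bB) -/D1 -/D2.
  by congr (_ + (_ + _)); rewrite /a mulrC divfK.
have Xge : D1 + 4 * beta + (D2 + 4 * a) <= X by rewrite XE; clear -sb; lra.
have massk : 2 * Lam ^+ 2 / 3 - k <= m1 + m2.
  rewrite (Int_chasles lex b0 bB) m1E in mass.
  apply: le_trans mass; rewrite lerD2l lerN2 ge_min lexx //.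
have E1 : 128 / 3 * m1 <= (D1 + 4 * beta) ^+ 2.
  by apply: (energy_dominates_mass (DI _ _) b0 m10 (ltW c0) H1); clear; lra.
have E2 : 8 / 7 * (128 / 3) * m2 <= (D2 + 4 * a) ^+ 2.
  have c0' : (0 : R) <= 8 / 7 * (128 / 3) by clear; lra.
  by apply: (energy_dominates_mass (DI _ _) a0 (exc0 _ _) c0' H2); clear; lra.
have [lo hi] := stab D1 beta D2 a m1 m2 (DI _ _) b0 (DI _ _) a0 m10 (exc0 _ _) H1 E1 E2 massk.
split; first by clear -lo Xge r0a r1a r10 r00; lra.
move=> Xle.
have Xle' : D1 + 4 * beta + (D2 + 4 * a) <= 16 * Lam / 3 + k.
  by apply: (le_trans Xge); apply: (le_trans Xle); rewrite lerD2l ge_min lexx.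
have [bL mV Dtot0] := hi Xle'.
have Dtot : D1 + D2 <= 4 * Lam / 3 + r0 by clear -Dtot0 a0; lra.
have lamB : Lam <= B by clear -LB; lra.
have bp : 0 < beta by move: bL; rewrite ler_norml => /andP[h _]; clear -h r0d r00; lra.
have pbE : p beta = tau by exact: Eb.
have near_beta x : 0 <= x -> x <= B -> `|beta - x| <= r0 -> `|p x| <= r1.
  move=> x0 xB bx.
  have inc : (p x - tau) ^+ 2 <= (r1 / 2) ^+ 2.
    apply: (@le_trans _ _ ((D1 + D2) * r0)); last first.
      apply: le_trans r0b; rewrite ler_wpM2r ?(ltW r00)//.
      by clear -Dtot r0c; lra.
    have sub y z : 0 <= y -> y <= z -> z <= B -> Int (fun t => g t ^+ 2) y z <= D1 + D2.
      move=> y0 yz zB; rewrite /D1 /D2 -(Int_chasles lg2 b0 bB).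
      by apply: Int_sub => // *; exact: sqr_ge0.
    case: (leP beta x) => bx'.
      have := primitive_increment_sqr bx' Lg gp; rewrite pbE => h; apply: (le_trans h).
      apply: ler_pM => //; [by rewrite subr_ge0|exact: sub|].
      by rewrite distrC ger0_norm ?subr_ge0// in bx.
    have := primitive_increment_sqr (ltW bx') Lg gp; rewrite pbE -sqrrN opprB => h.
    apply: (le_trans h); apply: ler_pM => //; [by rewrite subr_ge0 ltW|exact: (sub _ _ _ (ltW bx'))|].
    by rewrite gtr0_norm ?subr_gt0// in bx.
  have nrm : `|p x - tau| <= r1 / 2.
    have : `|p x - tau| ^+ 2 <= (r1 / 2) ^+ 2 by rewrite real_normK// num_real.
    by rewrite ler_pXn2r// nnegrE// divr_ge0// ltW.
  have -> : p x = (p x - tau) + tau by clear; ring.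
  apply: (le_trans (ler_normD _ _)); rewrite (ger0_norm tau0).
  by clear -nrm taur r0a; lra.
have pL : `|p Lam| <= r1 by apply: near_beta => //; exact: ltW.
split; first exact: le_trans r1a.
have lp := continuous_locint cp.
have lpt : locint (fun y => p y - tau).
  by apply: locintB => //; apply: continuous_locint; exact: cts_cst.
have Ib : Int p 0 beta = m1 + tau * beta.
  rewrite -[beta in tau * beta]subr0 -(Int_cst tau b0) /m1 -IntD//.
    by apply: eq_Int => y _; ring.
  by apply: continuous_locint; exact: cts_cst.
have between x z : 0 <= x -> x <= z -> z <= B -> z - x <= r0 ->
   (forall y, x <= y <= z -> `|p y| <= r1) -> `|Int p x z| <= r1.
  move=> x0 xz zB zx H; apply: (le_trans (normr_Int _ _ lp)).
  apply: (@le_trans _ _ (Int (fun=> r1) x z)).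
    by apply: le_Int => //; [exact: locint_norm|apply: continuous_locint; exact: cts_cst].
  rewrite Int_cst// -[leRHS]mulr1 ler_pM2l//; clear -zx r0c r00; lra.
have pint : `|Int p 0 Lam - (2 * Lam ^+ 2 / 3)| <= (Lam + 3) * r1.
  have D : `|Int p 0 Lam - Int p 0 beta| <= r1.
    case: (leP beta Lam) => bl.
      rewrite (Int_chasles lp b0 bl) addrAC subrr add0r.
      move: bL; rewrite distrC ger0_norm ?subr_ge0// => bL.
      apply: between => // y /andP[y1 y2]; apply: near_beta.
      - exact: le_trans y1.
      - exact: le_trans lamB.
      - rewrite distrC ger0_norm ?subr_ge0//; clear -y2 bL; lra.
    rewrite (Int_chasles lp (ltW Lam0) (ltW bl)) opprD addNKr normrN.
    move: bL; rewrite gtr0_norm ?subr_gt0// => bL.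
    apply: between => //; [exact: ltW|exact: ltW|] => y /andP[y1 y2]; apply: near_beta.
    - by apply: le_trans y1; exact: ltW.
    - exact: le_trans bB.
    - rewrite ger0_norm ?subr_ge0//; clear -y1 bL; lra.
  have -> : Int p 0 Lam - 2 * Lam ^+ 2 / 3 = (Int p 0 Lam - Int p 0 beta) +
     (m1 - 2 * Lam ^+ 2 / 3) + tau * beta by rewrite Ib; ring.
  apply: (le_trans (ler_normD _ _)); rewrite (ger0_norm (x := tau * beta)) ?mulr_ge0//.
  have tb : tau * beta <= r1 * (Lam + 1).
    apply: ler_pM => //; first by clear -taur r0a r00; lra.
    by move: bL; rewrite ler_norml => /andP[_ h]; clear -h r0c r00; lra.
  have := ler_normD (Int p 0 Lam - Int p 0 beta) (m1 - 2 * Lam ^+ 2 / 3).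
  by move=> h; clear -h D mV tb r0a r00; lra.
pose c := 2 / Lam.
have cid : continuous (fun y : R => y) by exact: cts_id.
have Lid := continuous_L2loc cid.
have lgid := L2locM Lg Lid.
have lid2 : locint (fun y : R => y ^+ 2) by case: Lid.
have Eid : Int (fun y : R => y ^+ 2) 0 Lam = Lam ^+ 3 / 3.
  have d (x : R) : is_derive x 1 (fun x : R => x ^+ 3 * 3^-1) (x ^+ 2).
    apply: (dr_eq (drM (drX 3 (dr_id x)) (dr_cst 3^-1 x))).
    by rewrite /=; field.
  have csq : continuous (fun x : R => x ^+ 2) by apply: ctsX; exact: cts_id.
  by rewrite (Int_FTC (ltW Lam0) csq d) expr0n/= mul0r subr0.
have parts : Int (fun y => g y * y) 0 Lam = Lam * p Lam - Int p 0 Lam.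
  have := primitive_by_parts (ltW Lam0) gp (fun x => dr_id x) (@cts_cst R 1).
  rewrite (eq_Int (g := p)); last by move=> x _; rewrite mulr1.
  by move=> ->; rewrite mulr0; ring.
have -> : Int (fun y => (g y + 2 / Lam * y) ^+ 2) 0 Lam =
    Int (fun y => g y ^+ 2) 0 Lam + 2 * c * (Lam * p Lam - Int p 0 Lam) + c ^+ 2 * (Lam ^+ 3 / 3).
  have l1 := locintZ (2 * c) lgid; have l2 := locintZ (c ^+ 2) lid2.
  rewrite -parts -Eid -(IntZ (2 * c))// -(IntZ (c ^+ 2))// -IntD// -IntD//; last exact: locintD.
  by apply: eq_Int => y _; rewrite -/c; ring.
have Dsum : Int (fun y => g y ^+ 2) 0 Lam + Int (fun y => g y ^+ 2) Lam B = D1 + D2.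
  by rewrite -(Int_chasles lg2 (ltW Lam0) lamB) /D1 /D2 -(Int_chasles lg2 b0 bB).
have cE1 : 2 * c * Lam = 4 by rewrite /c; field; rewrite gt_eqF.
have cE2 : c ^+ 2 * (Lam ^+ 3 / 3) = 4 * Lam / 3 by rewrite /c; field; rewrite gt_eqF.
have cE3 : 2 * c * (2 * Lam ^+ 2 / 3) = 8 * Lam / 3 by rewrite /c; field; rewrite gt_eqF.
have c20 : 0 < 2 * c by rewrite /c mulr_gt0// divr_gt0.
have pint' : - ((2 * c) * Int p 0 Lam) <= 2 * c * ((Lam + 3) * r1) - 8 * Lam / 3.
  move: pint; rewrite ler_norml => /andP[h _].
  have : 2 * c * (- ((Lam + 3) * r1)) <= 2 * c * (Int p 0 Lam - 2 * Lam ^+ 2 / 3).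
    by rewrite ler_pM2l.
  by rewrite mulrBr cE3; clear; lra.
have pl' : 4 * p Lam <= 4 * r1.
  by move: pL; rewrite ler_norml => /andP[_ h]; clear -h; lra.
have -> : Int (fun y => g y ^+ 2) 0 Lam + 2 * c * (Lam * p Lam - Int p 0 Lam) +
    c ^+ 2 * (Lam ^+ 3 / 3) + Int (fun y => g y ^+ 2) Lam B =
    (Int (fun y => g y ^+ 2) 0 Lam + Int (fun y => g y ^+ 2) Lam B) + (2 * c * Lam) * p Lam
    - (2 * c) * Int p 0 Lam + c ^+ 2 * (Lam ^+ 3 / 3) by clear; ring.
rewrite Dsum cE1 cE2.
have rE : (5 + 4 / Lam * (Lam + 3)) * r1 = 5 * r1 + 2 * c * ((Lam + 3) * r1).
  by rewrite /c; field; rewrite gt_eqF.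
rewrite rE in r1b.
by clear -r1b pint' pl' Dtot r0a r00 r10; lra.
Unshelve. all: by end_near. Qed.

End HalfTransitionStability.

(** * The competitor *)
Section Competitor.
Context {R : realType}.
Implicit Types (p g s w : R -> R) (a b x y z t A B L wl wr M V : R).

Lemma h2rep_parabola (a q z : R) :
  h2rep (fun y => a + q / 2 * (y - z) ^+ 2) (fun y => q * (y - z)) (fun=> q).
Proof.
apply: h2rep_smooth => [x|x|]; last exact: cts_cst.
- apply: (dr_eq (drD (dr_cst a x) (drZ (q / 2) (drX 2 (drB (dr_id x) (dr_cst z x)))))).
  by rewrite /= expr1; field.
- by apply: (dr_eq (drZ q (drB (dr_id x) (dr_cst z x)))); ring.
Qed.

(** The cubic transition of half-width L and total height M around the point
(t, m), reaching its extreme values with zero slope; [cubic_p] and [cubic_g] are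
its derivatives. *)
Definition cubic_w L M m t y : R :=
  m + M / (4 * L ^+ 3) * (3 * L ^+ 2 * (y - t) - (y - t) ^+ 3).
Definition cubic_p L M t y : R := 3 * M / (4 * L ^+ 3) * (L ^+ 2 - (y - t) ^+ 2).
Definition cubic_g L M t y : R := - (3 * M / (2 * L ^+ 3)) * (y - t).

Lemma cubic_w_derive L M m t (x : R) : L != 0 -> is_derive x 1 (cubic_w L M m t) (cubic_p L M t x).
Proof.
move=> L0; have D := drB (dr_id x) (dr_cst t x).
apply: (dr_eq (drD (dr_cst m x) (drZ (M / (4 * L ^+ 3))
  (drB (drZ (3 * L ^+ 2) D) (drX 3 D))))).
by rewrite /cubic_p /=; field.
Qed.

Lemma h2rep_cubic L M m t : L != 0 ->
  h2rep (cubic_w L M m t) (cubic_p L M t) (cubic_g L M t).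
Proof.
move=> L0; apply: h2rep_smooth => [x|x|]; first exact: cubic_w_derive.
- have D := drB (dr_id x) (dr_cst t x).
  apply: (dr_eq (drZ (3 * M / (4 * L ^+ 3)) (drB (dr_cst (L ^+ 2) x) (drX 2 D)))).
  by rewrite /cubic_g /=; field.
- apply: ctsM; first exact: cts_cst.
  by apply: ctsB; [exact: cts_id|exact: cts_cst].
Qed.

Lemma cubic_w_left L M m t : L != 0 -> cubic_w L M m t (t - L) = m - M / 2.
Proof. by move=> L0; rewrite /cubic_w; field. Qed.

Lemma cubic_w_right L M m t : L != 0 -> cubic_w L M m t (t + L) = m + M / 2.
Proof. by move=> L0; rewrite /cubic_w; field. Qed.

Lemma cubic_p_left L M t : cubic_p L M t (t - L) = 0.
Proof. by rewrite /cubic_p (_ : t - L - t = - L); [rewrite sqrrN subrr mulr0|ring]. Qed.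

Lemma cubic_p_right L M t : cubic_p L M t (t + L) = 0.
Proof. by rewrite /cubic_p (_ : t + L - t = L); [rewrite subrr mulr0|ring]. Qed.

Lemma cubic_p_bound L M t y : 0 < L -> t - L <= y -> y <= t + L ->
  `|cubic_p L M t y| <= `|3 * M / (4 * L)|.
Proof.
move=> L0 y1 y2; have L2 : 0 < L ^+ 2 by exact: exprn_gt0.
have -> : cubic_p L M t y = 3 * M / (4 * L) * ((L ^+ 2 - (y - t) ^+ 2) / L ^+ 2).
  by rewrite /cubic_p; field; rewrite gt_eqF.
rewrite normrM ler_piMr// ger0_norm.
  by rewrite ler_pdivrMr// mul1r gerBl sqr_ge0.
rewrite divr_ge0 ?(ltW L2)// subr_ge0 -[leLHS]real_normK ?num_real//.
by rewrite ler_pXn2r ?nnegrE ?(ltW L0)// ler_norml; apply/andP; split; clear -y1 y2; lra.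
Qed.

Lemma cubic_w_bound L M m t y : 0 < L -> t - L <= y -> y <= t + L ->
  `|cubic_w L M m t y - m| <= `|M| / 2.
Proof.
move=> L0 y1 y2.
pose z := (y - t) / L.
have z1 : -1 <= z by rewrite /z ler_pdivlMr//; clear -y1; lra.
have z2 : z <= 1 by rewrite /z ler_pdivrMr//; clear -y2; lra.
have -> : cubic_w L M m t y - m = M / 2 * ((3 * z - z ^+ 3) / 2).
  by rewrite /cubic_w /z; field; rewrite gt_eqF.
rewrite normrM normrM (ger0_norm (x := 2^-1)) ?invr_ge0// ler_piMr ?divr_ge0//.
rewrite ler_norml; apply/andP; split.
  rewrite -subr_ge0 (_ : (3 * z - z ^+ 3) / 2 - -1 = (z + 1) ^+ 2 * (2 - z) / 2); last by field.
  by rewrite divr_ge0// mulr_ge0 ?sqr_ge0//; clear -z2; lra.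
rewrite -subr_ge0 (_ : 1 - (3 * z - z ^+ 3) / 2 = (1 - z) ^+ 2 * (2 + z) / 2); last by field.
by rewrite divr_ge0// mulr_ge0 ?sqr_ge0//; clear -z1; lra.
Qed.

Lemma Int_cubic_w L M m t : 0 < L -> Int (cubic_w L M m t) (t - L) (t + L) = m * (2 * L).
Proof.
move=> L0; have Ln : L != 0 by rewrite gt_eqF.
have cw : continuous (cubic_w L M m t) by exact: (is_derive_continuous (fun x => cubic_w_derive M m t x Ln)).
have d (x : R) : is_derive x 1 (fun y => m * (y - t) + M / (4 * L ^+ 3) *
    (3 * L ^+ 2 / 2 * (y - t) ^+ 2 - 4^-1 * (y - t) ^+ 4)) (cubic_w L M m t x).
  have D := drB (dr_id x) (dr_cst t x).
  apply: (dr_eq (drD (drZ m D) (drZ (M / (4 * L ^+ 3))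
    (drB (drZ (3 * L ^+ 2 / 2) (drX 2 D)) (drZ 4^-1 (drX 4 D)))))).
  by rewrite /cubic_w /=; field.
have LL : t - L <= t + L by clear -L0; lra.
by rewrite (Int_FTC LL cw d); field.
Qed.

Lemma Int_cubic_g2 L M t : 0 < L ->
  Int (fun y => cubic_g L M t y ^+ 2) (t - L) (t + L) = 3 / 2 * (M ^+ 2 / L ^+ 3).
Proof.
move=> L0; have Ln : L != 0 by rewrite gt_eqF.
have [_ _] := h2rep_cts (h2rep_cubic M 0 t Ln) => _.
have d (x : R) : is_derive x 1 (fun y => 3 * M ^+ 2 / (4 * L ^+ 6) * (y - t) ^+ 3)
    (cubic_g L M t x ^+ 2).
  have D := drB (dr_id x) (dr_cst t x).
  apply: (dr_eq (drZ (3 * M ^+ 2 / (4 * L ^+ 6)) (drX 3 D))).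
  by rewrite /cubic_g /=; field.
have cg : continuous (fun y => cubic_g L M t y ^+ 2).
  apply: ctsX; apply: ctsM; first exact: cts_cst.
  by apply: ctsB; [exact: cts_id|exact: cts_cst].
have LL : t - L <= t + L by clear -L0; lra.
by rewrite (Int_FTC LL cg d); field.
Qed.

Lemma Int_parabola (a q z x y : R) : x <= y ->
  Int (fun y => a + q / 2 * (y - z) ^+ 2) x y =
  a * (y - x) + q / 6 * ((y - z) ^+ 3 - (x - z) ^+ 3).
Proof.
move=> xy.
have [cw _ _] := h2rep_cts (h2rep_parabola a q z).
have d (s : R) : is_derive s 1 (fun y => a * y + q / 6 * (y - z) ^+ 3)
    (a + q / 2 * (s - z) ^+ 2).
  have D := drB (dr_id s) (dr_cst z s).
  by apply: (dr_eq (drD (drZ a (dr_id s)) (drZ (q / 6) (drX 3 D)))); rewrite /=; field.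
by rewrite (Int_FTC xy cw d); ring.
Qed.

Definition five a b c d (f1 f2 f3 f4 f5 : R -> R) : R -> R :=
  paste a f1 (paste b f2 (paste c f3 (paste d f4 f5))).

Lemma Int_five A a b c d B f1 f2 f3 f4 f5 :
  locint f1 -> locint f2 -> locint f3 -> locint f4 -> locint f5 ->
  A <= a -> a <= b -> b <= c -> c <= d -> d <= B ->
  Int (five a b c d f1 f2 f3 f4 f5) A B =
  Int f1 A a + Int f2 a b + Int f3 b c + Int f4 c d + Int f5 d B.
Proof.
move=> l1 l2 l3 l4 l5 Aa ab bc cd dB.
have l45 := locint_paste d l4 l5; have l345 := locint_paste c l3 l45.
have l2345 := locint_paste b l2 l345.
have cB := le_trans cd dB; have bB := le_trans bc cB; have aB := le_trans ab bB.
by rewrite /five (Int_paste l1 l2345)// (Int_paste l2 l345)// (Int_paste l3 l45)// (Int_paste l4 l5)// !addrA.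
Qed.

Lemma five_comp a b c d f1 f2 f3 f4 f5 (F : R -> R) :
  (fun y => F (five a b c d f1 f2 f3 f4 f5 y)) =
  five a b c d (fun y => F (f1 y)) (fun y => F (f2 y)) (fun y => F (f3 y))
    (fun y => F (f4 y)) (fun y => F (f5 y)).
Proof. by apply/funext => y; rewrite /five /paste; do 4 case: ifP => //. Qed.

Section five_pieces.
Variables (A B L wA wB pA pB t : R).
Hypotheses (L0 : 0 < L) (At : A + 1 <= t - L) (tB : t + L <= B - 1).
Let wl := wA + pA / 2.
Let wr := wB - pB / 2.
Let M := wr - wl.
Let m := (wl + wr) / 2.

(** The parabolas on [A, A + 1] and [B - 1, B] bring the prescribed slopes at A
and B to zero; wl and wr are the heights that they reach. *)
Definition comp_w := five (A + 1) (t - L) (t + L) (B - 1)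
  (fun y => wl + (- pA) / 2 * (y - (A + 1)) ^+ 2) (fun=> wl) (cubic_w L M m t)
  (fun=> wr) (fun y => wr + pB / 2 * (y - (B - 1)) ^+ 2).
Definition comp_p := five (A + 1) (t - L) (t + L) (B - 1)
  (fun y => - pA * (y - (A + 1))) (fun=> 0) (cubic_p L M t) (fun=> 0)
  (fun y => pB * (y - (B - 1))).
Definition comp_g := five (A + 1) (t - L) (t + L) (B - 1)
  (fun=> - pA) (fun=> 0) (cubic_g L M t) (fun=> 0) (fun=> pB).

Let Ln : L != 0. Proof. by rewrite gt_eqF. Qed.

Let AL : A <= A + 1. Proof. by rewrite lerDl. Qed.
Let tt : t - L <= t + L. Proof. by have := L0; lra. Qed.
Let BL : B - 1 <= B. Proof. by rewrite gerBl. Qed.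

Lemma comp_h2rep : h2rep comp_w comp_p comp_g.
Proof.
have hc a : h2rep (fun _ : R => a) (fun _ : R => 0 : R) (fun _ : R => 0 : R).
  exact: (h2rep_smooth (fun x => dr_cst a x) (fun x => dr_cst 0 x) (@cts_cst R 0)).
rewrite /comp_w /comp_p /comp_g /five; apply: h2rep_paste; first exact: h2rep_parabola.
- apply: h2rep_paste; first exact: hc.
  + apply: h2rep_paste; first exact: h2rep_cubic.
    * apply: h2rep_paste; [exact: hc|exact: h2rep_parabola| |].
        by rewrite subrr expr0n/= mulr0 addr0.
      by rewrite subrr mulr0.
    * by rewrite /paste tB cubic_w_right// /m /M; field.
    * by rewrite /paste tB cubic_p_right.
  + by rewrite /paste tt cubic_w_left// /m /M; field.
  + by rewrite /paste tt cubic_p_left.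
- by rewrite /paste At subrr expr0n/= mulr0 addr0.
- by rewrite /paste At subrr mulr0.
Qed.

Lemma comp_ends : [/\ comp_w A = wA, comp_p A = pA, comp_w B = wB & comp_p B = pB].
Proof.
have h1 : t - L < B by have := L0; have := tB; lra.
have h2 : A + 1 < B by apply: le_lt_trans h1.
have h3 : t + L < B by have := tB; lra.
have h4 : B - 1 < B by rewrite gtrBl.
by split; rewrite /comp_w /comp_p /five /paste ?AL ?(lt_geF h2) ?(lt_geF h1) ?(lt_geF h3) ?(lt_geF h4) /wl /wr; field.
Qed.

(** The integral is affine in the position [t] of the transition, with slope
wl - wr, so that a suitable position gives any prescribed value if wl <> wr. *)
Lemma Int_comp_w : Int comp_w A B = wl * (t - A) + wr * (B - t) + (pB - pA) / 6.
Proof.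
have [c1 _ _] := h2rep_cts (h2rep_parabola wl (- pA) (A + 1)).
have [c2 _ _] := h2rep_cts (h2rep_parabola wr pB (B - 1)).
have [c3 _ _] := h2rep_cts (h2rep_cubic M m t Ln).
have l1 := continuous_locint c1; have l2 := continuous_locint c2.
have l3 := continuous_locint c3.
have lc a : locint (fun _ : R => a) by exact/continuous_locint/cts_cst.
by rewrite /comp_w Int_five// !Int_cst// Int_cubic_w// !Int_parabola// /m; field.
Qed.

Lemma Int_comp_g2 : Int (fun y => comp_g y ^+ 2) A B =
  pA ^+ 2 + pB ^+ 2 + 3 / 2 * (M ^+ 2 / L ^+ 3).
Proof.
rewrite /comp_g (five_comp _ _ _ _ _ _ _ _ _ (fun z => z ^+ 2)).
have cg : continuous (fun y => cubic_g L M t y ^+ 2).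
  apply: ctsX; apply: ctsM; first exact: cts_cst.
  by apply: ctsB; [exact: cts_id|exact: cts_cst].
have l3 := continuous_locint cg.
have lc a : locint (fun _ : R => a) by exact/continuous_locint/cts_cst.
rewrite Int_five//.
by rewrite !Int_cst// Int_cubic_g2// expr0n/= sqrrN; ring.
Qed.

Lemma Int_comp_well (Psi : R -> R) : continuous Psi -> Psi 0 = 0 ->
  (forall x y, `|x| <= `|y| -> Psi x <= Psi y) ->
  Int (fun y => Psi (comp_p y)) A B <= Psi pA + Psi pB + 2 * L * Psi (3 * M / (4 * L)).
Proof.
move=> cPsi Psi0 mPsi; rewrite /comp_p (five_comp _ _ _ _ _ _ _ _ _ Psi).
have [_ c1 _] := h2rep_cts (h2rep_parabola wl (- pA) (A + 1)).
have [_ c2 _] := h2rep_cts (h2rep_parabola wr pB (B - 1)).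
have [_ c3 _] := h2rep_cts (h2rep_cubic M m t Ln).
have l1 := continuous_locint (cts_comp c1 cPsi).
have l2 := continuous_locint (cts_comp c2 cPsi).
have l3 := continuous_locint (cts_comp c3 cPsi).
have lc a : locint (fun _ : R => a) by exact/continuous_locint/cts_cst.
rewrite Int_five// !Int_cst// Psi0 !mul0r !addr0.
have b1 : Int (fun y => Psi (- pA * (y - (A + 1)))) A (A + 1) <= Psi pA.
  have -> : Psi pA = Int (fun=> Psi pA) A (A + 1) by rewrite Int_cst//; ring.
  apply: le_Int; [exact: l1|exact: lc|] => y /andP[y1 y2]; apply: mPsi.
  rewrite normrM normrN ler_piMr// ler_norml; apply/andP; split; have := y1; have := y2; lra.
have b3 : Int (fun y => Psi (cubic_p L M t y)) (t - L) (t + L) <= 2 * L * Psi (3 * M / (4 * L)).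
  have -> : 2 * L * Psi (3 * M / (4 * L)) =
      Int (fun=> Psi (3 * M / (4 * L))) (t - L) (t + L) by rewrite Int_cst//; ring.
  apply: le_Int; [exact: l3|exact: lc|] => y /andP[y1 y2]; apply: mPsi.
  exact: cubic_p_bound.
have b2 : Int (fun y => Psi (pB * (y - (B - 1)))) (B - 1) B <= Psi pB.
  have -> : Psi pB = Int (fun=> Psi pB) (B - 1) B by rewrite Int_cst//; ring.
  apply: le_Int; [exact: l2|exact: lc|] => y /andP[y1 y2]; apply: mPsi.
  rewrite normrM ler_piMr// ler_norml; apply/andP; split; have := y1; have := y2; lra.
by have := lerD (lerD b1 b3) b2; lra.
Qed.

Definition step V y : R := paste 0 (fun=> - V) (fun=> V) y.

Lemma comp_w_left y : A <= y -> y <= t - L -> `|comp_w y - wl| <= `|pA|.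
Proof.
move=> Ay yt; rewrite /comp_w /five /paste yt.
case: ifP => [yA|_]; last by rewrite subrr normr0.
rewrite addrAC subrr add0r normrM normrM normrN (ger0_norm (x := 2^-1)) ?invr_ge0//.
rewrite -mulrA ler_piMr//.
have : `|(y - (A + 1)) ^+ 2| <= 1; last by move=> ?; lra.
have z1 : `|y - (A + 1)| <= 1 by rewrite ler_norml; apply/andP; split; lra.
by rewrite normrX exprn_ile1.
Qed.

Lemma comp_w_right y : y <= B -> t + L <= y -> `|comp_w y - wr| <= `|pB|.
Proof.
move=> yB ty; have L0' := L0; have At' := At.
have zero : y = t + L -> comp_w y = wr.
  move=> E; rewrite /comp_w /five /paste ifF; last by apply/negbTE; rewrite -ltNge; lra.
  rewrite ifF; last by apply/negbTE; rewrite -ltNge; lra.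
  by rewrite E lexx cubic_w_right// /m /M; field.
move: ty; rewrite le_eqVlt => /predU1P[/esym/zero->|ty]; first by rewrite subrr normr0.
rewrite /comp_w /five /paste ifF; last by apply/negbTE; rewrite -ltNge; lra.
rewrite ifF; last by apply/negbTE; rewrite -ltNge; lra.
rewrite (lt_geF ty); case: ifP => [_|/negbT]; first by rewrite subrr normr0.
rewrite -ltNge => yb.
rewrite addrAC subrr add0r normrM normrM (ger0_norm (x := 2^-1)) ?invr_ge0//.
rewrite -mulrA ler_piMr//.
have : `|(y - (B - 1)) ^+ 2| <= 1; last by move=> ?; lra.
have z1 : `|y - (B - 1)| <= 1 by rewrite ler_norml; apply/andP; split; lra.
by rewrite normrX exprn_ile1.
Qed.

Lemma comp_w_middle V y : t - L < y -> y < t + L ->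
  `|comp_w y| <= `|V| + `|wl + V| + `|wr - V|.
Proof.
move=> y1 y2.
have -> : comp_w y = cubic_w L M m t y.
  rewrite /comp_w /five /paste (lt_geF y1) (ltW y2) ifF//.
  by apply/negbTE; rewrite -ltNge; apply: le_lt_trans y1.
have h := cubic_w_bound M m L0 (ltW y1) (ltW y2).
have -> : cubic_w L M m t y = (cubic_w L M m t y - m) + m by ring.
have hM : `|M| <= 2 * `|V| + `|wl + V| + `|wr - V|.
  have -> : M = (wr - V) - (wl + V) + 2 * V by rewrite /M; ring.
  apply: (le_trans (ler_normD _ _)); rewrite normrM (ger0_norm (x := 2))//.
  by have := ler_normB (wr - V) (wl + V); lra.
have hm : `|m| <= (`|wl + V| + `|wr - V|) / 2.
  have -> : m = ((wl + V) + (wr - V)) / 2 by rewrite /m; ring.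
  by rewrite normrM (ger0_norm (x := 2^-1)) ?invr_ge0// ler_pM2r ?invr_gt0// ler_normD.
by have := ler_normD (cubic_w L M m t y - m) m; lra.
Qed.

(** Away from the origin the competitor differs from the sharp step only by the
errors in the boundary data. *)
Lemma comp_w_step V r y : A <= y <= B -> `|t| + L <= r ->
  `|comp_w y - step V y| <=
  `|wl + V| + `|wr - V| + `|pA| + `|pB| + (if `|y| <= r then 2 * `|V| else 0).
Proof.
move=> /andP[Ay yB] tr.
have nwl := normr_ge0 (wl + V); have nwr := normr_ge0 (wr - V).
have npA := normr_ge0 pA; have npB := normr_ge0 pB; have nV := normr_ge0 V.
have tl := ler_norm t; have tl' := ler_norm (- t); rewrite normrN in tl'.
have S1 : `|step V y| <= `|V| by rewrite /step /paste; case: ifP; rewrite ?normrN.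
have S2 : `|step V y + V| <= 2 * `|V|.
  by have := ler_normD (step V y) V; lra.
have S3 : `|step V y - V| <= 2 * `|V|.
  by have := ler_normB (step V y) V; lra.
have L0' := L0.
case: (leP `|y| r) => yr.
  case: (leP y (t - L)) => y1.
    have h := comp_w_left Ay y1.
    have -> : comp_w y - step V y = (comp_w y - wl) + (wl + V) - (step V y + V) by ring.
    have := ler_normB ((comp_w y - wl) + (wl + V)) (step V y + V).
    by have := ler_normD (comp_w y - wl) (wl + V); lra.
  case: (leP (t + L) y) => y2.
    have h := comp_w_right yB y2.
    have -> : comp_w y - step V y = (comp_w y - wr) + (wr - V) - (step V y - V) by ring.
    have := ler_normB ((comp_w y - wr) + (wr - V)) (step V y - V).
    by have := ler_normD (comp_w y - wr) (wr - V); lra.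
  have h := comp_w_middle V y1 y2.
  by have := ler_normB (comp_w y) (step V y); lra.
rewrite addr0; move: yr; rewrite lter_normr => /orP[yr|yr].
  have y2 : t + L <= y by lra.
  have -> : step V y = V by rewrite /step /paste ifF//; apply/negbTE; rewrite -ltNge; lra.
  have h := comp_w_right yB y2.
  have -> : comp_w y - V = (comp_w y - wr) + (wr - V) by ring.
  by have := ler_normD (comp_w y - wr) (wr - V); lra.
have y1 : y <= t - L by lra.
have -> : step V y = - V by rewrite /step /paste ifT//; lra.
have h := comp_w_left Ay y1.
have -> : comp_w y - - V = (comp_w y - wl) + (wl + V) by ring.
by have := ler_normD (comp_w y - wl) (wl + V); lra.
Qed.

End five_pieces.
End Competitor.

(** * Comparison with the competitor *)
Section EnergyUpperBound.
Context {R : realType}.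
Implicit Types (p g w : R -> R) (a b x y z t A B L M V C : R).

Lemma locint_step V : locint (step V).
Proof.
by apply: locint_paste; apply: continuous_locint; exact: cts_cst.
Qed.

Lemma Int_step V A B : A <= 0 -> 0 <= B -> Int (step V) A B = V * (A + B).
Proof.
move=> A0 B0; have lc a : locint (fun _ : R => a) by exact/continuous_locint/cts_cst.
by rewrite (Int_paste (lc _) (lc _) A0 B0) !Int_cst//; ring.
Qed.

Lemma Int_window r k A B : 0 <= r -> A <= - (r + 1) -> r + 1 <= B -> 0 <= k ->
  forall f, locint f -> (forall y, A <= y <= B -> f y <= if `|y| <= r then k else 0) ->
  Int f A B <= 2 * k * (r + 1).
Proof.
move=> r0 Ar rB k0 f lf H.
have lc a : locint (fun _ : R => a) by exact/continuous_locint/cts_cst.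
have l1 := locint_paste (r + 1) (lc k) (lc 0).
have l2 := locint_paste (- (r + 1)) (lc 0) l1.
have E : Int (paste (- (r + 1)) (fun=> 0) (paste (r + 1) (fun=> k) (fun=> 0))) A B =
    2 * k * (r + 1).
  have h : - (r + 1) <= r + 1 by clear -r0; lra.
  rewrite (Int_paste (lc _) l1 Ar (le_trans h rB)) (Int_paste (lc _) (lc _) h rB).
  by rewrite !Int_cst//; ring.
rewrite -E; apply: le_Int => // y Ay; apply: (le_trans (H _ Ay)).
rewrite /paste; case: ifP => yr.
  move: yr; rewrite ler_norml => /andP[y1 y2].
  rewrite ifF; last by apply/negbTE; rewrite -ltNge; clear -y1; lra.
  by rewrite ifT//; clear -y2; lra.
by case: ifP => // _; case: ifP.
Qed.

(** The number c0 is arbitrary and does not enter the bound.  By convexity the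
fidelity terms of the competitor W and of w differ by at most
2b int (W - c0 - Fb)(W - w), and the contribution of c0 is the integral of
W - w, which is zero by the choice of the position of the transition. *)
Lemma energy_upper_bound L V b C c0 A B w p g (Fb Psi : R -> R) :
  0 < L -> 0 <= b -> 0 <= C -> A <= 0 -> 0 <= B -> h2rep w p g -> continuous Fb ->
  (forall y, A <= y <= B -> `|Fb y| <= C) ->
  continuous Psi -> Psi 0 = 0 -> (forall x y, `|x| <= `|y| -> Psi x <= Psi y) ->
  (forall W Q H, h2rep W Q H -> W A = w A -> Q A = p A -> W B = w B -> Q B = p B ->
    Int (fun y => g y ^+ 2 + Psi (p y) + b * (w y - (c0 + Fb y)) ^+ 2) A B <=
    Int (fun y => H y ^+ 2 + Psi (Q y) + b * (W y - (c0 + Fb y)) ^+ 2) A B) ->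
  let wl := w A + p A / 2 in let wr := w B - p B / 2 in let M := wr - wl in
  let e := `|wl + V| + `|wr - V| + `|p A| + `|p B| in
  let N := Int (fun y => `|w y - step V y|) A B in
  let T := (e * (B - A) + `|p A| + `|p B| + N) / `|M| in
  M != 0 -> T + L + 1 <= - A -> T + L + 1 <= B ->
  Int (fun y => g y ^+ 2 + Psi (p y)) A B <=
    p A ^+ 2 + p B ^+ 2 + 3 / 2 * (M ^+ 2 / L ^+ 3) +
    (Psi (p A) + Psi (p B) + 2 * L * Psi (3 * M / (4 * L))) +
    2 * b * ((3 * `|V| + e + C) * (N + e * (B - A) + 4 * `|V| * (T + L + 1))).
Proof.
move=> L0 b0 C0 A0 B0 r cF FC cPsi Psi0 mPsi mini wl wr M e N T Mn0 TA TB.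
have [cw cp lg] := h2rep_cts r; have [[mg lg2] _ _] := r.
have e0 : 0 <= e by rewrite /e !addr_ge0.
have N0 : 0 <= N by apply: Int_ge0.
have BA0 : 0 <= B - A by rewrite subr_ge0 (le_trans A0).
have AB : A <= B by rewrite -subr_ge0.
have T0 : 0 <= T by rewrite /T divr_ge0// !addr_ge0// mulr_ge0.
have lw := continuous_locint cw; have lS := locint_step V.
have lwS : locint (fun y => w y - step V y) by exact: locintB.
have Iw : `|Int w A B - V * (A + B)| <= N.
  rewrite -Int_step// -IntB//; exact: normr_Int.
(* the position for which the competitor and w have equal integrals *)
pose t := (wr * B - wl * A + (p B - p A) / 6 - Int w A B) / M.
have tM : t * M = wr * B - wl * A + (p B - p A) / 6 - Int w A B by rewrite /t divfK.
have tT : `|t| <= T.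
  rewrite /T ler_pdivlMr ?normr_gt0// -normrM tM.
  have -> : wr * B - wl * A + (p B - p A) / 6 - Int w A B =
    (wr - V) * B + (wl + V) * (- A) + (p B - p A) / 6 - (Int w A B - V * (A + B)) by ring.
  apply: (le_trans (ler_normB _ _)); apply: lerD => //.
  apply: (le_trans (ler_normD _ _)).
  have h1 : `|(p B - p A) / 6| <= `|p A| + `|p B|.
    rewrite normrM (ger0_norm (x := 6^-1)) ?invr_ge0//.
    have := ler_normB (p B) (p A); have := normr_ge0 (p A); have := normr_ge0 (p B).
    by clear; lra.
  have h2 : `|(wr - V) * B + (wl + V) * - A| <= e * (B - A).
    apply: (le_trans (ler_normD _ _)).
    rewrite !normrM (ger0_norm B0) (ger0_norm (x := - A)) ?oppr_ge0// mulrDr.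
    apply: lerD; apply: ler_wpM2r; rewrite ?oppr_ge0//.
      have := normr_ge0 (wl + V); have := normr_ge0 (p A); have := normr_ge0 (p B).
      by rewrite /e; clear; lra.
    have := normr_ge0 (wr - V); have := normr_ge0 (p A); have := normr_ge0 (p B).
    by rewrite /e; clear; lra.
  by clear -h1 h2; lra.
have At : A + 1 <= t - L.
  by move: tT; rewrite ler_norml => /andP[h _]; clear -h TA; lra.
have tB : t + L <= B - 1.
  by move: tT; rewrite ler_norml => /andP[_ h]; clear -h TB; lra.
pose W := comp_w A B L (w A) (w B) (p A) (p B) t.
pose Q := comp_p A B L (w A) (w B) (p A) (p B) t.
pose H := comp_g A B L (w A) (w B) (p A) (p B) t.
have rW : h2rep W Q H by exact: comp_h2rep.
have [WA QA WB QB] := comp_ends (w A) (w B) (p A) (p B) L0 At tB.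
have := mini W Q H rW WA QA WB QB.
have [cW cQ lH] := h2rep_cts rW; have [[mH lH2] _ _] := rW.
have IW : Int W A B = Int w A B.
  rewrite Int_comp_w// -/wl -/wr.
  have -> : Int w A B = wr * B - wl * A + (p B - p A) / 6 - t * M by rewrite tM; ring.
  by rewrite /M; ring.
have IH := Int_comp_g2 (w A) (w B) (p A) (p B) L0 At tB; rewrite -/wl -/wr -/M in IH.
have IQ := Int_comp_well (w A) (w B) (p A) (p B) L0 At tB cPsi Psi0 mPsi.
rewrite -/wl -/wr -/M in IQ.
have lPp := continuous_locint (cts_comp cp cPsi).
have lPQ := continuous_locint (cts_comp cQ cPsi).
have cPhi : continuous (fun y => c0 + Fb y) by apply: ctsD => //; exact: cts_cst.
have cfw : continuous (fun y => (w y - (c0 + Fb y)) ^+ 2) by apply: ctsX; exact: ctsB.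
have cfW : continuous (fun y => (W y - (c0 + Fb y)) ^+ 2) by apply: ctsX; exact: ctsB.
have lfw := locintZ b (continuous_locint cfw); have lfW := locintZ b (continuous_locint cfW).
have l1 := locintD lg2 lPp; have l2 := locintD lH2 lPQ.
rewrite (IntD _ _ l1 lfw) (IntD _ _ l2 lfW) => mn.
have IHQ : Int (fun y => H y ^+ 2 + Psi (Q y)) A B <=
    p A ^+ 2 + p B ^+ 2 + 3 / 2 * (M ^+ 2 / L ^+ 3) +
    (Psi (p A) + Psi (p B) + 2 * L * Psi (3 * M / (4 * L))).
  by rewrite (IntD _ _ lH2 lPQ) IH lerD2l.
have Wstep y : A <= y <= B -> `|W y - step V y| <= e + (if `|y| <= T + L then 2 * `|V| else 0).
  move=> yAB; apply: (@comp_w_step R A B L (w A) (w B) (p A) (p B) t L0 At V (T + L) y yAB).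
  by rewrite lerD2r.
have Wb y : A <= y <= B -> `|W y| <= 3 * `|V| + e.
  move=> /Wstep h; have := ler_normD (W y - step V y) (step V y).
  have : `|step V y| <= `|V| by rewrite /step /paste; case: ifP; rewrite ?normrN.
  have : (if `|y| <= T + L then 2 * `|V| else 0) <= 2 * `|V|.
    by case: ifP => // _; rewrite mulr_ge0.
  by rewrite subrK; move: h; clear; lra.
have IWS : Int (fun y => `|W y - step V y|) A B <= e * (B - A) + 4 * `|V| * (T + L + 1).
  have lWS : locint (fun y => `|W y - step V y|).
    by apply: locint_norm; apply: locintB => //; exact: continuous_locint.
  have le : locint (fun _ : R => e) by exact/continuous_locint/cts_cst.
  have := @Int_window (T + L) (2 * `|V|) A B.
  have TL : 0 <= T + L by rewrite addr_ge0// ltW.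
  have TA' : A <= - (T + L + 1) by rewrite lerNr.
  move=> /(_ TL TA' TB) /(_ ltac:(by rewrite mulr_ge0)) /(_ _ (locintB lWS le)).
  rewrite IntB// Int_cst// => h; rewrite -lerBlDl.
  have -> : 4 * `|V| * (T + L + 1) = 2 * (2 * `|V|) * (T + L + 1) by ring.
  by apply: h => y yAB; rewrite lerBlDl; exact: Wstep.
have IWw : Int (fun y => `|W y - w y|) A B <= e * (B - A) + 4 * `|V| * (T + L + 1) + N.
  have lWS : locint (fun y => `|W y - step V y|).
    by apply: locint_norm; apply: locintB => //; exact: continuous_locint.
  have lwS' := locint_norm lwS.
  apply: (@le_trans _ _ (Int (fun y => `|W y - step V y| + `|w y - step V y|) A B)).
    apply: le_Int => //; [exact/continuous_locint/cts_norm/ctsB|exact: locintD|].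
    move=> y _; have -> : W y - w y = (W y - step V y) - (w y - step V y) by ring.
    exact: ler_normB.
  by rewrite IntD//; apply: lerD.
have cWw : continuous (fun y => W y - w y) by exact: ctsB.
have fid : Int (fun y => b * (W y - (c0 + Fb y)) ^+ 2) A B
    - Int (fun y => b * (w y - (c0 + Fb y)) ^+ 2) A B <=
    2 * b * ((3 * `|V| + e + C) * (N + e * (B - A) + 4 * `|V| * (T + L + 1))).
  have lWw := continuous_locint cWw.
  have lprod : locint (fun y => (3 * `|V| + e + C) * `|W y - w y|).
    by apply: locintZ; exact: locint_norm.
  have lrhs : locint (fun y => (2 * b) * ((3 * `|V| + e + C) * `|W y - w y|) -
      (2 * b * c0) * (W y - w y)).
    by apply: locintB; exact: locintZ.
  rewrite -IntB//.
  apply: (@le_trans _ _ (Int (fun y => (2 * b) * ((3 * `|V| + e + C) * `|W y - w y|) -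
      (2 * b * c0) * (W y - w y)) A B)).
    apply: le_Int => //; first exact: locintB.
    move=> y yAB; rewrite -subr_ge0.
    have -> : 2 * b * ((3 * `|V| + e + C) * `|W y - w y|) - 2 * b * c0 * (W y - w y) -
       (b * (W y - (c0 + Fb y)) ^+ 2 - b * (w y - (c0 + Fb y)) ^+ 2) =
       2 * b * ((3 * `|V| + e + C) * `|W y - w y| - (W y - Fb y) * (W y - w y))
       + b * (W y - w y) ^+ 2 by ring.
    apply: addr_ge0; last by rewrite mulr_ge0// sqr_ge0.
    rewrite mulr_ge0 ?mulr_ge0// subr_ge0; apply: (le_trans (ler_norm _)).
    rewrite normrM ler_wpM2r//; apply: (le_trans (ler_normB _ _)).
    by apply: lerD; [exact: Wb|exact: FC].
  rewrite IntB//; [|exact: locintZ|exact: locintZ].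
  rewrite !IntZ//; last exact: locint_norm.
  rewrite (IntB _ _ (continuous_locint cW) lw) IW subrr mulr0 subr0.
  rewrite ler_wpM2l ?mulr_ge0// ler_wpM2l ?addr_ge0 ?mulr_ge0//.
  by move: IWw; clear; lra.
by move: mn IHQ fid; clear; lra.
Qed.

End EnergyUpperBound.

(** * Consequences of a bound on the variation *)
Section VariationBound.
Context {R : realType}.
Local Notation mu := (@lebesgue_measure R).
Implicit Types (p P V v f g k z : R -> R) (a b c d x y T : R).

Lemma average_near z y d : 0 < d -> continuous z ->
  \forall h \near (0 : R)^'+, `|Int z y (y + h) / h - z y| <= d.
Proof.
move=> d0 cz; have lz := continuous_locint cz.
have /cvgrPdist_le /(_ d d0) [r r0 Hr] := cz y.
exists r => // h /=; rewrite sub0r normrN => hr h0; rewrite gtr0_norm// in hr.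
have yh : y <= y + h by rewrite lerDl ltW.
have lc a : locint (fun _ : R => a) by exact/continuous_locint/cts_cst.
have -> : Int z y (y + h) / h - z y = Int (fun t => z t - z y) y (y + h) / h.
  by rewrite IntB// Int_cst//; field; rewrite gt_eqF.
rewrite normrM (ger0_norm (x := h^-1)) ?invr_ge0 ?(ltW h0)// ler_pdivrMr//.
have lzy : locint (fun t => z t - z y) by exact: locintB.
apply: (le_trans (normr_Int _ _ lzy)).
have -> : d * h = Int (fun=> d) y (y + h) by rewrite Int_cst//; ring.
apply: le_Int; [exact: locint_norm|exact: lc|] => t /andP[yt th].
by rewrite distrC; apply: Hr; rewrite /ball_/= distrC ger0_norm ?subr_ge0//; lra.
Qed.

Definition trapezoid a a' b' b y : R :=
  Num.max 0 (Num.min 1 (Num.min ((y - a) / (a' - a)) ((b - y) / (b - b')))).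

Lemma trapezoid_bounds a a' b' b y : 0 <= trapezoid a a' b' b y <= 1.
Proof. by rewrite /trapezoid le_max lexx/= ge_max ler01/= ge_min lexx. Qed.

Lemma cts_min f g : continuous f -> continuous g -> continuous (fun y => Num.min (f y) (g y)).
Proof. by move=> cf cg y; exact: (continuous_min (cf y) (cg y)). Qed.

Lemma cts_max f g : continuous f -> continuous g -> continuous (fun y => Num.max (f y) (g y)).
Proof. by move=> cf cg y; exact: (continuous_max (cf y) (cg y)). Qed.

Lemma trapezoid_cts a a' b' b : continuous (trapezoid a a' b' b).
Proof.
have lin c d : continuous (fun y : R => (y - c) / d).
  by apply: ctsM; [apply: ctsB; [exact: cts_id|exact: cts_cst]|exact: cts_cst].
have lin' c d : continuous (fun y : R => (c - y) / d).
  by apply: ctsM; [apply: ctsB; [exact: cts_cst|exact: cts_id]|exact: cts_cst].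
apply: cts_max; first exact: cts_cst.
apply: cts_min; first exact: cts_cst.
by apply: cts_min; [exact: lin|exact: lin'].
Qed.

Lemma trapezoid1 a a' b' b y : a < a' -> b' < b -> a' <= y -> y <= b' -> trapezoid a a' b' b y = 1.
Proof.
move=> aa bb ay yb; rewrite /trapezoid.
have h1 : 1 <= (y - a) / (a' - a) by rewrite ler_pdivlMr ?subr_gt0// mul1r lerD2r.
have h2 : 1 <= (b - y) / (b - b') by rewrite ler_pdivlMr ?subr_gt0// mul1r lerD2l lerN2.
by rewrite (min_l (x := 1)) ?max_r// le_min h1 h2.
Qed.

Lemma trapezoid0 a a' b' b y : a < a' -> b' < b -> y <= a \/ b <= y -> trapezoid a a' b' b y = 0.
Proof.
move=> aa bb H; rewrite /trapezoid; apply: max_l; rewrite !ge_min; apply/orP; right.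
case: H => H; apply/orP; [left|right]; rewrite pmulr_lle0 ?invr_gt0 ?subr_gt0//; lra.
Qed.

(** The supremum in the variation is nearly attained by the sign of -P, cut off
near the endpoints and regularized: z = - chi P/(1 + |P|) is continuous with
|P| - 1 <= - P z where chi = 1.  Moving averages of z are C^1 test functions
bounded by 1 and converge to z pointwise. *)
Lemma BV_variation_Int a b a' b' V P v T : a < a' -> a' <= b' -> b' < b ->
  continuous P -> primitive P V -> (forall y, a < y < b -> v y = V y) ->
  (BV_variation a b v <= T%:E)%E ->
  Int (fun y => `|P y|) a' b' <= T + (b' - a').
Proof.
move=> aa ab bb cP PV vV BV; have alb : a < b by lra.
have [cV lP] : continuous V /\ locint P.
  by split; [exact: primitive_continuous PV|exact: continuous_locint].
pose a1 := (a + a') / 2; pose b1 := (b' + b) / 2.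
have a1a' : a1 < a' by rewrite /a1; lra.
have b'b1 : b' < b1 by rewrite /b1; lra.
have aa1 : a < a1 by rewrite /a1; lra.
have b1b : b1 < b by rewrite /b1; lra.
pose chi := trapezoid a1 a' b' b1.
have den t : 1 + `|P t| != 0 by rewrite gt_eqF// ltr_pwDl.
pose z t := - (chi t * (P t * (1 + `|P t|)^-1)).
have cz : continuous z.
  apply: ctsN; apply: ctsM; first exact: trapezoid_cts.
  apply: ctsM => //; apply: ctsV => //; apply: ctsD; first exact: cts_cst.
  exact: cts_norm.
have z1 t : `|z t| <= 1.
  have /andP[c0 c1] := trapezoid_bounds a1 a' b' b1 t.
  rewrite normrN normrM (ger0_norm c0) -[leRHS]mulr1; apply: ler_pM => //.
  rewrite normrM normfV (ger0_norm (x := 1 + `|P t|)) ?addr_ge0//.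
  by rewrite ler_pdivrMr ?ltr_pwDl// mul1r lerDr.
have zsupp t : t <= a1 \/ b1 <= t -> z t = 0.
  by move=> H; rewrite /z /chi trapezoid0// mul0r oppr0.
have lz := continuous_locint cz.
have [Z zZ] := exists_primitive lz.
have cZ := primitive_continuous zZ.
pose h0 := (a1 - a) / 2; have h00 : 0 < h0 by rewrite /h0; lra.
(* The support of the average over [y, y + h] stays in [a1 - h0, b1] inside (a, b). *)
have avg (h : R) : 0 < h -> h <= h0 -> [/\ forall y, h^-1 * (Z (y + h) - Z y) = Int z y (y + h) / h,
    forall y, `|h^-1 * (Z (y + h) - Z y)| <= 1, continuous (fun y => h^-1 * (Z (y + h) - Z y)) &
    - T <= Int (fun y => P y * (h^-1 * (Z (y + h) - Z y))) a b].
  move=> hh hh0; pose phi y := h^-1 * (Z (y + h) - Z y).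
  have phiE y : phi y = Int z y (y + h) / h.
    by rewrite /phi (primitiveE zZ (x := y)) ?lerDl ?(ltW hh)//; ring.
  have dphi (t : R) : is_derive t 1 phi (h^-1 * (z (t + h) - z t)).
    apply: drZ; apply: drB; last exact: primitive_is_derive.
    have D : is_derive t 1 (fun y : R => y + h) 1.
      by apply: (dr_eq (drD (dr_id t) (dr_cst h t))); rewrite addr0.
    apply: (dr_eq (is_derive1_comp (f := Z) (g := fun y => y + h)
       (primitive_is_derive (t + h) cz zZ) D)).
    by rewrite mulr1.
  have phi1 y : `|phi y| <= 1.
    rewrite phiE normrM (ger0_norm (x := h^-1)) ?invr_ge0 ?(ltW hh)// ler_pdivrMr// mul1r.
    have yh : y <= y + h by rewrite lerDl ltW.
    apply: (le_trans (normr_Int _ _ lz)).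
    apply: (@le_trans _ _ (Int (fun=> 1) y (y + h))).
      by apply: le_Int => //; [exact: locint_norm|exact/continuous_locint/cts_cst].
    by rewrite Int_cst//; lra.
  have zero s t : s <= t -> t <= a1 \/ b1 <= s -> Int z s t = 0.
    move=> st H; rewrite (eq_Int (g := fun=> 0)) ?Int_cst ?mul0r// => r /andP[sr rt].
    by apply: zsupp; case: H => H; [left|right]; lra.
  have tphi : test_function a b phi.
    apply: (@test_functionI R a b (a1 - h0) b1 phi _ _ b1b dphi).
    - by rewrite /h0; lra.
    - apply: ctsM; first exact: cts_cst.
      apply: ctsB => //; apply: (cts_comp _ cz); apply: ctsD; [exact: cts_id|exact: cts_cst].
    - move=> t; apply: contraNT; rewrite negb_and -!ltNge phiE => H.
      rewrite zero ?mul0r// ?lerDl ?(ltW hh)//.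
      by move: H => /orP[H|H]; [left|right]; lra.
  have cphi := test_cts tphi.
  have sup : ((\int[mu]_(x in `]a, b[) (v x * derive1 phi x))%:E <= BV_variation a b v)%E.
    by apply: ereal_sup_ubound; exists phi.
  have := le_trans sup BV; rewrite lee_fin.
  have -> : \int[mu]_(x in `]a, b[) (v x * derive1 phi x) =
      \int[mu]_(x in `]a, b[) (V x * derive1 phi x).
    by apply: eq_Rintegral => x; rewrite inE/= in_itv/= => /vV ->.
  have [_ _ ->//] := primitive_weak_derivative alb PV.
  move=> H.
  split => //; rewrite lerNl; apply: le_trans H; rewrite lerN2.
  by rewrite -Int_oo//; apply: continuous_measurable_fun; exact: ctsM.
pose hn (n : nat) := h0 / n.+1%:R.
have hn0 n : 0 < hn n by rewrite divr_gt0.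
have hnle n : hn n <= h0 by rewrite ler_pdivrMr// ler_peMr ?(ltW h00)// ler1n.
have hncvg : hn n @[n --> \oo] --> (0 : R).
  rewrite -[X in _ --> X](mulr0 h0); apply: cvgM; first exact: cvg_cst.
  exact: cvg_harmonic.
have hnright : hn n @[n --> \oo] --> (0 : R)^'+.
  move=> A [r r0 Hr]; have /cvgrPdist_lt /(_ r r0) := hncvg.
  by apply: filterS => n hr; exact: Hr.
have cPz : continuous (fun y => P y * z y) by exact: ctsM.
have limT : - T <= Int (fun y => P y * z y) a b.
  pose fn n y := P y * ((hn n)^-1 * (Z (y + hn n) - Z y)).
  have cfn n : continuous (fn n).
    by have [_ _ c _] := avg _ (hn0 n) (hnle n); apply: ctsM.
  have [|||||_ _] := @dominated_convergence _ _ R mu `[a, b] (measurable_itv _)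
    (fun n y => (fn n y)%:E) (fun y => (P y * z y)%:E) (fun y => `|P y|%:E).
  - move=> n; apply/measurable_EFinP; apply: (@measurable_funS _ _ _ _ setT) => //.
    exact: continuous_measurable_fun.
  - apply/measurable_EFinP; apply: (@measurable_funS _ _ _ _ setT) => //.
    exact: continuous_measurable_fun.
  - apply: aeW => y _; apply: cvg_EFin; first exact: nearW.
    apply: cvgM; first exact: cvg_cst.
    apply/cvgrPdist_le => e e0.
    have H2 := hnright _ (average_near y e0 cz).
    near=> n; have [E _ _ _] := avg _ (hn0 n) (hnle n).
    by rewrite E distrC; near: n.
  - exact: (locint_norm lP a b).
  - apply: aeW => y n _; rewrite /= lee_fin normrM ler_piMr//.
    by have [_ + _ _] := avg _ (hn0 n) (hnle n); apply.
  move=> cv.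
  have E : (\int[mu]_(y in `[a, b]) (P y * z y)%:E = (Int (fun y => P y * z y) a b)%:E)%E.
    rewrite /Int /Rintegral fineK//.
    by apply: integrable_fin_num => //; exact: (continuous_locint cPz).
  rewrite E in cv; have {}cv := fine_cvg cv.
  rewrite leNgt; apply/negP => lt.
  have H2 := cvgr_lt _ (cv _) _ lt.
  have : \forall n \near \oo, False; last by move=> /filter_ex[].
  near=> n; have [_ _ _] := avg _ (hn0 n) (hnle n); apply/negP; rewrite -ltNge.
  near: n; exact: H2.
have lPz := continuous_locint cPz.
have : Int (fun y => `|P y| - 1) a' b' <= T.
  apply: (@le_trans _ _ (Int (fun y => - (P y * z y)) a b)); last by rewrite IntN// lerNl.
  have sgn y : 0 <= - (P y * z y).
    rewrite /z mulrN opprK mulrCA mulr_ge0//.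
      by have /andP[] := trapezoid_bounds a1 a' b' b1 y.
    by rewrite mulrA mulr_ge0 ?invr_ge0 ?addr_ge0// -expr2 sqr_ge0.
  apply: (@le_trans _ _ (Int (fun y => - (P y * z y)) a' b')); last first.
    by apply: Int_sub; [exact: locintN|move=> *; exact: sgn|lra|lra|lra].
  apply: le_Int; [|exact: locintN|].
    by apply: locintB; [exact: locint_norm|exact/continuous_locint/cts_cst].
  move=> y /andP[ay yb]; rewrite /z /chi trapezoid1// mul1r mulrN opprK mulrA.
  have P0 := normr_ge0 (P y).
  rewrite ler_pdivlMr ?ltr_pwDl// -expr2 -(real_normK (num_real (P y))).
  have -> : (`|P y| - 1) * (1 + `|P y|) = `|P y| ^+ 2 - 1 by ring.
  by rewrite gerBl.
rewrite IntB; [|exact: locint_norm|exact/continuous_locint/cts_cst].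
by rewrite Int_cst//; lra.
Unshelve. all: by end_near. Qed.

(** Chebyshev: each of the two conditions fails on at most a quarter of the
interval. *)
Lemma good_point c d eta T K k P : c < d -> continuous k -> continuous P -> 0 < eta -> 0 < K ->
  4 * eta <= d - c -> 4 * T <= (d - c) * K ->
  Int (fun y => `|k y|) c d <= eta ^+ 2 -> Int (fun y => `|P y|) c d <= T ->
  exists2 y, c <= y <= d & `|k y| <= eta /\ `|P y| <= K.
Proof.
move=> cd ck cP eta0 K0 he hT Ik IP; apply: contrapT => H.
have lk := continuous_locint (cts_norm ck); have lp := continuous_locint (cts_norm cP).
have : Int (fun=> 1) c d <= Int (fun y => eta^-1 * `|k y| + K^-1 * `|P y|) c d.
  apply: le_Int; [exact/continuous_locint/cts_cst|by apply: locintD; exact: locintZ|].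
  move=> y ycd; case: (leP `|k y| eta) => ke; last first.
    apply: (@le_trans _ _ (eta^-1 * `|k y|)).
      by rewrite mulrC ler_pdivlMr// mul1r ltW.
    by rewrite lerDl mulr_ge0// invr_ge0 ltW.
  case: (leP `|P y| K) => pK; first by exfalso; apply: H; exists y.
  apply: (@le_trans _ _ (K^-1 * `|P y|)).
    by rewrite mulrC ler_pdivlMr// mul1r ltW.
  by rewrite lerDr mulr_ge0// invr_ge0 ltW.
rewrite IntD; [|exact: locintZ|exact: locintZ].
rewrite !IntZ// Int_cst ?(ltW cd)// mul1r.
have h1 : eta^-1 * Int (fun y => `|k y|) c d <= eta.
  by rewrite mulrC ler_pdivrMr// -expr2.
have h2 : K^-1 * Int (fun y => `|P y|) c d <= (d - c) / 4.
  rewrite mulrC ler_pdivrMr//; apply: (le_trans IP).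
  by rewrite mulrAC ler_pdivlMr// mulrC.
by lra.
Qed.

End VariationBound.

(** * The logarithmic well *)
Section LogarithmicWell.
Context {R : realType}.
Implicit Types (e t s x M r : R).

Lemma abs_lnE e : 0 < e < 1 -> `|ln e| = - ln e.
Proof. by move=> e01; rewrite ltr0_norm// ln_lt0. Qed.

Lemma expR_abs_ln e : 0 < e < 1 -> expR `|ln e| = e^-1.
Proof. by move=> e01; have /andP[e0 _] := e01; rewrite abs_lnE// expRN lnK. Qed.

Lemma near_unit : \forall e \near (0 : R)^'+, 0 < e < 1.
Proof.
near=> e; apply/andP; split; first by near: e; exact: nbhs_right_gt.
by near: e; exact: nbhs_right_lt.
Unshelve. all: by end_near. Qed.

Lemma abs_ln_large M : \forall e \near (0 : R)^'+, M <= `|ln e|.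
Proof.
near=> e; have e01 : 0 < e < 1 by near: e; exact: near_unit.
have /andP[e0 _] := e01.
rewrite -ler_expR expR_abs_ln// -[leLHS]invrK lef_pV2 ?posrE ?invr_gt0 ?expR_gt0//.
by near: e; apply: nbhs_right_le; rewrite invr_gt0 expR_gt0.
Unshelve. all: by end_near. Qed.

Lemma sqrt_abs_ln_large M : \forall e \near (0 : R)^'+, M <= Num.sqrt `|ln e|.
Proof.
near=> e; apply: (le_trans (ler_norm M)); rewrite -sqrtr_sqr ler_wsqrtr//.
by near: e; exact: abs_ln_large.
Unshelve. all: by end_near. Qed.

Lemma cube_abs_ln e : 0 < e < 1 -> e * `|ln e| ^+ 3 <= 6.
Proof.
move=> e01; have /andP[e0 _] := e01.
have := @expR_ge1Dxn R _ 2 (normr_ge0 (ln e)); rewrite expR_abs_ln// => h.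
have : `|ln e| ^+ 3 / 6 <= e^-1.
  by apply: le_trans h; rewrite lerDr.
rewrite ler_pdivrMr// => h3.
have -> : 6 = e * (e^-1 * 6) by field; rewrite gt_eqF.
by rewrite ler_pM2l.
Qed.

Lemma omega_sqr_le e : 0 < e < 1 -> omega e ^+ 2 <= e.
Proof.
move=> e01; have /andP[e0 _] := e01; rewrite omega_sqr.
have h : `|ln e| <= e^-1.
  by rewrite -expR_abs_ln// (le_trans _ (expR_ge1Dx _))// lerDr.
rewrite expr2 -mulrA -[leRHS]mulr1 ler_pM2l// mulrC -ler_pdivlMr// mul1r//.
Qed.

Lemma omega_small d : 0 < d -> \forall e \near (0 : R)^'+, omega e <= d.
Proof.
move=> d0; near=> e; have e01 : 0 < e < 1 by near: e; exact: near_unit.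
have : omega e ^+ 2 <= d ^+ 2.
  apply: (le_trans (omega_sqr_le e01)); near: e; apply: nbhs_right_le.
  exact: exprn_gt0.
by rewrite ler_pXn2r// nnegrE ltW// omega_gt0.
Unshelve. all: by end_near. Qed.

Section well.
Variable e : R.
Hypothesis e01 : 0 < e < 1.
Let e0 : 0 < e. Proof. by case/andP: e01. Qed.
Let l0 : 0 < `|ln e|. Proof. exact: abs_ln_gt0. Qed.

Lemma psi_arg t : 0 < 1 + t ^+ 2 / e ^+ 4.
Proof. by rewrite ltr_pwDl// divr_ge0 ?sqr_ge0// exprn_ge0// ltW. Qed.

Lemma psi0 : psi e 0 = 0.
Proof. by rewrite /psi expr0n/= mul0r addr0 ln1 mul0r. Qed.

Lemma psi_mono s t : `|s| <= `|t| -> psi e s <= psi e t.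
Proof.
move=> st; rewrite ler_pM2r ?invr_gt0// ler_ln ?posrE ?psi_arg// lerD2l.
rewrite ler_pM2r ?invr_gt0 ?exprn_gt0//.
by rewrite -(real_normK (num_real s)) -(real_normK (num_real t)) ler_pXn2r.
Qed.

Lemma psi_norm t : psi e `|t| = psi e t.
Proof. by rewrite /psi real_normK// num_real. Qed.

Lemma psi_ge0 t : 0 <= psi e t.
Proof. by rewrite -psi0; apply: psi_mono; rewrite normr0. Qed.

Lemma psi_cts : continuous (psi e).
Proof.
have -> : psi e = fun t => ln (1 + (t * (e ^+ 2)^-1) ^+ 2) * `|ln e|^-1.
  by apply/funext => t; rewrite /psi; congr (ln (1 + _) / _); field; rewrite gt_eqF.
apply: ctsM; last exact: cts_cst.
apply: (cts_comp _ cts_ln1sqr); apply: ctsM; [exact: cts_id|exact: cts_cst].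
Qed.

Lemma psi_le t : psi e t <= 4 + t ^+ 2 / `|ln e|.
Proof.
rewrite /psi ler_pdivrMr// mulrDl divfK ?gt_eqF//.
have e40 : 0 < e ^+ 4 by exact: exprn_gt0.
have t0 : 0 < 1 + t ^+ 2 by rewrite ltr_pwDl// sqr_ge0.
have h : 1 + t ^+ 2 / e ^+ 4 <= (1 + t ^+ 2) / e ^+ 4.
  rewrite mulrDl mul1r lerD2r; case/andP: e01 => _ e1.
  by rewrite -[leLHS]invr1 lef_pV2 ?posrE// exprn_ile1// ltW.
apply: (@le_trans _ _ (ln ((1 + t ^+ 2) / e ^+ 4))).
  by rewrite ler_ln ?posrE ?psi_arg// divr_gt0.
rewrite ln_div ?posrE// lnXn// abs_lnE//.
have : ln (1 + t ^+ 2) <= t ^+ 2.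
  by apply: le_ln1Dx; apply: (@lt_le_trans _ _ 0) => //; rewrite ?sqr_ge0// ltrN10.
by rewrite -mulr_natl; lra.
Qed.

Lemma psi_small K : psi e (e ^+ 2 * K) <= K ^+ 2 / `|ln e|.
Proof.
rewrite /psi ler_pM2r ?invr_gt0//.
have -> : (e ^+ 2 * K) ^+ 2 / e ^+ 4 = K ^+ 2 by field; rewrite gt_eqF.
by apply: le_ln1Dx; apply: (@lt_le_trans _ _ 0) => //; rewrite ?sqr_ge0// ltrN10.
Qed.

Let r := Num.sqrt `|ln e|.
Hypothesis r6 : 6 <= r.
Let r0 : 0 < r. Proof. by rewrite sqrtr_gt0. Qed.
Let lE : `|ln e| = r ^+ 2. Proof. by rewrite sqr_sqrtr. Qed.

(** With r = sqrt |ln e| and threshold r^-6, a power of a logarithm is negligible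
against the powers of e, so the well is already nearly 4 beyond the
threshold. *)
Lemma psi_large t : r ^- 6 <= `|t| -> 4 <= (1 + 6 / r) * psi e t.
Proof.
move=> rt.
have h1 : 4 - 12 / r <= psi e t.
  apply: (@le_trans _ _ (psi e (r ^- 6))); last first.
    by apply: psi_mono; rewrite (ger0_norm (x := r ^- 6))// invr_ge0 exprn_ge0// ltW.
  rewrite /psi ler_pdivlMr//.
  have rr : 0 < r ^- 12 / e ^+ 4 by rewrite divr_gt0 ?invr_gt0 ?exprn_gt0.
  apply: (@le_trans _ _ (ln (r ^- 12 / e ^+ 4))); last first.
    rewrite ler_ln ?posrE ?psi_arg//.
    by rewrite (_ : (r ^- 6) ^+ 2 = r ^- 12) ?lerDr// -exprVn -exprM exprVn.
  rewrite ln_div ?posrE ?invr_gt0 ?exprn_gt0// lnV ?posrE ?exprn_gt0// !lnXn//.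
  have lr : ln r <= r by rewrite ltW// ln_sublinear.
  have -> : (4 - 12 / r) * `|ln e| = 4 * `|ln e| - 12 * r.
    by rewrite lE; field; rewrite gt_eqF.
  by move: lr; rewrite abs_lnE// -(mulr_natl _ 12) -(mulr_natl _ 4); move: (ln r) (ln e) r => x y z; lra.
have h2 : 0 <= 1 + 6 / r by rewrite addr_ge0// divr_ge0// ltW.
have : (1 + 6 / r) * (4 - 12 / r) <= (1 + 6 / r) * psi e t by rewrite ler_wpM2l.
apply: le_trans.
have -> : (1 + 6 / r) * (4 - 12 / r) = 4 + 12 * ((r - 6) / r ^+ 2).
  by field; rewrite gt_eqF.
by rewrite lerDl mulr_ge0// divr_ge0 ?sqr_ge0// subr_ge0.
Qed.

(** Slopes below e^2/r are accounted for by the first term in the bracket.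
Between e^2/r and the threshold r^-6 the well is at least 1/(2 r^4), so that a
small multiple of it dominates the slope.  Integrated over an interval of
length of order e^-2, the bracket is of order 1/r. *)
Lemma small_slopes_mass (p : R -> R) y :
  p y <= excess p (r ^- 6) y + (e ^+ 2 / r + 2 / `|ln e| * psi e (p y)).
Proof.
have ex0 : 0 <= excess p (r ^- 6) y by rewrite /excess le_max lexx orbT.
have q0 : 0 <= 2 / `|ln e| * psi e (p y) by rewrite mulr_ge0 ?psi_ge0// divr_ge0.
case: (leP (p y) (e ^+ 2 / r)) => [h|h].
  by apply: (le_trans h); lra.
have er0 : 0 < e ^+ 2 / r by rewrite divr_gt0// exprn_gt0.
have lo : 2^-1 / r ^+ 4 <= psi e (p y).
  apply: (@le_trans _ _ (psi e (e ^+ 2 / r))); last first.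
    by apply: psi_mono; rewrite !gtr0_norm ?(lt_trans er0 h)// ltW.
  rewrite /psi ler_pdivlMr// lE.
  have -> : (e ^+ 2 / r) ^+ 2 / e ^+ 4 = r ^- 2 by field; rewrite !gt_eqF.
  have -> : 2^-1 / r ^+ 4 * r ^+ 2 = 2^-1 / r ^+ 2 by field; rewrite gt_eqF.
  have r20 : 0 < r ^+ 2 by exact: exprn_gt0.
  have x0 : 0 < 1 + r ^- 2 by rewrite ltr_pwDl// invr_ge0 ltW.
  have : ln ((1 + r ^- 2)^-1) <= (1 + r ^- 2)^-1 - 1.
    have := @le_ln1Dx R ((1 + r ^- 2)^-1 - 1); rewrite addrCA subrr addr0; apply.
    by rewrite ltrBrDl subrr invr_gt0.
  rewrite lnV ?posrE// => hl.
  have : 2^-1 / r ^+ 2 <= 1 - (1 + r ^- 2)^-1.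
    have -> : 1 - (1 + r ^- 2)^-1 = (r ^+ 2 + 1)^-1.
      field; rewrite (gt_eqF r0)/= gt_eqF ?andbT// addr_gt0//.
    rewrite -invfM lef_pV2 ?posrE ?mulr_gt0 ?addr_gt0//.
    have : 36 <= r ^+ 2 by rewrite (_ : 36 = 6 ^+ 2) ?ler_pXn2r ?nnegrE ?(ltW r0)// -natrX.
    by move=> ?; lra.
  by move=> ?; lra.
have tau_le : r ^- 6 <= 2 / `|ln e| * psi e (p y).
  rewrite lE; have -> : r ^- 6 = 2 / r ^+ 2 * (2^-1 / r ^+ 4) by field; rewrite gt_eqF.
  by rewrite ler_wpM2l// divr_ge0// exprn_ge0// ltW.
have : p y - r ^- 6 <= excess p (r ^- 6) y by rewrite /excess le_max lexx.
by move=> ?; lra.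
Qed.

End well.
End LogarithmicWell.

(** * Upper bound for the energy of a transition *)
Section EnergyBound.
Context {R : realType}.

(** Bookkeeping for [energy_upper_bound] with the width Lam: the cubic costs
3/2 (2V)^2/Lam^3 = 8 Lam/3 and the well 8 Lam, and every other term is of order
mu. *)
Lemma transition_energy_le (Lam V H beta C K0 : R) :
  0 < Lam -> V != 0 -> Lam ^+ 2 = 3 / 2 * `|V| ->
  0 < H -> 0 <= beta -> 0 <= C -> 0 <= K0 -> exists2 c, 0 < c &
  forall (mu e A B c0 : R) (w p g Fb : R -> R), 0 < e < 1 -> 0 < mu -> mu <= 1 -> 3 * mu <= `|V| ->
  ((5 * H + 3) / `|V| + 1) * mu <= H / 4 -> `|ln e|^-1 <= mu ->
  e ^+ 2 * (Lam + 1) <= mu -> K0 * e ^+ 2 <= mu ->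
  h2rep w p g -> continuous Fb -> (forall y, A <= y <= B -> `|Fb y| <= C) ->
  e ^+ 2 * (B - A) <= H -> H / 4 <= - (e ^+ 2 * A) -> H / 4 <= e ^+ 2 * B ->
  `|w B - V| <= mu -> `|w A + V| <= mu -> `|p A| <= K0 * e ^+ 2 -> `|p B| <= K0 * e ^+ 2 ->
  e ^+ 2 * Int (fun y => `|w y - step V y|) A B <= mu ->
  (forall W Q G, h2rep W Q G -> W A = w A -> Q A = p A -> W B = w B -> Q B = p B ->
    Int (scaled_density e (beta * e ^+ 2) (fun y => c0 + Fb y) w p g) A B <=
    Int (scaled_density e (beta * e ^+ 2) (fun y => c0 + Fb y) W Q G) A B) ->
  Int (fun y => g y ^+ 2 + psi e (p y)) A B <= 32 * Lam / 3 + c * mu.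
Proof.
move=> Lam0 V0 LV H0 b0 C0 K00; have v0 : 0 < `|V| by rewrite normr_gt0.
set v := `|V| in v0 LV *.
exists (2 + 3 / 2 * ((12 * v + 9) / Lam ^+ 3) + 2 * K0 ^+ 2 + 9 * (2 * v + 3) ^+ 2 / (8 * Lam)
  + 2 * beta * ((3 * v + 5 + C) * (25 * H + 13 + 4 * v))).
  have h1 : 0 <= 3 / 2 * ((12 * v + 9) / Lam ^+ 3).
    by rewrite mulr_ge0// divr_ge0// ?exprn_ge0 ?(ltW Lam0)// addr_ge0// mulr_ge0// ltW.
  have h2 : 0 <= 9 * (2 * v + 3) ^+ 2 / (8 * Lam).
    by rewrite divr_ge0// mulr_ge0// ?sqr_ge0// ltW.
  have h3 : 0 <= 2 * beta * ((3 * v + 5 + C) * (25 * H + 13 + 4 * v)).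
    by rewrite mulr_ge0// mulr_ge0//; lra.
  by have := sqr_ge0 K0; lra.
move=> mu e A B c0 w p g Fb e01 mu0 mu1 muV muH lmu eL Ke r cF FC BA HA HB wB wA pA pB wS mini.
have e20 : 0 < e ^+ 2 by rewrite exprn_gt0//; case/andP: e01.
have A0 : A <= 0 by rewrite -(pmulr_rle0 _ e20); lra.
have B0 : 0 <= B by rewrite -(pmulr_rge0 _ e20); lra.
have cP := psi_cts (e := e) e01.
have mP x y : `|x| <= `|y| -> psi e x <= psi e y by exact: psi_mono.
have := @energy_upper_bound R Lam V (beta * e ^+ 2) C c0 A B w p g Fb (psi e)
  Lam0 (mulr_ge0 b0 (ltW e20)) C0 A0 B0 r cF FC cP (psi0 e) mP mini.
pose wl := w A + p A / 2; pose wr := w B - p B / 2; pose M := wr - wl.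
pose E := `|wl + V| + `|wr - V| + `|p A| + `|p B|.
pose N := Int (fun y => `|w y - step V y|) A B.
pose T := (E * (B - A) + `|p A| + `|p B| + N) / `|M|.
rewrite -/wl -/wr -/M -/E -/N -/T -/v => bound.
have pAm : `|p A| <= mu by exact: le_trans Ke.
have pBm : `|p B| <= mu by exact: le_trans Ke.
have hl : `|wl + V| <= 3 / 2 * mu.
  have -> : wl + V = (w A + V) + p A / 2 by rewrite /wl; ring.
  apply: (le_trans (ler_normD _ _)); rewrite normrM (ger0_norm (x := 2^-1))//.
  by move: wA pAm; clear => *; lra.
have hr : `|wr - V| <= 3 / 2 * mu.
  have -> : wr - V = (w B - V) - p B / 2 by rewrite /wr; ring.
  apply: (le_trans (ler_normB _ _)); rewrite normrM (ger0_norm (x := 2^-1))//.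
  by move: wB pBm; clear => *; lra.
have hE : E <= 5 * mu by rewrite /E; move: hl hr pAm pBm; clear => *; lra.
have E0 : 0 <= E by rewrite /E !addr_ge0.
have hM : `|M - 2 * V| <= 3 * mu.
  have -> : M - 2 * V = (wr - V) - (wl + V) by rewrite /M; ring.
  by apply: (le_trans (ler_normB _ _)); move: hl hr; clear => *; lra.
have V2 : `|2 * V| = 2 * v by rewrite normrM ger0_norm.
have Mlo : v <= `|M|.
  have : `|2 * V| <= `|M| + `|M - 2 * V|.
    by apply: le_trans (ler_normB _ _); rewrite opprB addrCA subrr addr0.
  by rewrite V2; move: hM muV; clear => *; lra.
have Mhi : `|M| <= 2 * v + 3 * mu.
  have -> : M = 2 * V + (M - 2 * V) by ring.
  by apply: (le_trans (ler_normD _ _)); rewrite V2 lerD2l.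
have Mpos : 0 < `|M| by exact: lt_le_trans Mlo.
have Mn0 : M != 0 by rewrite -normr_gt0.
have N0 : 0 <= N by apply: Int_ge0.
have BA0 : 0 <= B - A by rewrite subr_ge0 (le_trans A0).
have e21 : e ^+ 2 <= 1 by rewrite exprn_ile1//; case/andP: e01 => *; exact: ltW.
have eEBA : e ^+ 2 * (E * (B - A)) <= 5 * H * mu.
  have -> : e ^+ 2 * (E * (B - A)) = E * (e ^+ 2 * (B - A)) by ring.
  have -> : 5 * H * mu = (5 * mu) * H by ring.
  by apply: ler_pM => //; rewrite mulr_ge0// ltW.
have eT : e ^+ 2 * T <= (5 * H + 3) / v * mu.
  rewrite /T mulrA ler_pdivrMr//.
  have h : (5 * H + 3) * mu <= (5 * H + 3) / v * mu * `|M|.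
    have -> : (5 * H + 3) * mu = (5 * H + 3) / v * mu * v by field; rewrite gt_eqF.
    by rewrite ler_wpM2l// mulr_ge0 ?(ltW mu0)// divr_ge0 ?(ltW v0)// addr_ge0// mulr_ge0// ltW.
  apply: le_trans h.
  have h1 : e ^+ 2 * `|p A| <= mu by rewrite (le_trans _ pAm)// ler_piMl.
  have h2 : e ^+ 2 * `|p B| <= mu by rewrite (le_trans _ pBm)// ler_piMl.
  have -> : e ^+ 2 * (E * (B - A) + `|p A| + `|p B| + N) = e ^+ 2 * (E * (B - A)) +
    e ^+ 2 * `|p A| + e ^+ 2 * `|p B| + e ^+ 2 * N by ring.
  by move: eEBA h1 h2 wS; rewrite -/N; clear => *; lra.
have eTL : e ^+ 2 * (T + Lam + 1) <= ((5 * H + 3) / v + 1) * mu.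
  have -> : e ^+ 2 * (T + Lam + 1) = e ^+ 2 * T + e ^+ 2 * (Lam + 1) by ring.
  by rewrite mulrDl mul1r lerD.
have TA : T + Lam + 1 <= - A.
  by rewrite -(ler_pM2l e20) (le_trans eTL)// mulrN; move: muH HA; clear => *; lra.
have TB : T + Lam + 1 <= B by rewrite -(ler_pM2l e20) (le_trans eTL)//; move: muH HB; clear => *; lra.
have {}bound := bound Mn0 TA TB.
apply: (le_trans bound).
have l0 := abs_ln_gt0 e01.
have T1 : p A ^+ 2 + p B ^+ 2 <= 2 * mu.
  have q x : `|x| <= mu -> x ^+ 2 <= mu.
    move=> xm; rewrite -(real_normK (num_real x)) expr2.
    apply: (@le_trans _ _ (mu * mu)); first exact: ler_pM.
    by rewrite ler_piMl// ltW.
  by have := q _ pAm; have := q _ pBm; clear => *; lra.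
have M2 : M ^+ 2 <= 4 * v ^+ 2 + (12 * v + 9) * mu.
  rewrite -(real_normK (num_real M)).
  apply: (@le_trans _ _ ((2 * v + 3 * mu) ^+ 2)); first by rewrite ler_pXn2r// nnegrE// (le_trans _ Mhi).
  have -> : (2 * v + 3 * mu) ^+ 2 = 4 * v ^+ 2 + 12 * v * mu + 9 * (mu * mu) by ring.
  have : mu * mu <= mu by rewrite ler_piMl// ltW.
  by clear => *; lra.
have L3 : 0 < Lam ^+ 3 by exact: exprn_gt0.
have T2 : 3 / 2 * (M ^+ 2 / Lam ^+ 3) <= 8 / 3 * Lam + 3 / 2 * ((12 * v + 9) / Lam ^+ 3) * mu.
  have -> : 8 / 3 * Lam + 3 / 2 * ((12 * v + 9) / Lam ^+ 3) * mu =
     3 / 2 * ((4 * v ^+ 2 + (12 * v + 9) * mu) / Lam ^+ 3).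
    have -> : v = 2 / 3 * Lam ^+ 2 by rewrite LV; field.
    by field; rewrite gt_eqF.
  by rewrite ler_pM2l ?divr_gt0// ler_pM2r// invr_gt0.
have T3a x : `|x| <= K0 * e ^+ 2 -> psi e x <= K0 ^+ 2 * mu.
  move=> xK; apply: (@le_trans _ _ (psi e (e ^+ 2 * K0))).
    apply: mP; rewrite (ger0_norm (x := e ^+ 2 * K0)); last by rewrite mulr_ge0// ltW.
    by rewrite (mulrC (e ^+ 2)).
  by apply: (le_trans (psi_small e01 _)); rewrite ler_wpM2l// sqr_ge0.
have T3 : 2 * Lam * psi e (3 * M / (4 * Lam)) <= 8 * Lam + 9 * (2 * v + 3) ^+ 2 / (8 * Lam) * mu.
  have h : psi e (3 * M / (4 * Lam)) <= 4 + (9 * (2 * v + 3) ^+ 2 / (16 * Lam ^+ 2)) * mu.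
    apply: (le_trans (psi_le e01 _)); rewrite lerD2l.
    apply: ler_pM => //; first exact: sqr_ge0.
    have -> : (3 * M / (4 * Lam)) ^+ 2 = 9 * M ^+ 2 / (16 * Lam ^+ 2) by field; rewrite gt_eqF.
    rewrite ler_pM2r ?invr_gt0 ?mulr_gt0 ?exprn_gt0// ler_pM2l//.
    rewrite -(real_normK (num_real M)) ler_pXn2r// ?nnegrE//; move: mu1 Mhi v0 mu0; clear => *; lra.
  have -> : 8 * Lam + 9 * (2 * v + 3) ^+ 2 / (8 * Lam) * mu =
      2 * Lam * (4 + (9 * (2 * v + 3) ^+ 2 / (16 * Lam ^+ 2)) * mu).
    by field; rewrite gt_eqF.
  by rewrite ler_wpM2l// mulr_ge0// ltW.
have T4 : 2 * (beta * e ^+ 2) * ((3 * v + E + C) *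
    (N + E * (B - A) + 4 * v * (T + Lam + 1))) <=
    2 * beta * ((3 * v + 5 + C) * (25 * H + 13 + 4 * v)) * mu.
  have -> : 2 * (beta * e ^+ 2) * ((3 * v + E + C) *
      (N + E * (B - A) + 4 * v * (T + Lam + 1))) = 2 * beta * ((3 * v + E + C) *
      (e ^+ 2 * N + e ^+ 2 * (E * (B - A)) + 4 * v * (e ^+ 2 * (T + Lam + 1)))) by ring.
  rewrite -[leRHS](mulrA (2 * beta)) ler_wpM2l ?mulr_ge0//.
  rewrite -[leRHS](mulrA (3 * v + 5 + C)); apply: ler_pM.
  - by rewrite !addr_ge0// mulr_ge0// ltW.
  - have T0 : 0 <= T by rewrite /T divr_ge0// !addr_ge0// mulr_ge0.
    have h1 : 0 <= e ^+ 2 * N by rewrite mulr_ge0// ltW.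
    have h2 : 0 <= e ^+ 2 * (E * (B - A)) by rewrite mulr_ge0 ?(ltW e20)// mulr_ge0.
    have h3 : 0 <= T + Lam + 1 by rewrite !addr_ge0// ltW.
    have h4 : 0 <= 4 * v * (e ^+ 2 * (T + Lam + 1)).
      by apply: mulr_ge0; rewrite mulr_ge0 ?(ltW v0) ?(ltW e20).
    by rewrite !addr_ge0.
  - by rewrite lerD2r lerD2l (le_trans hE)// ler_piMr.
  have h : 4 * v * (e ^+ 2 * (T + Lam + 1)) <= 4 * v * (((5 * H + 3) / v + 1) * mu).
    by rewrite ler_wpM2l// mulr_ge0// ltW.
  have E2 : 4 * v * (((5 * H + 3) / v + 1) * mu) = (20 * H + 12 + 4 * v) * mu.
    by field; rewrite gt_eqF.
  rewrite E2 in h.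
  have -> : (25 * H + 13 + 4 * v) * mu = mu + 5 * H * mu + (20 * H + 12 + 4 * v) * mu by ring.
  by apply: lerD => //; apply: lerD.
have := lerD (lerD (lerD T1 T2) (lerD (lerD (T3a _ pA) (T3a _ pB)) T3)) T4.
move/le_trans; apply; rewrite le_eqVlt; apply/orP; left; apply/eqP.
by rewrite /v; field; rewrite gt_eqF.
Qed.
End EnergyBound.

(** * Endpoints provided by strict convergence *)
Section Endpoints.
Context {R : realType}.
Local Notation mu := (@lebesgue_measure R).
Implicit Types (e H V : R).

(** The blow-up of the problem, at scale omega, with U in place of u_eps. *)
Definition meso_w e (U : R -> R) x y : R := (U (x + omega e * y) - U x) / omega e.

Lemma step_pos V y : 0 < y -> step V y = V.
Proof. by move=> y0; rewrite /step /paste leNgt y0. Qed.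

Lemma step_neg V y : y <= 0 -> step V y = - V.
Proof. by move=> y0; rewrite /step /paste y0. Qed.

(** [good_point] on [H/4, H/2] and on [-H/2, -H/4], where the step is constant.
A slope bounded by K at scale omega is bounded by K e^2 at scale omega e^2. *)
Lemma good_endpoints e H V T r x U P G v : 0 < e < 1 -> 0 < H -> 0 < r -> r <= 1 ->
  r <= H / 16 -> 0 <= T ->
  h2rep U P G -> 0 < x - omega e * (H / 2) -> x + omega e * (H / 2) < 1 ->
  (forall y, - H < y < H -> v y = meso_w e U x y) ->
  (BV_variation (- H) H v <= T%:E)%E ->
  Int (fun y => `|meso_w e U x y - step V y|) (- H) H <= r ^+ 2 ->
  exists A B, let w := blow_w e U x in let p := blow_p e P x in
  let K := 16 * (T + H) / H in
  [/\ H / 4 <= - (e ^+ 2 * A) <= H / 2 /\ H / 4 <= e ^+ 2 * B <= H / 2,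
      `|w B - V| <= r /\ `|w A + V| <= r,
      `|p A| <= K * e ^+ 2 /\ `|p B| <= K * e ^+ 2,
      e ^+ 2 * Int (fun y => `|w y - step V y|) A B <= r &
      0 < x + omega e * e ^+ 2 * A /\ x + omega e * e ^+ 2 * B < 1].
Proof.
move=> e01 H0 r0 r1 rH T0 rep x0 x1 vV BV hI.
have e20 : 0 < e ^+ 2 by rewrite exprn_gt0//; case/andP: e01.
have om := omega_gt0 e01.
have [cU cP lG] := h2rep_cts rep; have [LG GP PU] := rep.
set V1 := meso_w e U x in vV hI *.
pose P1 y := P (x + omega e * y).
have cl : continuous (fun y : R => x + omega e * y).
  by apply: ctsD; [exact: cts_cst|apply: ctsM; [exact: cts_cst|exact: cts_id]].
have cP1 : continuous P1 by exact: cts_comp cl cP.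
have cV1 : continuous V1.
  apply: ctsM; last exact: cts_cst.
  by apply: ctsB; [exact: cts_comp cl cU|exact: cts_cst].
have PV : primitive P1 V1.
  have := primitive_addc (- (U x / omega e)) (primitiveZ (omega e)^-1 (primitive_affine x om PU)).
  by congr primitive; apply/funext => y; rewrite /P1 /V1 /meso_w; field; rewrite gt_eqF.
have IP : Int (fun y => `|P1 y|) (- (H / 2)) (H / 2) <= T + H.
  have h1 : - H < - (H / 2) by lra.
  have h2 : - (H / 2) <= H / 2 by lra.
  have h3 : H / 2 < H by lra.
  have := BV_variation_Int h1 h2 h3 cP1 PV vV BV.
  by move=> h; lra.
have lP : locint (fun y => `|P1 y|) by exact/continuous_locint/cts_norm.
have lD : locint (fun y => `|V1 y - step V y|).
  by apply: locint_norm; apply: locintB; [exact: continuous_locint|exact: locint_step].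
pose K := 16 * (T + H) / H.
have K0 : 0 < K by rewrite /K divr_gt0//; lra.
have hK c d : d - c = H / 4 -> 4 * (T + H) <= (d - c) * K.
  by move=> ->; rewrite le_eqVlt; apply/orP; left; apply/eqP; rewrite /K; field; rewrite gt_eqF.
have [y2 y2b [k2 p2]] : exists2 y, H / 4 <= y <= H / 2 & `|V1 y - V| <= r /\ `|P1 y| <= K.
  apply: (good_point (T := T + H)) => //; try lra.
  - by apply: ctsB => //; exact: cts_cst.
  - by apply: hK; field.
  - apply: (le_trans _ hI).
    rewrite (@eq_Int _ _ (fun y => `|V1 y - step V y|)); last first.
      by move=> y yb; rewrite step_pos//; lra.
    by apply: Int_sub => //; lra.
  - by apply: (le_trans _ IP); apply: Int_sub => //; lra.
have [y1 y1b [k1 p1]] : exists2 y, - (H / 2) <= y <= - (H / 4) & `|V1 y + V| <= r /\ `|P1 y| <= K.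
  apply: (good_point (T := T + H)) => //; try lra.
  - by apply: ctsD => //; exact: cts_cst.
  - by apply: hK; field.
  - apply: (le_trans _ hI).
    rewrite (@eq_Int _ _ (fun y => `|V1 y - step V y|)); last first.
      by move=> y yb; rewrite step_neg ?opprK//; lra.
    by apply: Int_sub => //; lra.
  - by apply: (le_trans _ IP); apply: Int_sub => //; lra.
have wE y : blow_w e U x y = V1 (e ^+ 2 * y) by rewrite /V1 /meso_w /blow_w mulrA.
have pE y : blow_p e P x y = e ^+ 2 * P1 (e ^+ 2 * y) by rewrite /P1 /blow_p mulrA.
have eK y : e ^+ 2 * (y / e ^+ 2) = y by rewrite mulrC divfK// gt_eqF.
exists (y1 / e ^+ 2), (y2 / e ^+ 2) => /=; split.
- by rewrite !eK; split; move: y1b y2b; clear => *; lra.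
- by rewrite !wE !eK.
- rewrite !pE !eK !(normrM (e ^+ 2)) (gtr0_norm e20) -/K ![K * _]mulrC.
  by split; rewrite ler_pM2l.
- have sE y : step V y = step V (e ^+ 2 * y).
    by rewrite /step /paste pmulr_rle0.
  rewrite (@eq_Int _ _ (fun y => `|V1 (0 + e ^+ 2 * y) - step V (0 + e ^+ 2 * y)|)); last first.
    by move=> y _; rewrite wE add0r -sE.
  rewrite (Int_affine 0 _ _ e20 lD) !add0r !eK mulrA divff ?gt_eqF// mul1r.
  apply: (@le_trans _ _ (r ^+ 2)); last by rewrite expr2 ler_piMl// ltW.
  by apply: (le_trans _ hI); apply: Int_sub => //; move: y1b y2b H0; clear => *; lra.
- have oE y : omega e * e ^+ 2 * (y / e ^+ 2) = omega e * y by rewrite -mulrA eK.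
  rewrite !oE; split.
    apply: (lt_le_trans x0); rewrite lerD2l -mulrN ler_pM2l//; lra.
  by apply: (le_lt_trans _ x1); rewrite lerD2l ler_pM2l//; lra.
Qed.

End Endpoints.

Section NearEndpoints.
Context {R : realType}.
Local Notation mu := (@lebesgue_measure R).
Implicit Types (e H V : R).

Lemma staircase_pos H V y : 0 < H -> 0 <= y < 2 * H ->
  canonical_staircase H V (y - H) + V = V.
Proof.
move=> H0 yH; rewrite /canonical_staircase /stair (@floor_def _ _ 0).
  by rewrite mulr0 mulr0 add0r.
have -> : ((y - H) / H + 1) / 2 = y / (2 * H) by field; rewrite gt_eqF.
have H2 : 0 < 2 * H by rewrite mulr_gt0.
by rewrite add0r ler_pdivlMr// ltr_pdivrMr// mul0r mul1r.
Qed.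

Lemma staircase_neg H V y : 0 < H -> - (2 * H) <= y < 0 ->
  canonical_staircase H V (y - H) + V = - V.
Proof.
move=> H0 yH; rewrite /canonical_staircase /stair (@floor_def _ _ (-1)).
  by ring.
have -> : ((y - H) / H + 1) / 2 = y / (2 * H) by field; rewrite gt_eqF.
have H2 : 0 < 2 * H by rewrite mulr_gt0.
by rewrite ler_pdivlMr// ltr_pdivrMr// mulN1r mul0r.
Qed.

(** The points -H and H are inside steps, so that strict convergence can be used
on (-H, H). *)
Lemma near_cst_not_jump (v : R -> R) y c : (\forall z \near y, v z = c) -> ~ jump_point v y.
Proof.
move=> vc [l [r [lr cl cr]]].
have E1 : v z @[z --> y^'-] --> c.
  by apply: cvg_near_cst; rewrite near_withinE; apply: filterS vc => z vz _.
have E2 : v z @[z --> y^'+] --> c.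
  by apply: cvg_near_cst; rewrite near_withinE; apply: filterS vc => z vz _.
have lc : l = c by exact: (cvg_unique _ cl E1).
have rc : r = c by exact: (cvg_unique _ cr E2).
by move: lr; rewrite lc rc eqxx.
Qed.

Lemma cvge_lt (f : R -> \bar R) l s : f e @[e --> 0^'+] --> l -> (l < s)%E ->
  \forall e \near 0^'+, (f e < s)%E.
Proof.
move=> fl ls; apply: (fl [set z | (z < s)%E]); apply: open_nbhs_nbhs; split => //.
exact: open_ereal_lt_ereal.
Qed.

Lemma near_endpoints (u : R -> R -> R) (xe : R -> R) (x0 H V : R) : 0 < H -> 0 < x0 < 1 ->
  xe e @[e --> 0^'+] --> x0 ->
  BVloc_strict_cvg (blow_up u xe) (fun y => canonical_staircase H V (y - H) + V) ->
  exists2 K, 0 <= K & forall r : R, 0 < r -> \forall e \near 0^'+, forall U P G,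
    h2rep U P G -> (forall x, 0 < x < 1 -> u e x = U x) ->
    exists A B, let w := blow_w e U (xe e) in let p := blow_p e P (xe e) in
    [/\ H / 4 <= - (e ^+ 2 * A) <= H / 2 /\ H / 4 <= e ^+ 2 * B <= H / 2,
        `|w B - V| <= r /\ `|w A + V| <= r,
        `|p A| <= K * e ^+ 2 /\ `|p B| <= K * e ^+ 2,
        e ^+ 2 * Int (fun y => `|w y - step V y|) A B <= r &
        0 < xe e + omega e * e ^+ 2 * A /\ xe e + omega e * e ^+ 2 * B < 1].
Proof.
move=> H0 x01 xcv.
set v0 := fun y => _; move=> BVc.
have vpos y : 0 <= y < 2 * H -> v0 y = V by exact: staircase_pos.
have vneg y : - (2 * H) <= y < 0 -> v0 y = - V by exact: staircase_neg.
have j1 : ~ jump_point v0 (- H).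
  apply: (near_cst_not_jump (c := - V)); near=> z; apply: vneg; apply/andP; split.
    by apply: ltW; near: z; apply: lt_nbhsr; lra.
  by near: z; apply: lt_nbhsl; lra.
have j2 : ~ jump_point v0 H.
  apply: (near_cst_not_jump (c := V)); near=> z; apply: vpos; apply/andP; split.
    by apply: ltW; near: z; apply: lt_nbhsr; lra.
  by near: z; apply: lt_nbhsl; lra.
have HH : - H < H by lra.
have [[iv0 bv0] bve L1 BV1] := BVc _ _ HH j1 j2.
have [T T0 hT] : exists2 T : R, 0 <= T & (BV_variation (- H) H v0 < T%:E)%E.
  case E : (BV_variation (- H) H v0) bv0 => [t||] // _.
    exists (`|t| + 1); first by rewrite addr_ge0.
    by rewrite lte_fin (le_lt_trans (ler_norm t))// ltrDl.
  by exists 0 => //; exact: ltNyr.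
exists (16 * (T + H) / H); first by rewrite divr_ge0 ?(ltW H0)//; lra.
move=> r r0.
(* s <= H/16 is needed to find good points in intervals of length H/4 *)
pose s := Num.min r (Num.min 1 (H / 16)).
have s0 : 0 < s by rewrite !lt_min r0 ltr01 divr_gt0.
have sr : s <= r by rewrite ge_min lexx.
have s1 : s <= 1 by rewrite !ge_min lexx orbT.
have sH : s <= H / 16 by rewrite !ge_min lexx !orbT.
have s2 : 0 < s ^+ 2 by exact: exprn_gt0.
have /andP[x00 x11] := x01.
pose d := Num.min x0 (1 - x0) / 4.
have d0 : 0 < d by rewrite divr_gt0// lt_min x00 subr_gt0.
have dx0 : 4 * d <= x0.
  by rewrite /d mulrC divfK// ge_min lexx.
have dx1 : 4 * d <= 1 - x0.
  by rewrite /d mulrC divfK// ge_min lexx orbT.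
near=> e => U P G rep uU.
have e01 : 0 < e < 1 by near: e; exact: near_unit.
have om : omega e <= d / H by near: e; apply: omega_small; rewrite divr_gt0.
have omH : omega e * H <= d by rewrite -ler_pdivlMr.
have om0 := omega_gt0 e01.
have xx : `|x0 - xe e| <= d.
  by near: e; move/cvgrPdist_le : xcv; apply.
have BVe : (BV_variation (- H) H (blow_up u xe e) < T%:E)%E.
  by near: e; exact: (cvge_lt BV1).
have L1e : (\int[mu]_(y in `](- H)%R, H[) `|blow_up u xe e y - v0 y|%:E < (s ^+ 2)%:E)%E.
  by near: e; apply: (cvge_lt L1); rewrite lte_fin.
have [ive _] : BV (- H) H (blow_up u xe e) by near: e.
have inside y : - H < y < H -> 0 < xe e + omega e * y < 1.
  move=> /andP[y1 y2]; move: xx; rewrite ler_norml => /andP[h1 h2].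
  have : - (omega e * H) <= omega e * y by rewrite -mulrN ler_pM2l// ltW.
  have : omega e * y <= omega e * H by rewrite ler_pM2l// ltW.
  by lra.
have xin : 0 < xe e < 1.
  by have := inside 0; rewrite mulr0 addr0; apply; lra.
have vE y : - H < y < H -> blow_up u xe e y = meso_w e U (xe e) y.
  by move=> /inside yin; rewrite /blow_up /meso_w !uU.
have om2 : omega e * (H / 2) = omega e * H / 2 by rewrite mulrA.
have [cU _ _] := h2rep_cts rep.
have cV1 : continuous (meso_w e U (xe e)).
  apply: ctsM; last exact: cts_cst.
  apply: ctsB; last exact: cts_cst.
  apply: cts_comp cU.
  by apply: ctsD; [exact: cts_cst|apply: ctsM; [exact: cts_cst|exact: cts_id]].
have lD : locint (fun y => `|meso_w e U (xe e) y - step V y|).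
  by apply: locint_norm; apply: locintB; [exact: continuous_locint|exact: locint_step].
have hI : Int (fun y => `|meso_w e U (xe e) y - step V y|) (- H) H <= s ^+ 2.
  rewrite -lee_fin; apply: le_trans (ltW L1e); rewrite le_eqVlt; apply/orP; left; apply/eqP.
  apply/esym; apply: ae_eq_integral_Int => //.
    apply: measurableT_comp => //; apply: measurable_funB.
      by have /measurable_EFinP := measurable_int mu ive.
    by have /measurable_EFinP := measurable_int mu iv0.
  exists [set 0]; split => //; first exact: lebesgue_measure_set1.
  move=> y /= hy; apply: contrapT => y0; apply: hy => yH.
  rewrite vE//; congr `|_ - _|; have [y_|y_|//] := ltrgtP y 0.
    by rewrite step_neg ?vneg//; [lra|exact: ltW].
  by rewrite step_pos// vpos//; lra.
have [hH1 hH2] : - H < - (H / 2) < H /\ - H < H / 2 < H by lra.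
have x1 : 0 < xe e - omega e * (H / 2).
  by have /andP[] := inside _ hH1; rewrite mulrN.
have x2 : xe e + omega e * (H / 2) < 1 by have /andP[] := inside _ hH2.
have [A [B /=[h1 [h2 h2'] h3 h4 h5]]] :=
  good_endpoints e01 H0 s0 s1 sH T0 rep x1 x2 vE (ltW BVe) hI.
exists A, B; split => //; first by split; exact: le_trans sr.
exact: le_trans sr.
Unshelve. all: by end_near. Qed.

End NearEndpoints.

(** * Stability of the optimal transition *)
Section TwoSided.
Context {R : realType}.
Implicit Types (e Lam rho V A B : R) (w p g : R -> R).
Local Notation rt e := (Num.sqrt `|ln e|).

(** [half_transition] for the logarithmic well, whose small defect below 4 is
absorbed by the factor 1 + 6/r and whose small slopes are controlled by
[small_slopes_mass]. *)
Lemma half_connection Lam rho : 0 < Lam -> 0 < rho -> exists2 kap, 0 < kap &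
  forall (e B D : R) (p g : R -> R), 0 < e < 1 -> 6 <= rt e -> Lam + 1 <= B ->
  L2loc g -> primitive g p -> p B <= rt e ^- 6 -> rt e ^- 6 <= kap ->
  Int (fun y => psi e (p y)) 0 B <= D ->
  2 * Lam ^+ 2 / 3 - kap <= Int p 0 B - (e ^+ 2 * B / rt e + 2 / `|ln e| * D) ->
  let X := Int (fun y => g y ^+ 2) 0 B + (1 + 6 / rt e) * Int (fun y => psi e (p y)) 0 B in
  16 * Lam / 3 - rho <= X /\
  (X <= 16 * Lam / 3 + kap -> `|p Lam| <= rho /\
    Int (fun y => (g y + 2 / Lam * y) ^+ 2) 0 Lam + Int (fun y => g y ^+ 2) Lam B <= rho).
Proof.
move=> Lam0 rho0; have [kap kap0 hk] := half_transition Lam0 rho0.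
exists kap => // e B D p g e01 r6 LB Lg gp pB taukap psiD mass X.
set r := Num.sqrt _ in r6 pB taukap mass X *.
have r0 : 0 < r by apply: lt_le_trans r6.
have B0 : 0 <= B by apply: le_trans LB; rewrite addr_ge0// ltW.
have cp := primitive_continuous gp.
have cpsi : continuous (fun y => psi e (p y)) by exact: cts_comp cp (psi_cts e01).
have c6 : 0 <= 1 + 6 / r by rewrite addr_ge0// divr_ge0// ltW.
have cs : continuous (fun y => (1 + 6 / r) * psi e (p y)).
  by apply: ctsM => //; exact: cts_cst.
have tau0 : 0 <= r ^- 6 by rewrite invr_ge0 exprn_ge0// ltW.
have lpsi := continuous_locint cpsi.
have lex := continuous_locint (cts_excess (tau := r ^- 6) cp).
have m : 2 * Lam ^+ 2 / 3 - kap <= Int (excess p (r ^- 6)) 0 B.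
  apply: (le_trans mass); rewrite lerBlDr.
  have lc c : locint (fun _ : R => c) by exact/continuous_locint/cts_cst.
  have l2 : locint (fun y => e ^+ 2 / r + 2 / `|ln e| * psi e (p y)).
    by apply: locintD => //; exact: locintZ.
  have : Int p 0 B <= Int (fun y => excess p (r ^- 6) y +
      (e ^+ 2 / r + 2 / `|ln e| * psi e (p y))) 0 B.
    apply: le_Int; [exact: continuous_locint|exact: locintD|].
    by move=> y _; exact: small_slopes_mass.
  move/le_trans; apply; rewrite IntD// IntD//; last exact: locintZ.
  rewrite Int_cst// subr0 IntZ// lerD2l.
  have -> : e ^+ 2 / r * B = e ^+ 2 * B / r by rewrite mulrAC.
  by rewrite lerD2l ler_wpM2l// divr_ge0.
have := hk B (r ^- 6) p g (fun y => (1 + 6 / r) * psi e (p y)) LB Lg gp cs _ pB _ tau0 taukap m.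
rewrite IntZ// => /(_ _ _)-[].
- by move=> y; rewrite mulr_ge0// psi_ge0.
- move=> y ty; apply: psi_large => //; apply: ltW.
  by rewrite (lt_le_trans ty)// ler_norm.
by move=> h1 h2; split.
Qed.

(** The right half is handled by the profile sg w'(y), the left half by
sg w'(-y).  [half_connection] is used twice: its lower bound with a tolerance
k1/2, then, for the other half, its stability with tolerance k1. *)
Lemma two_sided_connection Lam V rho : 0 < Lam -> V != 0 -> Lam ^+ 2 = 3 / 2 * `|V| ->
  0 < rho -> exists2 kap, 0 < kap &
  forall (e A B : R) (w p g : R -> R), 0 < e < 1 -> 6 <= rt e ->
  Lam + 1 <= B -> Lam + 1 <= - A -> h2rep w p g -> w 0 = 0 ->
  `|w B - V| <= kap -> `|w A + V| <= kap ->
  `|p A| <= rt e ^- 6 -> `|p B| <= rt e ^- 6 -> (rt e)^-1 <= kap ->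
  e ^+ 2 * B / rt e <= kap -> e ^+ 2 * (- A) / rt e <= kap ->
  Int (fun y => g y ^+ 2 + psi e (p y)) A B <= 32 * Lam / 3 + kap ->
  let sg := Num.sg V in
  [/\ `|p Lam| <= rho,
    Int (fun y => (g y + sg * (2 / Lam) * y) ^+ 2) 0 Lam + Int (fun y => g y ^+ 2) Lam B <= rho &
    Int (fun y => (g y + sg * (2 / Lam) * y) ^+ 2) (- Lam) 0 + Int (fun y => g y ^+ 2) A (- Lam)
       <= rho].
Proof.
move=> Lam0 V0 LV rho0.
have [k1 k10 hk1] := half_connection Lam0 rho0.
(* k2 makes the lower bound of each half precise enough for the stability of the other one *)
have [k2 k20 hk2] := half_connection Lam0 (divr_gt0 k10 (ltr0Sn _ 1)).
pose k := Num.min (Num.min k1 k2) 1.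
have k0 : 0 < k by rewrite !lt_min k10 k20 ltr01.
have kk1 : k <= k1 by rewrite !ge_min lexx.
have kk2 : k <= k2 by rewrite !ge_min lexx !orbT.
have k11 : k <= 1 by rewrite !ge_min lexx !orbT.
(* 11 Lam + 1 bounds the total energy; c collects the factors of the error terms *)
pose c := 2 * (7 * (11 * Lam + 1) + 4).
have c0 : 0 < c by rewrite /c; lra.
have c1 : 1 <= c by rewrite /c; lra.
exists (k / c); first by rewrite divr_gt0.
move=> e A B w p g e01 r6 LB LA rep w0 wB wA pA pB rk eB eA en sg.
set r := Num.sqrt _ in r6 pA pB rk eB eA.
have r0 : 0 < r by apply: lt_le_trans r6.
have lE : `|ln e| = r ^+ 2 by rewrite sqr_sqrtr.
have B0 : 0 <= B by apply: le_trans LB; rewrite addr_ge0// ltW.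
have A0 : A <= 0 by rewrite -oppr_ge0; apply: le_trans LA; rewrite addr_ge0// ltW.
have [cw cp lg] := h2rep_cts rep; have [Lg gp pw] := rep.
set q := k / c in rk eB eA en wA wB.
have q0 : 0 < q by rewrite divr_gt0.
have qc : q * c = k by rewrite /q divfK// gt_eqF.
have qk : q <= k by rewrite -qc ler_peMr// ltW.
have q1 : q <= 1 by exact: le_trans k11.
have cpsi : continuous (fun y => psi e (p y)) by exact: cts_comp cp (psi_cts e01).
have lpsi := continuous_locint cpsi.
have lp := continuous_locint cp.
have lg2 : locint (fun y => g y ^+ 2) by case: Lg.
have sgV : sg * V = `|V| by rewrite /sg -normrEsg.
have sg1 : `|sg| = 1 by rewrite normr_sg V0.
have sg2 : sg ^+ 2 = 1 by rewrite sqr_sg V0.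
have nsg x : `|sg * x| = `|x| by rewrite normrM sg1 mul1r.
have psg x : psi e (sg * x) = psi e x by rewrite -psi_norm nsg psi_norm.
set E := Int _ A B in en.
have EE : E = Int (fun y => g y ^+ 2) A 0 + Int (fun y => g y ^+ 2) 0 B +
    (Int (fun y => psi e (p y)) A 0 + Int (fun y => psi e (p y)) 0 B).
  by rewrite /E IntD// (Int_chasles lg2 A0 B0) (Int_chasles lpsi A0 B0).
set gA := Int _ A 0 in EE; set gB := Int _ 0 B in EE.
set sA := Int _ A 0 in EE; set sB := Int _ 0 B in EE.
have gA0 : 0 <= gA by apply: Int_ge0 => y _; exact: sqr_ge0.
have gB0 : 0 <= gB by apply: Int_ge0 => y _; exact: sqr_ge0.
have sA0 : 0 <= sA by apply: Int_ge0 => y _; exact: psi_ge0.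
have sB0 : 0 <= sB by apply: Int_ge0 => y _; exact: psi_ge0.
pose D := 11 * Lam + 1.
have D0 : 0 < D by rewrite /D; move: Lam0; clear => *; lra.
have ED : gA + gB + (sA + sB) <= D.
  by rewrite -EE; apply: (le_trans en); rewrite /D; move: q1 Lam0; clear => *; lra.
have qD : q * (14 * D + 8) = k by rewrite -qc /c /D; ring.
have qD0 : 0 <= q * D by rewrite mulr_ge0// ltW.
have v23 : 2 * Lam ^+ 2 / 3 = `|V| by rewrite LV; field.
have r16 : r^-1 <= 6^-1 by rewrite lef_pV2 ?posrE.
have ri0 : 0 < r^-1 by rewrite invr_gt0.
have lD : 2 / `|ln e| * D <= q * D.
  rewrite ler_pM2r// lE expr2 invfM mulrA.
  apply: (@le_trans _ _ (1 * r^-1)); last by rewrite mul1r.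
  by rewrite ler_pM2r//; move: r16; clear => *; lra.
have tauk : r ^- 6 <= k.
  apply: le_trans qk; apply: le_trans rk.
  rewrite lef_pV2 ?posrE ?exprn_gt0// ler_eXnr//.
  by apply: le_trans r6; rewrite ler1n.
have massB : `|V| - k <= Int (fun y => sg * p y) 0 B - (e ^+ 2 * B / r + 2 / `|ln e| * D).
  have -> : Int (fun y => sg * p y) 0 B = `|V| + sg * (w B - V).
    rewrite IntZ//; have := primitiveE pw B0; rewrite w0 add0r => <-.
    by rewrite mulrBr sgV; ring.
  have : - (sg * (w B - V)) <= q by rewrite (le_trans _ wB)// -(nsg (w B - V)) -normrN ler_norm.
  by move: eB lD qD qD0 q0; clear => *; lra.
have massA : `|V| - k <=
    Int (fun y => sg * p (- y)) 0 (- A) - (e ^+ 2 * (- A) / r + 2 / `|ln e| * D).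
  have -> : Int (fun y => sg * p (- y)) 0 (- A) = `|V| - sg * (w A + V).
    rewrite (@Int_opp _ (fun y => sg * p y)) ?opprK ?oppr0; last first.
      exact: locintZ.
    rewrite IntZ//; have := primitiveE pw A0; rewrite w0 => h.
    have -> : Int p A 0 = - w A by rewrite -[LHS](addKr (w A)) -h addr0.
    by rewrite mulrDr sgV; ring.
  have : sg * (w A + V) <= q by rewrite (le_trans _ wA)// -(nsg (w A + V)) ler_norm.
  by move: eA lD qD qD0 q0; clear => *; lra.
have LgB : L2loc (fun y => sg * g y) by exact: L2locZ.
have gpB := primitiveZ sg gp.
have LgA : L2loc (fun y => - (sg * g (- y))).
  have -> : (fun y => - (sg * g (- y))) = (fun y => (- sg) * g (- y)).
    by apply/funext => y; rewrite mulNr.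
  by apply: L2locZ; exact: L2loc_opp.
have gpA := primitive_opp gpB.
have pBt : sg * p B <= r ^- 6 by rewrite (le_trans _ pB)// -(nsg (p B)) ler_norm.
have pAt : sg * p (- - A) <= r ^- 6 by rewrite opprK (le_trans _ pA)// -(nsg (p A)) ler_norm.
have sBE : Int (fun y => psi e (sg * p y)) 0 B = sB by apply: eq_Int => y _; exact: psg.
have sAE : Int (fun y => psi e (sg * p (- y))) 0 (- A) = sA.
  have := Int_opp 0 (- A) lpsi; rewrite opprK oppr0 -/sA => <-.
  by apply: eq_Int => y _; exact: psg.
have gBE : Int (fun y => (sg * g y) ^+ 2) 0 B = gB.
  by apply: eq_Int => y _; rewrite exprMn sg2 mul1r.
have gAE : Int (fun y => (- (sg * g (- y))) ^+ 2) 0 (- A) = gA.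
  have := Int_opp 0 (- A) lg2; rewrite opprK oppr0 -/gA => <-.
  by apply: eq_Int => y _; rewrite sqrrN exprMn sg2 mul1r.
have sBD : Int (fun y => psi e (sg * p y)) 0 B <= D.
  by rewrite sBE; move: ED gA0 gB0 sA0; clear => *; lra.
have sAD : Int (fun y => psi e (sg * p (- y))) 0 (- A) <= D.
  by rewrite sAE; move: ED gA0 gB0 sB0; clear => *; lra.
have mB kk : k <= kk -> 2 * Lam ^+ 2 / 3 - kk <=
    Int (fun y => sg * p y) 0 B - (e ^+ 2 * B / r + 2 / `|ln e| * D).
  by move=> kkk; apply: le_trans massB; rewrite v23 lerB.
have mA kk : k <= kk -> 2 * Lam ^+ 2 / 3 - kk <=
    Int (fun y => sg * p (- y)) 0 (- A) - (e ^+ 2 * (- A) / r + 2 / `|ln e| * D).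
  by move=> kkk; apply: le_trans massA; rewrite v23 lerB.
have [loB _] := hk2 e B D _ _ e01 r6 LB LgB gpB pBt (le_trans tauk kk2) sBD (mB _ kk2).
have [loA _] := hk2 e (- A) D _ _ e01 r6 LA LgA gpA pAt (le_trans tauk kk2) sAD (mA _ kk2).
have [_ hiB] := hk1 e B D _ _ e01 r6 LB LgB gpB pBt (le_trans tauk kk1) sBD (mB _ kk1).
have [_ hiA] := hk1 e (- A) D _ _ e01 r6 LA LgA gpA pAt (le_trans tauk kk1) sAD (mA _ kk1).
rewrite -/r gBE sBE in loB hiB; rewrite -/r gAE sAE in loA hiA.
have total : gB + (1 + 6 / r) * sB + (gA + (1 + 6 / r) * sA) <= 32 * Lam / 3 + k1 / 2.
  have h : 6 / r * (sA + sB) <= 6 * q * D.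
    apply: ler_pM; rewrite ?mulr_ge0 ?addr_ge0 ?(ltW ri0)//; first by rewrite ler_pM2l.
    by move: ED gA0 gB0; clear => *; lra.
  have -> : gB + (1 + 6 / r) * sB + (gA + (1 + 6 / r) * sA) =
    gA + gB + (sA + sB) + 6 / r * (sA + sB) by ring.
  by move: en; rewrite EE; move: h qD qD0 kk1 q0; clear => *; lra.
have hiB' : gB + (1 + 6 / r) * sB <= 16 * Lam / 3 + k1 by move: total loA; clear => *; lra.
have hiA' : gA + (1 + 6 / r) * sA <= 16 * Lam / 3 + k1 by move: total loB; clear => *; lra.
have [p1 I1] := hiB hiB'; have [_ I2] := hiA hiA'.
have sq a b : (sg * a + b) ^+ 2 = (a + sg * b) ^+ 2.
  have -> : (sg * a + b) ^+ 2 = sg ^+ 2 * a ^+ 2 + 2 * sg * a * b + b ^+ 2 by ring.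
  have -> : (a + sg * b) ^+ 2 = a ^+ 2 + 2 * sg * a * b + sg ^+ 2 * b ^+ 2 by ring.
  by rewrite sg2 !mul1r.
split.
- by rewrite -nsg.
- apply: le_trans I1; rewrite le_eqVlt; apply/orP; left; apply/eqP; congr (_ + _).
    by apply: eq_Int => y _; rewrite sq; congr (_ ^+ 2); ring.
  by apply: eq_Int => y _; rewrite exprMn sg2 mul1r.
- apply: le_trans I2; rewrite le_eqVlt; apply/orP; left; apply/eqP; congr (_ + _).
    have ll : locint (fun y => (g y + sg * (2 / Lam) * y) ^+ 2).
      have [] : L2loc (fun y => g y + sg * (2 / Lam) * y).
        apply: L2locD => //; apply: continuous_L2loc.
        by apply: ctsM; [exact: cts_cst|exact: cts_id].
      by [].
    have := Int_opp 0 Lam ll; rewrite oppr0 => <-.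
    apply: eq_Int => y _.
    have -> : - (sg * g (- y)) + 2 / Lam * y = - (sg * g (- y) + - (2 / Lam * y)) by ring.
    by rewrite sqrrN sq; congr (_ ^+ 2); ring.
  have := Int_opp Lam (- A) lg2; rewrite opprK => <-.
  by apply: eq_Int => y _; rewrite sqrrN exprMn sg2 mul1r.
Qed.
End TwoSided.

(** * Distance to the cubic connection *)
Section Connection.
Context {R : realType}.
Implicit Types (Lam V : R).

Definition connection_p Lam V : R -> R :=
  paste (- Lam) (fun=> 0) (paste Lam (cubic_p Lam (2 * V) 0) (fun=> 0)).
Definition connection_g Lam V : R -> R :=
  paste (- Lam) (fun=> 0) (paste Lam (cubic_g Lam (2 * V) 0) (fun=> 0)).

Lemma cubic_connectionE Lam V : 0 < Lam -> cubic_connection Lam V =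
  paste (- Lam) (fun=> - V) (paste Lam (cubic_w Lam (2 * V) 0 0) (fun=> V)).
Proof.
move=> L0; apply/funext => y; rewrite /cubic_connection /paste.
case: ifP => // _; case: ifP => // _.
by rewrite /cubic_w; field; rewrite gt_eqF.
Qed.

Lemma h2rep_connection Lam V : 0 < Lam ->
  h2rep (cubic_connection Lam V) (connection_p Lam V) (connection_g Lam V).
Proof.
move=> L0; rewrite cubic_connectionE//.
have Ln0 : Lam != 0 by rewrite gt_eqF.
have rc c : h2rep (fun=> c : R) (fun=> 0) (fun=> 0).
  exact: (h2rep_smooth (fun x => dr_cst c x) (fun x => dr_cst 0 x) (@cts_cst R 0)).
have NL : - Lam <= Lam by rewrite (le_trans _ (ltW L0))// oppr_le0 ltW.
apply: h2rep_paste; [exact: rc| | |].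
- apply: h2rep_paste; [exact: h2rep_cubic|exact: rc| |].
    by rewrite /cubic_w; field.
  by rewrite /cubic_p; field.
- by rewrite /paste NL /cubic_w; field.
- by rewrite /paste NL /cubic_p; field.
Qed.

Lemma connection_g_mid Lam V y : 0 < Lam -> Lam ^+ 2 = 3 / 2 * `|V| -> - Lam < y <= Lam ->
  connection_g Lam V y = - (Num.sg V * (2 / Lam) * y).
Proof.
move=> L0 LV /andP[y1 y2]; rewrite /connection_g /paste leNgt y1 y2 /cubic_g.
have -> : V = Num.sg V * (2 / 3 * Lam ^+ 2) by rewrite LV mulrA -[LHS]mulr_sg_norm; field.
rewrite sgrM (gtr0_sg (x := 2 / 3 * Lam ^+ 2)) ?mulr_gt0 ?exprn_gt0//.
by rewrite sgr_id mulr1; field; rewrite gt_eqF.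
Qed.

Lemma connection_g_right Lam V y : 0 < Lam -> Lam < y -> connection_g Lam V y = 0.
Proof.
move=> L0 y1; rewrite /connection_g /paste leNgt (leNgt y Lam) y1.
by rewrite (lt_trans _ y1)// (lt_trans _ L0)// oppr_lt0.
Qed.

Lemma connection_g_left Lam V y : y <= - Lam -> connection_g Lam V y = 0.
Proof. by move=> y1; rewrite /connection_g /paste y1. Qed.

Lemma connection_p_Lam Lam V : 0 < Lam -> connection_p Lam V Lam = 0.
Proof.
move=> L0; rewrite /connection_p /paste lexx leNgt (lt_trans _ L0) ?oppr_lt0//=.
by rewrite /cubic_p subr0 subrr mulr0.
Qed.

(** Two integrations suffice: the slope of the connection vanishes at Lam, where p
is small, and the connection vanishes at 0, as w does. *)
Lemma connection_stability Lam V rho A B K a b (w p g : R -> R) : 0 < Lam ->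
  Lam ^+ 2 = 3 / 2 * `|V| -> 0 <= rho -> rho <= 1 -> h2rep w p g -> w 0 = 0 ->
  Lam <= K -> A <= - K -> K <= B -> - K <= a -> a <= b -> b <= K ->
  `|p Lam| <= rho ->
  Int (fun y => (g y + Num.sg V * (2 / Lam) * y) ^+ 2) 0 Lam
    + Int (fun y => g y ^+ 2) Lam B <= rho ->
  Int (fun y => (g y + Num.sg V * (2 / Lam) * y) ^+ 2) (- Lam) 0
    + Int (fun y => g y ^+ 2) A (- Lam) <= rho ->
  Int (fun y => (w y - cubic_connection Lam V y) ^+ 2 + (p y - connection_p Lam V y) ^+ 2
    + (g y - connection_g Lam V y) ^+ 2) a b <= (4 * K * (1 + 4 * K) * (1 + K ^+ 2) + 2) * rho.
Proof.
move=> L0 LV rho0 rho1 rep w0 LK AK KB Ka ab bK pL IR IL.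
have repC := h2rep_connection V L0; have repd := h2repB rep repC.
have [cdw cdp _] := h2rep_cts repd; have [Ldg gdp pdw] := repd.
have [Lg _ _] := rep; have [_ lg2] := Lg; have [_ ldg2] := Ldg.
set dw := fun y => w y - _ in cdw pdw *; set dp := fun y => p y - _ in cdp gdp pdw *.
set dg := fun y => g y - _ in Ldg gdp ldg2 *.
have K0 : 0 < K by exact: lt_le_trans LK.
have ll : locint (fun y => (g y + Num.sg V * (2 / Lam) * y) ^+ 2).
  have [//] : L2loc (fun y => g y + Num.sg V * (2 / Lam) * y).
  apply: L2locD => //; apply: continuous_L2loc.
  by apply: ctsM; [exact: cts_cst|exact: cts_id].
have NL0 : - Lam <= 0 by rewrite oppr_le0 ltW.
have LB : Lam <= B by exact: le_trans KB.
have AL : A <= - Lam by apply: (le_trans AK); rewrite lerN2.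
have Idg : Int (fun y => dg y ^+ 2) A B <= 2 * rho.
  rewrite (Int_chasles ldg2 AL (le_trans NL0 (le_trans (ltW L0) LB))).
  rewrite (Int_chasles ldg2 NL0 (le_trans (ltW L0) LB)) (Int_chasles ldg2 (ltW L0) LB).
  have -> : Int (fun y => dg y ^+ 2) A (- Lam) = Int (fun y => g y ^+ 2) A (- Lam).
    by apply: eq_Int => y /andP[_ yL]; rewrite /dg connection_g_left// subr0.
  have -> : Int (fun y => dg y ^+ 2) Lam B = Int (fun y => g y ^+ 2) Lam B.
    apply: eq_Int_oo; try exact: locint_measurable.
    by move=> y /andP[yL _]; rewrite /dg connection_g_right// subr0.
  have E y : - Lam < y < Lam -> dg y ^+ 2 = (g y + Num.sg V * (2 / Lam) * y) ^+ 2.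
    by move=> /andP[y1 y2]; rewrite /dg connection_g_mid ?opprK// y1 ltW.
  have -> : Int (fun y => dg y ^+ 2) (- Lam) 0 =
      Int (fun y => (g y + Num.sg V * (2 / Lam) * y) ^+ 2) (- Lam) 0.
    apply: eq_Int_oo; try exact: locint_measurable.
    by move=> y /andP[y1 y2]; apply: E; rewrite y1 (lt_trans y2).
  have -> : Int (fun y => dg y ^+ 2) 0 Lam =
      Int (fun y => (g y + Num.sg V * (2 / Lam) * y) ^+ 2) 0 Lam.
    apply: eq_Int_oo; try exact: locint_measurable.
    by move=> y /andP[y1 y2]; apply: E; rewrite y2 andbT (le_lt_trans NL0).
  by move: IR IL; clear => *; lra.
have Isub x y : - K <= x -> x <= y -> y <= K -> Int (fun t => dg t ^+ 2) x y <= 2 * rho.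
  move=> Kx xy yK; apply: le_trans Idg; apply: Int_sub => //.
  - by move=> t _; exact: sqr_ge0.
  - exact: le_trans Kx.
  - exact: le_trans KB.
pose M := 2 * (1 + 4 * K) * rho.
have M0 : 0 <= M by rewrite !mulr_ge0// addr_ge0// mulr_ge0// ltW.
have dpM y : - K <= y <= K -> dp y ^+ 2 <= M.
  move=> /andP[y1 y2].
  have dpL : dp Lam ^+ 2 <= rho.
    rewrite /dp connection_p_Lam// subr0 -(real_normK (num_real (p Lam))) expr2.
    apply: (@le_trans _ _ (rho * rho)); first exact: ler_pM.
    by rewrite ler_piMl.
  have inc : (dp y - dp Lam) ^+ 2 <= 4 * K * rho.
    have -> : 4 * K * rho = 2 * rho * (2 * K) by ring.
    case: (lerP y Lam) => [yL|/ltW Ly].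
      rewrite -sqrrN opprB; apply: (le_trans (primitive_increment_sqr yL Ldg gdp)).
      apply: ler_pM; [by apply: Int_ge0 => t _; exact: sqr_ge0|by rewrite subr_ge0|exact: Isub|].
      by move: y1 LK; clear => *; lra.
    apply: (le_trans (primitive_increment_sqr Ly Ldg gdp)).
    apply: ler_pM; [by apply: Int_ge0 => t _; exact: sqr_ge0|by rewrite subr_ge0| |].
      by apply: Isub => //; rewrite (le_trans _ (ltW L0))// oppr_le0 ltW.
    by move: y2 L0 K0; clear => *; lra.
  have : dp y ^+ 2 <= 2 * (dp y - dp Lam) ^+ 2 + 2 * dp Lam ^+ 2.
    rewrite -subr_ge0; have -> : 2 * (dp y - dp Lam) ^+ 2 + 2 * dp Lam ^+ 2 - dp y ^+ 2 =
      (dp y - 2 * dp Lam) ^+ 2 by ring.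
    exact: sqr_ge0.
  move/le_trans; apply; rewrite /M.
  have -> : 2 * (1 + 4 * K) * rho = 2 * (4 * K * rho) + 2 * rho by ring.
  by apply: lerD; rewrite ler_pM2l.
have lc c : locint (fun _ : R => c) by exact/continuous_locint/cts_cst.
have Ldp : L2loc dp by exact: continuous_L2loc.
have [_ ldp2] := Ldp; have Ldw : L2loc dw by exact: continuous_L2loc.
have [_ ldw2] := Ldw.
have dw0 : dw 0 = 0.
  rewrite /dw w0 /cubic_connection leNgt oppr_lt0 L0/= ltW// expr0n/= mulr0 subr0 mulr0.
  exact: subr0.
have dwM y : - K <= y <= K -> dw y ^+ 2 <= M * K ^+ 2.
  move=> /andP[y1 y2].
  have Idp s t : - K <= s -> s <= t -> t <= K -> t - s <= K ->
      Int (fun y => dp y ^+ 2) s t * (t - s) <= M * K ^+ 2.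
    move=> Ks st tK tsK; have st0 : 0 <= t - s by rewrite subr_ge0.
    rewrite expr2 mulrA; apply: ler_pM => //.
      by apply: Int_ge0 => z _; exact: sqr_ge0.
    apply: (@le_trans _ _ (Int (fun=> M) s t)).
      apply: le_Int => // z /andP[sz zt]; apply: dpM.
      by rewrite (le_trans Ks)//= (le_trans zt).
    by rewrite Int_cst// ler_wpM2l.
  case: (lerP y 0) => [yn|/ltW yp].
    have := primitive_increment_sqr yn Ldp pdw; rewrite dw0 sub0r sqrrN => /le_trans; apply.
    by apply: Idp => //; [exact: ltW|rewrite sub0r lerNl].
  have := primitive_increment_sqr yp Ldp pdw; rewrite dw0 subr0 => /le_trans; apply.
  by apply: Idp => //; [rewrite oppr_le0 ltW|rewrite subr0].
have ba : b - a <= 2 * K by move: Ka bK; clear => *; lra.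
rewrite IntD//; last exact: locintD.
have h1 : Int (fun y => dw y ^+ 2 + dp y ^+ 2) a b <= (M * K ^+ 2 + M) * (2 * K).
  apply: (@le_trans _ _ (Int (fun=> M * K ^+ 2 + M) a b)).
    apply: le_Int => //; first exact: locintD.
    move=> y /andP[ay yb]; have yK : - K <= y <= K by rewrite (le_trans Ka)//= (le_trans yb).
    by apply: lerD; [exact: dwM|exact: dpM].
  by rewrite Int_cst// ler_wpM2l// addr_ge0// mulr_ge0// sqr_ge0.
have -> : (4 * K * (1 + 4 * K) * (1 + K ^+ 2) + 2) * rho =
   (M * K ^+ 2 + M) * (2 * K) + 2 * rho by rewrite /M; ring.
by apply: lerD => //; exact: Isub.
Qed.

End Connection.

(** * Convergence to the cubic connection *)
Section Profile.
Context {R : realType}.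

(** For fixed rho all error terms are eventually below the tolerances required
by [two_sided_connection].  Powers of e beat powers of |ln e|, in particular
K0 e^2 is below the threshold r^-6 = |ln e|^-3. *)
Lemma near_transition_profile (beta : R) (f : R -> R) (u : R -> R -> R) (xe : R -> R)
    (x0 H V Lam : R) :
  0 < beta -> C1_closed 0 1 f ->
  (forall e : R, 0 < e < 1 -> PMF_minimizer e beta f 0 1 (u e)) ->
  0 < x0 < 1 -> xe e @[e --> 0^'+] --> x0 ->
  0 < H -> V != 0 -> 0 < Lam -> Lam ^+ 2 = 3 / 2 * `|V| ->
  BVloc_strict_cvg (blow_up u xe) (fun y => canonical_staircase H V (y - H) + V) ->
  forall K rho : R, 0 < rho -> \forall e \near 0^'+, forall U P G,
    h2rep U P G -> (forall x, 0 < x < 1 -> u e x = U x) ->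
    exists A B, let p := blow_p e P (xe e) in let g := blow_g e G (xe e) in
    let sg := Num.sg V in
    [/\ A <= - K /\ K <= B,
      0 < xe e + omega e * e ^+ 2 * A /\ xe e + omega e * e ^+ 2 * B < 1,
      `|p Lam| <= rho,
      Int (fun y => (g y + sg * (2 / Lam) * y) ^+ 2) 0 Lam + Int (fun y => g y ^+ 2) Lam B <= rho &
      Int (fun y => (g y + sg * (2 / Lam) * y) ^+ 2) (- Lam) 0 + Int (fun y => g y ^+ 2) A (- Lam)
        <= rho].
Proof.
move=> beta0 fC1 um x01 xcv H0 V0 L0 LV BVc K rho rho0.
have [F [C [C0 FC cF fF]]] := C1_closed_lipschitz fC1.
have [K0 K00 hE] := near_endpoints H0 x01 xcv BVc.
have CH0 : 0 <= C * H by rewrite mulr_ge0// ltW.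
have [c c0 hc] := transition_energy_le L0 V0 LV H0 (ltW beta0) CH0 K00.
have [kap kap0 hk] := two_sided_connection L0 V0 LV rho0.
have v0 : 0 < `|V| by rewrite normr_gt0.
pose cH := (5 * H + 3) / `|V| + 1.
have cH0 : 0 < cH by rewrite addr_gt0// divr_gt0//; lra.
pose r := Num.min (Num.min 1 (`|V| / 3)) (Num.min (H / 4 / cH) (Num.min (kap / c) kap)).
have r0 : 0 < r by rewrite !lt_min ltr01 !divr_gt0.
have r1 : r <= 1 by rewrite !ge_min lexx.
have rV : 3 * r <= `|V|.
  by rewrite mulrC -ler_pdivlMr// !ge_min lexx ?orbT.
have rH : cH * r <= H / 4.
  by rewrite mulrC -ler_pdivlMr// !ge_min lexx ?orbT.
have rc : c * r <= kap.
  by rewrite mulrC -ler_pdivlMr// !ge_min lexx ?orbT.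
have rk : r <= kap by rewrite !ge_min lexx ?orbT.
near=> e => U P G rep uU.
have e01 : 0 < e < 1 by near: e; exact: near_unit.
have /andP[e0 e1] := e01.
have e20 : 0 < e ^+ 2 by exact: exprn_gt0.
have e2e : e ^+ 2 <= e by rewrite expr2 ler_piMl// ltW.
have om0 := omega_gt0 e01; have l0 := abs_ln_gt0 e01.
have [A [B /=[[A1 B1] [wB wA] [pA pB] wS [xA xB]]]] :
    exists A B, let w := blow_w e U (xe e) in let p := blow_p e P (xe e) in
    [/\ H / 4 <= - (e ^+ 2 * A) <= H / 2 /\ H / 4 <= e ^+ 2 * B <= H / 2,
        `|w B - V| <= r /\ `|w A + V| <= r,
        `|p A| <= K0 * e ^+ 2 /\ `|p B| <= K0 * e ^+ 2,
        e ^+ 2 * Int (fun y => `|w y - step V y|) A B <= r &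
        0 < xe e + omega e * e ^+ 2 * A /\ xe e + omega e * e ^+ 2 * B < 1].
  by move: U P G rep uU; near: e; exact: hE.
have /andP[A1a A1b] := A1; have /andP[B1a B1b] := B1.
have small_e2 M s : 0 <= M -> M * e <= s -> M * e ^+ 2 <= s.
  by move=> M0; apply: le_trans; rewrite ler_wpM2l.
have hl : `|ln e|^-1 <= r.
  have : r^-1 <= `|ln e| by near: e; exact: abs_ln_large.
  by move=> h; rewrite -[leRHS]invrK lef_pV2 ?posrE ?invr_gt0.
have eL : e ^+ 2 * (Lam + 1) <= r.
  rewrite mulrC; apply: small_e2; first by rewrite addr_ge0// ltW.
  by near: e; exact: small_near.
have eK0 : K0 * e ^+ 2 <= r by apply: small_e2 => //; near: e; exact: small_near.
have eKH : `|K| * e ^+ 2 <= H / 4.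
  by apply: small_e2 => //; near: e; apply: small_near; rewrite divr_gt0.
have eLH : (Lam + 1) * e ^+ 2 <= H / 4.
  apply: small_e2; first by rewrite addr_ge0// ltW.
  by near: e; apply: small_near; rewrite divr_gt0.
have eK6 : 6 * K0 * e <= 1 by near: e; exact: small_near.
have r6 : 6 <= Num.sqrt `|ln e| by near: e; exact: sqrt_abs_ln_large.
have rtk : kap^-1 * (1 + H) <= Num.sqrt `|ln e| by near: e; exact: sqrt_abs_ln_large.
set rt := Num.sqrt _ in r6 rtk *.
have rt0 : 0 < rt by exact: lt_le_trans r6.
have rtk1 : (1 + H) / rt <= kap.
  by rewrite ler_pdivrMr// -ler_pdivrMl.
have tau : K0 * e ^+ 2 <= rt ^- 6.
  have -> : rt ^+ 6 = `|ln e| ^+ 3 by rewrite -[6%N]/(2 * 3)%N exprM /rt sqr_sqrtr.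
  rewrite -[leRHS]mul1r ler_pdivlMr ?exprn_gt0//.
  apply: le_trans eK6; have := cube_abs_ln e01 => h.
  have -> : K0 * e ^+ 2 * `|ln e| ^+ 3 = (K0 * e) * (e * `|ln e| ^+ 3) by ring.
  have -> : 6 * K0 * e = (K0 * e) * 6 by ring.
  by apply: ler_wpM2l => //; rewrite mulr_ge0// ltW.
have rep' := blow_h2rep (xe e) e01 rep.
pose c1 := (F (xe e) - U (xe e)) / omega e.
pose Fb y := (F (xe e + omega e * e ^+ 2 * y) - F (xe e)) / omega e.
have dE : blow_datum e F U (xe e) = fun y => c1 + Fb y.
  by apply/funext => y; rewrite /blow_datum /c1 /Fb; field; rewrite gt_eqF.
have cFb : continuous Fb.
  apply: ctsM; last exact: cts_cst.
  apply: ctsB; last exact: cts_cst.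
  apply: cts_comp cF.
  by apply: ctsD; [exact: cts_cst|apply: ctsM; [exact: cts_cst|exact: cts_id]].
have AB : A <= B.
  by rewrite -(ler_pM2l e20); have := A1a; have := B1a; have := H0; clear => *; lra.
have Fbb y : A <= y <= B -> `|Fb y| <= C * H.
  move=> /andP[yA yB]; rewrite /Fb normrM (gtr0_norm (x := (omega e)^-1)) ?invr_gt0//.
  rewrite ler_pdivrMr//; apply: (le_trans (FC _ _)).
  rewrite addrAC subrr add0r normrM (gtr0_norm (x := omega e * e ^+ 2)) ?mulr_gt0//.
  have eyH : `|e ^+ 2 * y| <= H.
    have : e ^+ 2 * A <= e ^+ 2 * y by rewrite ler_pM2l.
    have : e ^+ 2 * y <= e ^+ 2 * B by rewrite ler_pM2l.
    rewrite ler_norml; have := A1b; have := B1b; have := H0; clear => *; lra.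
  rewrite (normrM (e ^+ 2)) (gtr0_norm e20) in eyH.
  have -> : C * (omega e * e ^+ 2 * `|y|) = (C * (e ^+ 2 * `|y|)) * omega e by ring.
  by rewrite ler_pM2r// ler_wpM2l.
have mini W Q G' : h2rep W Q G' -> W A = blow_w e U (xe e) A -> Q A = blow_p e P (xe e) A ->
    W B = blow_w e U (xe e) B -> Q B = blow_p e P (xe e) B ->
    Int (scaled_density e (beta * e ^+ 2) (fun y => c1 + Fb y) (blow_w e U (xe e))
      (blow_p e P (xe e)) (blow_g e G (xe e))) A B <=
    Int (scaled_density e (beta * e ^+ 2) (fun y => c1 + Fb y) W Q G') A B.
  rewrite -dE => *; exact: (blow_up_minimality e01 (um e e01) rep uU cF fF AB xA xB).
have energy := hc r e A B c1 _ _ _ Fb e01 r0 r1 rV rH hl eL eK0 rep' cFb Fbb.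
have {}energy : Int (fun y => blow_g e G (xe e) y ^+ 2 + psi e (blow_p e P (xe e) y)) A B <=
    32 * Lam / 3 + kap.
  apply: (@le_trans _ _ (32 * Lam / 3 + c * r)); last by rewrite lerD2l.
  apply: energy => //.
  - by rewrite mulrBr; have := A1b; have := B1b; clear => *; lra.
have LB : Lam + 1 <= B.
  by rewrite -(ler_pM2l e20) mulrC (le_trans eLH)//; case/andP: B1.
have LA : Lam + 1 <= - A.
  by rewrite -(ler_pM2l e20) mulrC mulrN (le_trans eLH)//; case/andP: A1.
have w0 : blow_w e U (xe e) 0 = 0 by rewrite /blow_w mulr0 addr0 subrr mul0r.
have rti : rt^-1 <= kap.
  apply: le_trans rtk1; rewrite -[leLHS]mul1r ler_pM2r ?invr_gt0// lerDl ltW//.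
have eB : e ^+ 2 * B / rt <= kap.
  apply: le_trans rtk1; rewrite ler_pM2r ?invr_gt0//.
  by have := B1b; have := H0; clear => *; lra.
have eA : e ^+ 2 * (- A) / rt <= kap.
  apply: le_trans rtk1; rewrite ler_pM2r ?invr_gt0// mulrN.
  by have := A1b; have := H0; clear => *; lra.
have [h1 h2 h3] := hk e A B _ _ _ e01 r6 LB LA rep' w0 (le_trans wB rk) (le_trans wA rk)
  (le_trans pA tau) (le_trans pB tau) rti eB eA energy.
exists A, B; split => //; split.
  rewrite -(ler_pM2l e20) mulrN lerNr; apply: (@le_trans _ _ (`|K| * e ^+ 2)).
    by rewrite mulrC ler_pM2r// ler_norm.
  by apply: (le_trans eKH); case/andP: A1.
rewrite -(ler_pM2l e20); apply: (@le_trans _ _ (`|K| * e ^+ 2)).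
  by rewrite mulrC ler_pM2r// ler_norm.
by apply: (le_trans eKH); case/andP: B1.
Unshelve. all: by end_near. Qed.

End Profile.

Lemma cvg_ereal0 (R : realType) (h : R -> \bar R) :
  (forall s : R, 0 < s -> \forall e \near 0^'+, exists2 I, h e = I%:E & 0 <= I <= s) ->
  h e @[e --> 0^'+] --> 0%E.
Proof.
move=> hs; apply/fine_cvgP; split.
  by apply: filterS (hs 1 ltr01) => e [I ->].
apply/cvgrPdist_le => s s0; apply: filterS (hs s s0) => e [I /= -> /andP[I0 Is]].
by rewrite sub0r normrN /= ger0_norm.
Qed.
Unset Implicit Arguments.
(* The values u_eps(x) refer to the continuous representative of u_eps, whence
   the continuity hypothesis on u. *)
Theorem theorem3p2 (R : realType) (beta : R) (f : R -> R)
    (u : R -> R -> R) (xe : R -> R) (x0 H V Lambda : R)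
    (beta_gt0 : 0 < beta)
    (f_C1 : C1_closed 0 1 f)
    (u_min : forall eps : R, 0 < eps < 1 -> PMF_minimizer eps beta f 0 1 (u eps))
    (u_cont : forall eps : R, 0 < eps < 1 -> 
      forall x : R, 0 < x < 1 -> {for x, continuous (u eps)})
    (xe_in : forall eps : R, 0 < eps < 1 -> 0 < xe eps < 1)
    (x0_in : 0 < x0 < 1)
    (xe_cvg : xe eps @[eps --> 0^'+] --> x0)
    (df_neq0 : derive1 f x0 != 0)
    (H_def : H = (24 / (beta ^+ 2 * `|derive1 f x0| ^+ 3)) `^ (5^-1))
    (V_def : V = derive1 f x0 * H)
    (Lambda_def : Lambda = Num.sqrt 3 / 2 * Num.sqrt (2 * `|V|))
    (v_cvg : BVloc_strict_cvg (blow_up u xe)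
               (fun y => canonical_staircase H V (y - H) + V)) :
  H2loc_cvg (fun eps y => blow_up u xe eps (eps ^+ 2 * y))
            (cubic_connection Lambda V).
Proof.
have d0 : 0 < `|derive1 f x0| by rewrite normr_gt0.
have H0 : 0 < H by rewrite H_def powR_gt0// divr_gt0// mulr_gt0// exprn_gt0.
have V0 : V != 0 by rewrite V_def mulf_neq0// gt_eqF.
have v0 : 0 < `|V| by rewrite normr_gt0.
have L0 : 0 < Lambda.
  by rewrite Lambda_def mulr_gt0 ?divr_gt0// sqrtr_gt0// mulr_gt0.
have LV : Lambda ^+ 2 = 3 / 2 * `|V|.
  by rewrite Lambda_def !exprMn !sqr_sqrtr// ?mulr_ge0//; field.
have repC := h2rep_connection V L0.
move=> a b ab; pose K := Num.max Lambda (Num.max `|a| `|b|).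
have LK : Lambda <= K by rewrite le_max lexx.
have aK : - K <= a.
  by rewrite lerNl (le_trans (ler_norm _))// normrN !le_max lexx !orbT.
have bK : b <= K by rewrite (le_trans (ler_norm b))// !le_max lexx !orbT.
pose M := 4 * K * (1 + 4 * K) * (1 + K ^+ 2) + 2.
have K0 : 0 <= K by rewrite (le_trans (ltW L0)).
have M0 : 0 < M.
  rewrite /M ltr_wpDl// mulr_ge0 ?addr_ge0 ?sqr_ge0//.
  by rewrite !mulr_ge0// addr_ge0// mulr_ge0.
have near_rep rho : 0 < rho -> rho <= 1 -> \forall e \near 0^'+, exists w p g,
    [/\ h2rep w p g, forall y, a < y < b -> blow_up u xe e (e ^+ 2 * y) = w y &
    Int (fun y => (w y - cubic_connection Lambda V y) ^+ 2
      + (p y - connection_p Lambda V y) ^+ 2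
      + (g y - connection_g Lambda V y) ^+ 2) a b <= M * rho].
  move=> rho0 rho1; near=> e.
  have e01 : 0 < e < 1 by near: e; exact: near_unit.
  have [U [P [G [rep uU]]]] := H2_h2rep ltr01 (u_min e e01).1 (u_cont e e01).
  have [A [B /= [[AK KB] [xA xB] h1 h2 h3]]] :
      exists A B, let p := blow_p e P (xe e) in let g := blow_g e G (xe e) in
      let sg := Num.sg V in
      [/\ A <= - K /\ K <= B,
        0 < xe e + omega e * e ^+ 2 * A /\ xe e + omega e * e ^+ 2 * B < 1,
        `|p Lambda| <= rho,
        Int (fun y => (g y + sg * (2 / Lambda) * y) ^+ 2) 0 Lambda
          + Int (fun y => g y ^+ 2) Lambda B <= rho &
        Int (fun y => (g y + sg * (2 / Lambda) * y) ^+ 2) (- Lambda) 0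
          + Int (fun y => g y ^+ 2) A (- Lambda) <= rho].
    move: U P G rep uU; near: e.
    exact: (near_transition_profile beta_gt0 f_C1 u_min x0_in xe_cvg H0 V0 L0 LV v_cvg K rho0).
  have /andP[e0 _] := e01; have k0 : 0 < omega e * e ^+ 2.
    by rewrite mulr_gt0 ?omega_gt0// exprn_gt0.
  have rep' := blow_h2rep (xe e) e01 rep.
  exists (blow_w e U (xe e)), (blow_p e P (xe e)), (blow_g e G (xe e)); split => //.
    move=> y /andP[ay yb]; rewrite /blow_up /blow_w mulrA !uU ?xe_in//.
    apply/andP; split.
      apply: (lt_le_trans xA); rewrite lerD2l ler_pM2l//.
      by rewrite (le_trans AK)// (le_trans aK)// ltW.
    apply: (le_lt_trans _ xB); rewrite lerD2l ler_pM2l//.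
    by rewrite (le_trans (ltW yb))// (le_trans bK).
  apply: (connection_stability L0 LV (ltW rho0) rho1 rep' _ LK AK KB aK (ltW ab) bK) => //.
  by rewrite /blow_w mulr0 addr0 subrr mul0r.
split.
- by have [] := h2rep_weakD ab repC (fun x _ => erefl).
- apply: filterS (near_rep 1 ltr01 (lexx 1)) => e [w [p [g [rep vw _]]]].
  by have [] := h2rep_weakD ab rep vw.
apply: cvg_ereal0 => s s0; pose rho := Num.min 1 (s / M).
have rho0 : 0 < rho by rewrite lt_min ltr01 divr_gt0.
have rho1 : rho <= 1 by rewrite ge_min lexx.
have rhos : M * rho <= s by rewrite mulrC -ler_pdivlMr// ge_min lexx orbT.
apply: filterS (near_rep rho rho0 rho1) => e [w [p [g [rep vw bound]]]].
have repd := h2repB rep repC.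
exists (Int (fun y => (w y - cubic_connection Lambda V y) ^+ 2
      + (p y - connection_p Lambda V y) ^+ 2
      + (g y - connection_g Lambda V y) ^+ 2) a b).
  by apply: (H2_normsq_h2rep ab repd) => y yab /=; rewrite vw.
apply/andP; split; last exact: le_trans rhos.
by apply: Int_ge0 => y _; rewrite !addr_ge0// sqr_ge0.
Unshelve. all: by end_near. Qed.
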